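(* Let $G$ be a complex simple Lie group with Borel subgroup $B$, maximal torus $T\subset B$, Weyl group $W$ and weight lattice $P$, such that $e^\lambda\mapsto\chi^\lambda$ is an isomorphism $\iota:\mathbb{Z}[P]\to R(T)$ onto the representation ring of $T$. Let $\mathcal{B}_T(V_W)$ be the $R(T)$-algebra, and $\Xi^{[\lambda]}_{\rm eq}\in\mathcal{B}_T(V_W)$, $\lambda\in P$, the elements, defined in the context. Then the subalgebra $R(T)[\Xi^{[\lambda]}_{\rm eq},\ \lambda\in P]$ of $\mathcal{B}_T(V_W)$, generated over $R(T)$ by the elements $\Xi^{[\lambda]}_{\rm eq}$, is isomorphic as an $R(T)$-algebra to the $T$-equivariant $K$-ring $K_T(G/B)$.
   Context: **Roots.** $\Delta$ is the root system of $G$, $\Delta_+$ the positive roots corresponding to $B$, $\alpha^\vee=2\alpha/\langle\alpha,\alpha\rangle$, $\rho=\frac12\sum_{\beta\in\Delta_+}\beta$, $h$ the Coxeter number, $P\subset\mathfrak{h}^*$ the weight lattice, $s_\alpha\in W$ the reflection in $\alpha$. **Nichols-Woronowicz algebra.** For a finite-dimensional $\mathbb{Q}$-vector space $V$ with a linear automorphism $\psi$ of $V\otimes V$ satisfying the braid relation, let $\psi_i$ denote $\psi$ applied to the $i$-th and $(i+1)$-st factors of $V^{\otimes n}$. For $w\in S_n$ with reduced decomposition $w=s_{i_1}\cdots s_{i_l}$ put $\Psi_w=\psi_{i_1}\cdots\psi_{i_l}$ (independent of the decomposition), and let $\sigma_n(\psi)=\sum_{w\in S_n}\Psi_w$. Then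 $\mathcal{B}(V):=T(V)/\bigoplus_{n\ge0}\mathrm{Ker}(\sigma_n(\psi))$ (here $T(V)$ is the tensor algebra). **The module $V_W$.** $V_W$ is the $\mathbb{Q}$-vector space spanned by symbols $[\alpha]$, $\alpha\in\Delta$, modulo the relations $[-\alpha]=-[\alpha]$. $W$ acts by $w([\alpha])=[w(\alpha)]$, and $[\alpha]$ has $W$-degree $s_\alpha$. The braiding is $\psi([\alpha]\otimes[\beta])=[s_\alpha(\beta)]\otimes[\alpha]$. The algebra $\mathcal{B}(V_W)$ is $W$-graded (degrees multiply). **The algebra $\mathcal{B}_T(V_W)$.** Let $P'=h^{-1}P\subset\mathfrak{h}^*$ and let $\mathbb{Z}[P']$ be its group algebra with basis $X^\lambda$, $\lambda\in P'$, with $W$ acting by $w(X^\lambda)=X^{w(\lambda)}$. Let $\mathcal{B}(V_W)\langle P'\rangle=\mathbb{Z}[P']\otimes\mathcal{B}(V_W)$ with the associative multiplication for which $\mathbb{Z}[P']$ and $\mathcal{B}(V_W)$ are subalgebras and $x\cdot X=w_x(X)\cdot x$ for $X\in\mathbb{Z}[P']$ and $x\in\mathcal{B}(V_W)$ homogeneous of $W$-degree $w_x$; in particular $[\alpha]X^\lambda=X^{s_\alpha(\lambda)}[\alpha]$. The ring $\mathbb{Z}[P]^W\subset\mathbb{Z}[P']$ (with $e^\lambda=X^\lambda$) maps to $R(T)$ via $\iota$, and $\mathcal{B}_T(V_W):=R(T)\otimes_{\mathbb{Z}[P]^W}\mathcal{B}(V_W)\langle P'\rangle$. **The elements $\Xi^{[\lambda]}_{\rm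 eq}$.** For $\alpha\in\Delta$, $k\in\mathbb{Z}$ let $H_{\alpha,k}=\{\lambda\mid\langle\lambda,\alpha^\vee\rangle=k\}$ in the real span of the roots. Alcoves are the connected components of the complement of all the $H_{\alpha,k}$. The fundamental alcove is $A_\circ=\{\lambda\mid 0<\langle\lambda,\alpha^\vee\rangle<1\ \forall\alpha\in\Delta_+\}$. An alcove path is a sequence $(A_0,\ldots,A_l)$ of alcoves with $A_i\ne A_{i+1}$ having a common wall. Write $A_i\xrightarrow{\ \beta\ }A_{i+1}$ if the common wall lies in some $H_{\beta,k}$ and the root $\beta$ points in the direction from $A_i$ to $A_{i+1}$. For $\lambda\in P$, a $\lambda$-chain is a sequence of roots $(\beta_1,\ldots,\beta_l)$ arising from an alcove path $A_0\xrightarrow{-\beta_1}\cdots\xrightarrow{-\beta_l}A_l$ with $A_0=A_\circ$ and $A_l=A_\circ-\lambda$. Put $H_\alpha=X^{\rho/h}\,(X^{\alpha/h}+[\alpha])\,X^{-\rho/h}\in\mathcal{B}_T(V_W)$ for $\alpha\in\Delta$, and $\Xi^{[\lambda]}_{\rm eq}=H_{\beta_l}\cdots H_{\beta_1}$ for any $\lambda$-chain (the result does not depend on the chain). **Equivariant $K$-ring.** $K_T(G/B)$ is identified with the $R(T)$-algebra $R(T)[P]/J$, where $R(T)[P]=R(T)\otimes\mathbb{Z}[P]$ is the group algebra with basis $e^\lambda$, $\lambda\in P$, over $R(T)$, and $J$ is the ideal generated by $f-\iota(f)$, $f\in\mathbb{Z}[P]^W$. *)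

(* Defs.v *)
From HB Require Import structures.
From mathcomp Require Import all_boot all_order all_algebra all_fingroup finmap.
From mathcomp Require Import generic_quotient archimedean.
From mathcomp Require Import mathcomp_extra boolp classical_sets reals topology.
From mathcomp Require Import normedtype.

Set Implicit Arguments.
Unset Strict Implicit.
Unset Printing Implicit Defensive.

Import Order.TTheory GRing.Theory Num.Theory.
Import numFieldNormedType.Exports.

Local Open Scope ring_scope.

Definition monalg (k : nzRingType) (M : monoidType) : Type :=
  {fsfun M -> k with 0}.

Section MonoidAlgebra.
Variables (k : nzRingType) (M : monoidType).

HB.instance Definition _ := Choice.on (monalg k M).

Implicit Types (f g : monalg k M) (x y : M) (c : k).

Definition mcoef x f : k := (f : {fsfun M -> k with 0}) x.
Definition msupp f : {fset M} := finsupp (f : {fsfun M -> k with 0}).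
Definition mterm x c : monalg k M := [fsfun y in [fset x]%fset => c | 0].

Definition mzero : monalg k M := [fsfun].
Definition mopp f : monalg k M := [fsfun x in msupp f => - mcoef x f | 0].
Definition madd f g : monalg k M :=
  [fsfun x in (msupp f `|` msupp g)%fset => mcoef x f + mcoef x g | 0].

Lemma monalgP f g : (forall x, mcoef x f = mcoef x g) -> f = g.
Proof. by move=> fg; apply/fsfunP => x; exact: fg. Qed.

Lemma mcoef_outdom f x : x \notin msupp f -> mcoef x f = 0.
Proof. exact: fsfun_dflt. Qed.

Lemma mcoef_neq0 f x : (mcoef x f != 0) = (x \in msupp f).
Proof. by rewrite /msupp mem_finsupp. Qed.

Lemma mcoef_term c x y : mcoef y (mterm x c) = c *+ (x == y).
Proof. by rewrite /mcoef fsfunE !inE eq_sym; case: eqP. Qed.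

Let mzeroE x : mcoef x mzero = 0.
Proof. by rewrite /mcoef fsfunE. Qed.

Let moppE f x : mcoef x (mopp f) = - mcoef x f.
Proof.
rewrite {1}/mcoef fsfunE; case: ifPn => // /mcoef_outdom ->.
by rewrite oppr0.
Qed.

Let maddE f g x : mcoef x (madd f g) = mcoef x f + mcoef x g.
Proof.
rewrite {1}/mcoef fsfunE inE; case: ifPn => //.
by rewrite negb_or => /andP[/mcoef_outdom -> /mcoef_outdom ->]; rewrite addr0.
Qed.

Let maddA : associative madd.
Proof. by move=> f g e; apply/monalgP => x; rewrite !maddE addrA. Qed.
Let maddC : commutative madd.
Proof. by move=> f g; apply/monalgP => x; rewrite !maddE addrC. Qed.
Let madd0 : left_id mzero madd.
Proof. by move=> f; apply/monalgP => x; rewrite maddE mzeroE add0r. Qed.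
Let maddN : left_inverse mzero mopp madd.
Proof. by move=> f; apply/monalgP => x; rewrite maddE moppE mzeroE addNr. Qed.

HB.instance Definition _ :=
  GRing.isZmodule.Build (monalg k M) maddA maddC madd0 maddN.

Lemma mcoef_is_zmod x : zmod_morphism (mcoef x).
Proof. by move=> f g; rewrite maddE moppE. Qed.
HB.instance Definition _ x :=
  GRing.isZmodMorphism.Build (monalg k M) k (mcoef x) (mcoef_is_zmod x).

Lemma mterm_is_zmod x : zmod_morphism (mterm x).
Proof.
by move=> c d; apply/monalgP => y; rewrite raddfB /= !mcoef_term mulrnBl.
Qed.
HB.instance Definition _ x :=
  GRing.isZmodMorphism.Build k (monalg k M) (mterm x) (mterm_is_zmod x).

Lemma mterm0 x : mterm x 0 = 0.
Proof. exact: (raddf0 (mterm x)). Qed.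

Lemma msupp_term c x : (msupp (mterm x c) `<=` [fset x])%fset.
Proof.
apply/fsubsetP => y; rewrite -mcoef_neq0 mcoef_term inE.
by case: (eqVneq y x) => // xy; rewrite mulr0n eqxx.
Qed.

Lemma monalgEw (d : {fset M}) f : (msupp f `<=` d)%fset ->
  f = \sum_(x <- d) mterm x (mcoef x f).
Proof.
move/fsubsetP => fd; apply/monalgP => x; rewrite raddf_sum /=.
have [xf|xf] := boolP (x \in msupp f).
  rewrite (big_fsetD1 x) ?fd //= mcoef_term eqxx mulr1n big1_fset ?addr0 //.
  by move=> y; rewrite !inE mcoef_term => /andP[/negbTE ->].
rewrite big1_fset ?mcoef_outdom// => y _ _; rewrite mcoef_term.
by case: eqP => // ->; rewrite mcoef_outdom.
Qed.

Lemma monalgE f : f = \sum_(x <- msupp f) mterm x (mcoef x f).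
Proof. exact: monalgEw. Qed.

Definition mmul f g : monalg k M :=
  \sum_(x <- msupp f) \sum_(y <- msupp g)
    mterm (x * y)%g (mcoef x f * mcoef y g).

Definition mone : monalg k M := mterm 1%g 1.

Let mmulw (d e : {fset M}) f g :
  (msupp f `<=` d)%fset -> (msupp g `<=` e)%fset ->
  mmul f g = \sum_(x <- d) \sum_(y <- e)
    mterm (x * y)%g (mcoef x f * mcoef y g).
Proof.
move=> fd ge; rewrite /mmul (big_fset_incl _ fd) /=; last first.
  by move=> x _ /mcoef_outdom xf; rewrite big1// => y _; rewrite xf mul0r mterm0.
apply: eq_bigr => x _; apply: big_fset_incl => // y _ /mcoef_outdom ->.
by rewrite mulr0 mterm0.
Qed.

Let mmulDl : left_distributive mmul +%R.
Proof.
move=> f g e; pose d := (msupp f `|` msupp g `|` msupp (f + g)%R)%fset.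
have [fd gd fgd] : [/\ msupp f `<=` d, msupp g `<=` d & msupp (f + g)%R `<=` d]%fset.
  by split; apply/fsubsetP => x; rewrite !inE => ->; rewrite ?orbT.
rewrite (mmulw fd (fsubset_refl _)) (mmulw gd (fsubset_refl _)).
rewrite (mmulw fgd (fsubset_refl _)).
rewrite -big_split; apply: eq_bigr => x _ /=.
rewrite -big_split; apply: eq_bigr => y _ /=.
by rewrite raddfD /= mulrDl (raddfD (mterm _)).
Qed.

Let mmulDr : right_distributive mmul +%R.
Proof.
move=> e f g; pose d := (msupp f `|` msupp g `|` msupp (f + g)%R)%fset.
have [fd gd fgd] : [/\ msupp f `<=` d, msupp g `<=` d & msupp (f + g)%R `<=` d]%fset.
  by split; apply/fsubsetP => x; rewrite !inE => ->; rewrite ?orbT.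
rewrite (mmulw (fsubset_refl _) fd) (mmulw (fsubset_refl _) gd).
rewrite (mmulw (fsubset_refl _) fgd).
rewrite -big_split; apply: eq_bigr => x _ /=.
rewrite -big_split; apply: eq_bigr => y _ /=.
by rewrite raddfD /= mulrDr (raddfD (mterm _)).
Qed.

Let mmul0g : left_zero 0 mmul.
Proof. by move=> f; apply: (addIr (mmul 0 f)); rewrite -mmulDl !add0r. Qed.
Let mmulg0 : right_zero 0 mmul.
Proof. by move=> f; apply: (addIr (mmul f 0)); rewrite -mmulDr !add0r. Qed.

Let mmulTT c d x y : mmul (mterm x c) (mterm y d) = mterm (x * y)%g (c * d).
Proof.
rewrite (mmulw (msupp_term _ _) (msupp_term _ _)) !big_seq_fset1.
by rewrite !mcoef_term !eqxx !mulr1n.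
Qed.

Let mmul_suml I (r : seq I) (F : I -> monalg k M) g :
  mmul (\sum_(i <- r) F i) g = \sum_(i <- r) mmul (F i) g.
Proof.
by apply: (big_morph (mmul^~ g)) => [f h|]; rewrite ?mmulDl ?mmul0g.
Qed.

Let mmul_sumr I (r : seq I) (F : I -> monalg k M) g :
  mmul g (\sum_(i <- r) F i) = \sum_(i <- r) mmul g (F i).
Proof. by apply: (big_morph (mmul g)) => [f h|]; rewrite ?mmulDr ?mmulg0. Qed.

Let mmulA : associative mmul.
Proof.
move=> f g e; rewrite (monalgE f) (monalgE g) (monalgE e).
rewrite !mmul_suml; apply: eq_bigr => x _.
rewrite [LHS]mmul_sumr [X in _ = mmul X _]mmul_sumr [RHS]mmul_suml.
apply: eq_bigr => y _.
rewrite !mmul_sumr; apply: eq_bigr => z _.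
by rewrite !mmulTT mulrA mulgA.
Qed.

Let mmul1g : left_id mone mmul.
Proof.
move=> f; rewrite {1}(monalgE f) mmul_sumr [RHS]monalgE.
by apply: eq_bigr => x _; rewrite mmulTT mul1r mul1g.
Qed.

Let mmulg1 : right_id mone mmul.
Proof.
move=> f; rewrite {1}(monalgE f) mmul_suml [RHS]monalgE.
by apply: eq_bigr => x _; rewrite mmulTT mulr1 mulg1.
Qed.

Let mone_neq0 : mone != 0.
Proof.
apply/eqP => /(congr1 (mcoef 1%g)) /eqP.
by rewrite raddf0 /= mcoef_term eqxx mulr1n oner_eq0.
Qed.

HB.instance Definition _ := GRing.Zmodule_isNzRing.Build (monalg k M)
  mmulA mmul1g mmulg1 mmulDl mmulDr mone_neq0.

Lemma mtermM c d x y : mterm x c * mterm y d = mterm (x * y)%g (c * d).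
Proof. exact: mmulTT. Qed.

Definition mbasis x : monalg k M := mterm x 1.
Definition mconst c : monalg k M := mterm 1%g c.

(* The additive extension of [g : M -> A] along [u : k -> A]. *)
Definition mextend (A : pzRingType) (u : k -> A) (g : M -> A) f : A :=
  \sum_(x <- msupp f) u (mcoef x f) * g x.

End MonoidAlgebra.

Section RingQuotient.
Local Open Scope quotient_scope.
Variables (A : pzRingType) (S : set A).

Definition two_sided_ideal (I : set A) : Prop :=
  [/\ I 0, forall x y, I x -> I y -> I (x - y) &
      forall a x b, I x -> I (a * x * b)].

Definition ideal_gen : set A := smallest two_sided_ideal S.

Lemma ideal_genP : two_sided_ideal ideal_gen.
Proof.
split=> [I [[]]//|x y Ix Iy I [II SI]|a x b Ix I [II SI]].
  by have [_ + _] := II; apply; [exact: Ix|exact: Iy].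
by have [_ _] := II; apply; exact: Ix.
Qed.

Lemma ideal_genN x : ideal_gen x -> ideal_gen (- x).
Proof. by have [I0 IB _] := ideal_genP => /(IB _ _ I0); rewrite sub0r. Qed.

Lemma ideal_genD x y : ideal_gen x -> ideal_gen y -> ideal_gen (x + y).
Proof.
by have [_ IB _] := ideal_genP => Ix /ideal_genN /(IB _ _ Ix); rewrite opprK.
Qed.

Definition ring_quot_eqv (x y : A) : bool := `[< ideal_gen (x - y) >].

Lemma ring_quot_eqv_equiv : equiv_class_of ring_quot_eqv.
Proof.
split=> [x|x y|y x z]; rewrite /ring_quot_eqv.
- by apply/asboolP; rewrite subrr; have [] := ideal_genP.
- by apply/asboolP/asboolP => /ideal_genN; rewrite opprB.
- move=> /asboolP xy /asboolP yz; apply/asboolP.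
  by rewrite -[x](addrNK y) -addrA; exact: ideal_genD.
Qed.

Canonical ring_quot_equiv := EquivRelPack ring_quot_eqv_equiv.
Canonical ring_quot_encModRel := defaultEncModRel ring_quot_eqv.

Definition ring_quot := {eq_quot ring_quot_eqv}.
HB.instance Definition _ : EqQuotient A ring_quot_eqv ring_quot :=
  EqQuotient.on ring_quot.
HB.instance Definition _ := Choice.on ring_quot.

Definition rq_zero : ring_quot := lift_cst ring_quot 0.
Definition rq_one : ring_quot := lift_cst ring_quot 1.
Definition rq_opp := lift_op1 ring_quot -%R.
Definition rq_add := lift_op2 ring_quot +%R.
Definition rq_mul := lift_op2 ring_quot *%R.
Canonical pi_rq_zero := PiConst rq_zero.
Canonical pi_rq_one := PiConst rq_one.

Let eqvP (x y : A) :
  reflect (ideal_gen (x - y)) (x == y %[mod ring_quot]).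
Proof. by rewrite piE; exact: asboolP. Qed.

Let repr_eqv (x : A) : ideal_gen (x - repr (\pi_ring_quot x)).
Proof. by apply/eqvP; rewrite reprK. Qed.

Lemma pi_rq_opp_subproof : {morph \pi_ring_quot : x / - x >-> rq_opp x}.
Proof.
move=> x; unlock rq_opp; apply/eqP/eqvP.
by rewrite -opprD; apply: ideal_genN; exact: repr_eqv.
Qed.
Canonical pi_rq_opp := PiMorph1 pi_rq_opp_subproof.

Lemma pi_rq_add_subproof : {morph \pi_ring_quot : x y / x + y >-> rq_add x y}.
Proof.
move=> x y; unlock rq_add; apply/eqP/eqvP.
by rewrite opprD addrACA; apply: ideal_genD; exact: repr_eqv.
Qed.
Canonical pi_rq_add := PiMorph2 pi_rq_add_subproof.

Lemma pi_rq_mul_subproof : {morph \pi_ring_quot : x y / x * y >-> rq_mul x y}.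
Proof.
move=> x y; unlock rq_mul; apply/eqP/eqvP.
have [_ _ IM] := ideal_genP.
rewrite -[x * y](addrNK (x * repr (\pi_ring_quot y))) -mulrBr -addrA -mulrBl.
apply: ideal_genD.
  by rewrite -[_ * _]mulr1; apply: IM; exact: repr_eqv.
by rewrite -[_ - _]mul1r; apply: IM; exact: repr_eqv.
Qed.
Canonical pi_rq_mul := PiMorph2 pi_rq_mul_subproof.

Let rq_addA : associative rq_add.
Proof. by move=> x y z; rewrite -[x]reprK -[y]reprK -[z]reprK !piE addrA. Qed.
Let rq_addC : commutative rq_add.
Proof. by move=> x y; rewrite -[x]reprK -[y]reprK !piE addrC. Qed.
Let rq_add0 : left_id rq_zero rq_add.
Proof. by move=> x; rewrite -[x]reprK !piE add0r. Qed.
Let rq_addN : left_inverse rq_zero rq_opp rq_add.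
Proof. by move=> x; rewrite -[x]reprK !piE addNr. Qed.

HB.instance Definition _ :=
  GRing.isZmodule.Build ring_quot rq_addA rq_addC rq_add0 rq_addN.

Let rq_mulA : associative rq_mul.
Proof. by move=> x y z; rewrite -[x]reprK -[y]reprK -[z]reprK !piE mulrA. Qed.
Let rq_mul1 : left_id rq_one rq_mul.
Proof. by move=> x; rewrite -[x]reprK !piE mul1r. Qed.
Let rq_mulr1 : right_id rq_one rq_mul.
Proof. by move=> x; rewrite -[x]reprK !piE mulr1. Qed.
Let rq_mulDl : left_distributive rq_mul rq_add.
Proof. by move=> x y z; rewrite -[x]reprK -[y]reprK -[z]reprK !piE mulrDl. Qed.
Let rq_mulDr : right_distributive rq_mul rq_add.
Proof. by move=> x y z; rewrite -[x]reprK -[y]reprK -[z]reprK !piE mulrDr. Qed.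

(* [pzRingType]: the quotient may be the zero ring. *)
HB.instance Definition _ := GRing.Zmodule_isPzRing.Build ring_quot
  rq_mulA rq_mul1 rq_mulr1 rq_mulDl rq_mulDr.

Definition to_quot (x : A) : ring_quot := \pi x.

Lemma to_quot_is_zmod : zmod_morphism to_quot.
Proof. by move=> x y; rewrite /to_quot !piE. Qed.
HB.instance Definition _ :=
  GRing.isZmodMorphism.Build A ring_quot to_quot to_quot_is_zmod.

Lemma to_quot_is_monoid : monoid_morphism to_quot.
Proof. by split=> [|x y]; rewrite /to_quot !piE. Qed.
HB.instance Definition _ :=
  GRing.isMonoidMorphism.Build A ring_quot to_quot to_quot_is_monoid.

End RingQuotient.

Definition mulpair (B A : Type) : Type := (B * A)%type.
HB.instance Definition _ (B A : choiceType) :=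
  Choice.copy (mulpair B A) (B * A)%type.

Section MulPair.
Variables B A : pzRingType.
Implicit Types x y z : mulpair B A.

Definition mp_mul x y : mulpair B A := (x.1 * y.1, x.2 * y.2).
Definition mp_one : mulpair B A := (1, 1).

Let mp_mulA : associative mp_mul.
Proof. by move=> x y z; rewrite /mp_mul !mulrA. Qed.
Let mp_mul1 : left_id mp_one mp_mul.
Proof. by case=> b a; rewrite /mp_mul !mul1r. Qed.
Let mp_mulr1 : right_id mp_one mp_mul.
Proof. by case=> b a; rewrite /mp_mul !mulr1. Qed.

HB.instance Definition _ :=
  isMonoid.Build (mulpair B A) mp_mulA mp_mul1 mp_mulr1.
End MulPair.

(* The tensor product of rings [B (x)_D A] over a subring [D] of [S], where
   [S] acts through [f : S -> B] and [g : S -> A], the images of [D] being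
   central.  It is the free abelian group on the pairs [(b, a)] modulo
   biadditivity and balancedness, with [(b (x) a)(b' (x) a') = bb' (x) aa'];
   as the images of [D] are central, the relators already span a two-sided
   ideal. *)

Section Tensor.
Variables (S B A : pzRingType) (D : set S) (f : S -> B) (g : S -> A).

Let pure (b : B) (a : A) : monalg int (mulpair B A) :=
  mbasis int ((b, a) : mulpair B A).

Inductive tensor_rel : set (monalg int (mulpair B A)) :=
| tensor_rel_addl b b' a :
    tensor_rel (pure (b + b') a - pure b a - pure b' a)
| tensor_rel_addr b a a' :
    tensor_rel (pure b (a + a') - pure b a - pure b a')
| tensor_rel_balanced s b a :
    D s -> tensor_rel (pure (b * f s) a - pure b (g s * a)).

Definition tensor := ring_quot tensor_rel.
HB.instance Definition _ := GRing.PzRing.on tensor.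

Definition tens (b : B) (a : A) : tensor := to_quot tensor_rel (pure b a).

End Tensor.

Definition word (I : Type) : Type := seq I.
HB.instance Definition _ (I : choiceType) := Choice.copy (word I) (seq I).
HB.instance Definition _ (I : choiceType) :=
  isMonoid.Build (word I) (@catA I) (@cat0s I) (@cats0 I).

Section Nichols.
(* [V] is the rational vector space with basis [e_i], [i : I]; its tensor
   algebra is the algebra of the free monoid, a word of length [n] being a basis
   tensor of [V^{(x) n}].  The braiding is given by
   [psi i j = psi(e_i (x) e_j)], a combination of words of length 2. *)
Variable I : choiceType.
Local Notation TV := (monalg rat (word I)).
Variable psi : I -> I -> TV.

(* [psi] applied to the factors number [i] and [i + 1], counted from 0. *)
Definition psi_word (i : nat) (t : word I) : TV :=
  if drop i t is a :: b :: u
  then mbasis rat (take i t : word I) * psi a b * mbasis rat (u : word I)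
  else mbasis rat t.
Definition psi_at (i : nat) (x : TV) : TV :=
  mextend (@mconst rat (word I)) (psi_word i) x.

Definition adj_transp (n i : nat) : 'S_n :=
  match n with m.+1 => tperm (inord i) (inord i.+1) | 0 => 1%g end.
Definition decomposition (n : nat) (w : 'S_n) (s : seq nat) : Prop :=
  all (fun i => i.+1 < n)%N s /\ w = (\prod_(i <- s) adj_transp n i)%g.
Definition reduced_decomposition (n : nat) (w : 'S_n) (s : seq nat) : Prop :=
  decomposition w s /\
  forall s', decomposition w s' -> (size s <= size s')%N.

(* A chosen reduced decomposition of [w]; by the braid relation [Psi w] does not
   depend on the choice. *)
Definition reduced_word (n : nat) (w : 'S_n) : seq nat :=
  xget [::] [set s | reduced_decomposition w s]%classic.
Definition Psi (n : nat) (w : 'S_n) (x : TV) : TV :=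
  foldr psi_at x (reduced_word w).
Definition braided_sym (n : nat) (x : TV) : TV := \sum_(w : 'S_n) Psi w x.

(* The union of the kernels of the [sigma_n] on [V^{(x) n}].  Their direct sum is
   a two-sided ideal, hence the ideal generated by this set, and
   [B(V) = ring_quot nichols_rel]. *)
Definition nichols_rel : set TV :=
  [set x | exists2 n : nat,
     forall t : word I, t \in msupp x -> size t = n & braided_sym n x = 0]%classic.

End Nichols.

Section Roots.
Variables (R : realType) (n : nat).
Local Notation V := 'rV[R]_n.

Definition dotv (u v : V) : R := (u *m v^T) 0 0.
(* [<v, a^vee>] *)
Definition copair (v a : V) : R := 2 * dotv v a / dotv a a.
Definition refl (a v : V) : V := v - copair v a *: a.

(* The roots of a complex simple Lie group of rank [n], in the real span of the
   roots identified isometrically with [R^n], and the positive roots of a Borel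
   subgroup. *)
Record root_datum := RootDatum {
  Delta : {fset V};
  Deltap : {fset V};
  root_span : (<<Delta>> = fullv)%VS;
  root_neq0 : 0 \notin Delta;
  root_refl : forall a b, a \in Delta -> b \in Delta -> refl a b \in Delta;
  root_int : forall a b, a \in Delta -> b \in Delta ->
    copair b a \is a Num.int;
  root_reduced : forall a (c : R), a \in Delta -> c *: a \in Delta ->
    c = 1 \/ c = -1;
  root_nonempty : Delta != fset0;
  root_irreducible : forall A B : {fset V}, Delta = (A `|` B)%fset ->
    (forall a b, a \in A -> b \in B -> dotv a b = 0) ->
    A = fset0 \/ B = fset0;
  pos_sub : {subset Deltap <= Delta};
  pos_xor : forall a, a \in Delta -> (a \in Deltap) = (- a \notin Deltap);
  pos_add : forall a b, a \in Deltap -> b \in Deltap -> a + b \in Delta ->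
    a + b \in Deltap
}.

Variable Phi : root_datum.

Definition pos_root (a : Deltap Phi) : Delta Phi :=
  FSetSub (pos_sub (valP a)).

Lemma dotv_neq0 a : a \in Delta Phi -> dotv a a != 0.
Proof.
move=> aD; rewrite /dotv mxE psumr_eq0 => [|i _]; last first.
  by rewrite mxE -expr2 sqr_ge0.
apply: contra (root_neq0 Phi) => /allP h; suff <- : a = 0 by [].
apply/rowP => i; have := h i (mem_index_enum _).
by rewrite !mxE /= mulf_eq0 orbb => /eqP.
Qed.

Lemma copairB u v a : copair (u - v) a = copair u a - copair v a.
Proof. by rewrite /copair /dotv mulmxBl !mxE mulrBr mulrBl. Qed.

Lemma copairZ c v a : copair (c *: v) a = c * copair v a.
Proof. by rewrite /copair /dotv -scalemxAl mxE mulrCA !mulrA. Qed.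

Lemma copair_sum (I : finType) (F : I -> V) a :
  copair (\sum_i F i) a = \sum_i copair (F i) a.
Proof. by rewrite /copair /dotv mulmx_suml summxE mulr_sumr mulr_suml. Qed.

Lemma copair_root a : a \in Delta Phi -> copair a a = 2.
Proof. by move=> aD; rewrite /copair mulfK// dotv_neq0. Qed.

Lemma reflK a : a \in Delta Phi -> involutive (refl a).
Proof.
move=> aD v; rewrite /refl copairB copairZ copair_root //.
by rewrite mulr_natr mulr2n opprD addrA subrr sub0r scaleNr opprK subrK.
Qed.

Lemma refl_opp a v : refl a (- v) = - refl a v.
Proof.
by rewrite /refl -scaleN1r copairZ -scalerA -scalerBr !scaleN1r.
Qed.

Lemma copair_refl a v : a \in Delta Phi -> copair (refl a v) a = - copair v a.
Proof.
move=> aD; rewrite /refl copairB copairZ copair_root //.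
by rewrite mulr_natr mulr2n opprD addrA subrr sub0r.
Qed.

Lemma root_opp a : a \in Delta Phi -> - a \in Delta Phi.
Proof.
move=> aD; have := root_refl aD aD; rewrite /refl copair_root //.
by rewrite scaler_nat mulr2n opprD addrA subrr sub0r.
Qed.

Definition rho : V := 2^-1 *: \sum_(b : Deltap Phi) val b.

Definition simple_root (a : V) : Prop :=
  a \in Deltap Phi /\
  forall b c, b \in Deltap Phi -> c \in Deltap Phi -> a <> b + c.

(* [h] is the order of a Coxeter element. *)
Definition coxeter_number (h : nat) : Prop :=
  exists s : seq V,
    [/\ uniq s, forall a, a \in s <-> simple_root a &
    let cox v := foldr refl v s in
    [/\ (0 < h)%N, forall v, iter h cox v = v &
        forall k, (0 < k < h)%N -> exists v, iter k cox v <> v]].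

(* [lat m] is [m^-1 P] for [m > 0]; in particular [lat 1] is the weight lattice
   [P]. *)
Definition lat_pred (m : nat) : {pred V} :=
  fun v => [forall a : Delta Phi, copair (m%:R *: v) (val a) \is a Num.int].

Lemma lat_closed m : zmod_closed (lat_pred m).
Proof.
split=> [|u v /forallP uP /forallP vP]; apply/forallP => a.
  by rewrite scaler0 /copair /dotv mul0mx mxE mulr0 mul0r rpred0.
by rewrite scalerBr copairB rpredB// ?uP ?vP.
Qed.
HB.instance Definition _ m := GRing.isZmodClosed.Build V (lat_pred m)
  (lat_closed m).

Record lat (m : nat) := Lat { lat_val :> V; lat_valP : lat_val \in lat_pred m }.

HB.instance Definition _ m := [isSub for @lat_val m].
HB.instance Definition _ m := [Choice of lat m by <:].
HB.instance Definition _ m := [SubChoice_isSubZmodule of lat m by <:].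

Lemma lat_refl_subproof m (a : Delta Phi) (l : lat m) :
  refl (val a) (l : V) \in lat_pred m.
Proof.
apply/forallP => b; have /forallP lP := lat_valP l.
rewrite /refl scalerBr scalerA copairB [copair (_ *: val a) _]copairZ -(copairZ _ (lat_val l)).
apply: rpredB; first exact: lP.
by apply: rpredM; [exact: lP|apply: root_int; exact: fsvalP].
Qed.
Definition lat_refl m (a : Delta Phi) (l : lat m) : lat m :=
  Lat (lat_refl_subproof a l).

(* The action of the Weyl group element [s_{a_1} ... s_{a_k}]; all Weyl group
   elements are of this form. *)
Definition lat_act m (u : seq (Delta Phi)) (l : lat m) : lat m :=
  foldr (@lat_refl m) l u.

Lemma lat_incl_subproof m (l : lat 1) : (l : V) \in lat_pred m.
Proof.
apply/forallP => a; have /forallP/(_ a) := lat_valP l.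
rewrite scale1r => lP; rewrite copairZ.
by apply: rpredM; [exact: rpred_nat|exact: lP].
Qed.
Definition lat_incl m (l : lat 1) : lat m := Lat (lat_incl_subproof m l).

Lemma lat_div_subproof m (l : lat 1) : m%:R^-1 *: (l : V) \in lat_pred m.
Proof.
apply/forallP => a; have /forallP/(_ a) := lat_valP l.
rewrite scale1r scalerA; have [->|m0] := eqVneq (m%:R : R) 0.
  by rewrite mul0r copairZ mul0r.
by rewrite divff// scale1r.
Qed.
Definition lat_div m (l : lat 1) : lat m := Lat (lat_div_subproof m l).

Lemma root_lat_subproof (a : Delta Phi) : val a \in lat_pred 1.
Proof.
by apply/forallP => b; rewrite scale1r; apply: root_int; exact: fsvalP.
Qed.
Definition root_lat (a : Delta Phi) : lat 1 := Lat (root_lat_subproof a).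


Lemma addF2 (x : 'F_2) : x + x = 0.
Proof. by rewrite -mulr2n -mulr_natr (pchar_Fp_0 (isT : prime 2)) mulr0. Qed.

Lemma sum_involution_F2 (T : finType) (F : T -> 'F_2) (t : T -> T) :
  involutive t -> (forall x, F (t x) = F x) ->
  (forall x, t x = x -> F x = 0) -> \sum_x F x = 0.
Proof.
move=> tK Ft F0; pose P x := (enum_rank x < enum_rank (t x))%N.
rewrite (bigID P) /= [X in _ + X](bigID (fun x => t x == x)) /=.
rewrite [X in _ + (X + _)]big1 ?add0r => [|x /andP[_ /eqP /F0]//].
rewrite [X in _ + X](reindex_inj (inv_inj tK)) /=.
rewrite [X in _ + X](eq_big P F) => [|x|x _]; last 2 first.
- rewrite /P !tK -leqNgt ltn_neqAle andbC; congr (_ && _).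
  by rewrite [in RHS]eq_sym -(inj_eq (@enum_rank_inj T)) (inj_eq val_inj) eq_sym.
- exact: Ft.
exact: addF2.
Qed.

Lemma rho_lat_subproof : rho \in lat_pred 1.
Proof.
apply/forallP => -[a aD] /=; rewrite scale1r /rho copairZ copair_sum.
pose c (b : Deltap Phi) : int := Num.floor (copair (val b) a).
have cE b : copair (val b) a = (c b)%:~R.
  by rewrite /c (floorK (root_int aD (pos_sub (valP b)))).
pose t (b : Deltap Phi) : Deltap Phi :=
  insubd b (if refl a (val b) \in Deltap Phi then refl a (val b)
            else - refl a (val b)).
have tE b : val (t b) = if refl a (val b) \in Deltap Phi then refl a (val b)
            else - refl a (val b).
  rewrite /t insubdK //; case: ifPn => // /negbTE h.
  have := pos_xor (root_refl aD (pos_sub (valP b))).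
  by rewrite h => /esym/negbFE.
have negpos b : b \in Deltap Phi -> (- b \in Deltap Phi) = false.
  by move=> bp; have := pos_xor (pos_sub bp); rewrite bp => /esym/negbTE.
have tK : involutive t.
  move=> b; apply: val_inj; rewrite tE [val (t b)]tE.
  have bp := valP b; case: (boolP (refl a (val b) \in Deltap Phi)) => h.
    by rewrite (reflK aD) bp.
  by rewrite refl_opp (reflK aD) (negpos _ bp) opprK.
have ct b : c (t b) = c b \/ c (t b) = - c b.
  have := cE (t b); rewrite tE; case: ifP => _.
    rewrite copair_refl // cE -mulrNz => /eqP; rewrite eqr_int => /eqP.
    by right.
  rewrite -scaleN1r copairZ copair_refl // mulN1r opprK cE => /eqP.
  by rewrite eqr_int => /eqP; left.
have ct0 b : t b = b -> exists k, c b = 2 * k.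
  move=> /(congr1 val); rewrite tE; case: ifP => _ h.
    exists 0; rewrite mulr0; apply/eqP; rewrite -(@eqr_int R) -cE.
    have := copair_refl (val b) aD; rewrite h => /eqP.
    by rewrite eq_sym eqNr.
  have bE : val b = (copair (val b) a / 2) *: a.
    move: h; rewrite /refl opprB => /eqP; rewrite subr_eq => /eqP h.
    by rewrite mulrC -scalerA h -mulr2n -(scaler_nat 2 (val b)) scalerA mulVf ?scale1r // pnatr_eq0.
  have := pos_sub (valP b); rewrite {1}bE => /(root_reduced aD).
  case=> h2; [exists 1|exists (-1)]; apply/eqP; rewrite -(@eqr_int R) -cE.
    by rewrite -[copair _ _](@divfK _ 2) ?pnatr_eq0 // h2 mul1r mulr1.
  by rewrite -[copair _ _](@divfK _ 2) ?pnatr_eq0 // h2 mulN1r mulrN1 mulrNz.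
have /eqP : \sum_b ((c b)%:~R : 'F_2) = 0.
  apply: (sum_involution_F2 tK) => b.
    case: (ct b) => ->//; rewrite mulrNz.
    by apply/eqP; rewrite eq_sym -addr_eq0 addF2.
  by move=> /ct0[k ->]; rewrite mulr_natl mulr2n intrD addF2.
rewrite -(rmorph_sum (intmul 1)) /= -(dvdz_pcharf (pchar_Fp (isT : prime 2))).
move=> /dvdzP[q qE]; rewrite (eq_bigr _ (fun b _ => cE b)).
by rewrite -(rmorph_sum (intmul 1)) /= qE intrM mulrCA mulVf ?pnatr_eq0 // mulr1 intr_int.
Qed.
Definition rho_lat : lat 1 := Lat rho_lat_subproof.

End Roots.

(* The additive group [L] written multiplicatively, so that [monalg k (expo L)]
   is the group algebra k[L] with basis [X^l = mbasis k l]. *)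
Definition expo (L : Type) : Type := L.
HB.instance Definition _ (L : choiceType) := Choice.copy (expo L) L.
HB.instance Definition _ (L : zmodType) :=
  isMonoid.Build (expo L) (@addrA L) (@add0r L) (@addr0 L).

Section GroupAlgebra.
Variables (R : realType) (n : nat) (Phi : root_datum R n).
Local Notation P := (lat Phi 1).

Definition ZP := monalg int (expo P).
HB.instance Definition _ := GRing.NzRing.on ZP.

Definition weyl_act (u : seq (Delta Phi)) (f : ZP) : ZP :=
  mextend (intmul 1) (fun l : expo P => mbasis int (lat_act u l : expo P)) f.

(* Z[P]^W *)
Definition weyl_inv : set ZP := [set f | forall u, weyl_act u f = f]%classic.

End GroupAlgebra.

Section Alcoves.
Local Open Scope classical_set_scope.
Variables (R : realType) (n : nat) (Phi : root_datum R n).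
Local Notation V := 'rV[R]_n.

Definition hyperplane (a : V) (k : int) : set V :=
  [set x | copair x a = k%:~R].

Definition off_hyperplanes : set V :=
  [set x | forall a k, a \in Delta Phi -> ~ hyperplane a k x].

Definition alcove (A : set V) : Prop :=
  exists2 x, off_hyperplanes x & A = connected_component off_hyperplanes x.

Definition fund_alcove : set V :=
  [set x | forall a, a \in Deltap Phi -> 0 < copair x a < 1].

(* [A] and [B] share a codimension one face contained in [hyperplane b k]. *)
Definition common_wall (A B : set V) (b : V) (k : int) : Prop :=
  exists U : set V, [/\ open U, U `&` hyperplane b k !=set0 &
    U `&` hyperplane b k `<=` closure A `&` closure B].

(* [A --b--> B] *)
Definition alcove_step (A : set V) (b : V) (B : set V) : Prop :=
  A <> B /\
  exists k : int, [/\ common_wall A B b k,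
    forall x, A x -> copair x b < k%:~R &
    forall x, B x -> k%:~R < copair x b].

Definition lambda_chain (l : lat Phi 1) (s : seq (Delta Phi)) : Prop :=
  exists A : nat -> set V,
  [/\ forall i, (i <= size s)%N -> alcove (A i),
      A 0 = fund_alcove,
      A (size s) = [set x - (l : V) | x in fund_alcove] &
      forall i, (i < size s)%N ->
        alcove_step (A i) (- nth 0 [seq val b | b <- s] i) (A i.+1)].

End Alcoves.

Section BT.
Variables (R : realType) (n : nat) (Phi : root_datum R n).
Local Notation V := 'rV[R]_n.
Local Notation P := (lat Phi 1).

(* The symbols of the positive roots form a basis of V_W. *)
Local Notation TVW := (monalg rat (word (Deltap Phi))).

(* The symbol of a root, so that [root_symbol (- v) = - root_symbol v]; it is 0
   on vectors that are not roots. *)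
Definition root_symbol (v : V) : TVW :=
  if insub v is Some a then mbasis rat ([:: a] : word (Deltap Phi))
  else if insub (- v) is Some a then - mbasis rat ([:: a] : word (Deltap Phi))
  else 0.

Definition VW_braiding (a b : Deltap Phi) : TVW :=
  root_symbol (refl (val a) (val b)) * root_symbol (val a).

Variable h : nat.
Local Notation P' := (lat Phi h).

(* Z[P'] (x) T(V_W), with basis the X^l (x) t, is the monoid algebra over Q of
   the semidirect product of P' with the free monoid on the positive roots, a
   word acting on P' through its W-degree. *)
Definition smash_monoid : Type := (P' * word (Deltap Phi))%type.
HB.instance Definition _ :=
  Choice.copy smash_monoid (P' * word (Deltap Phi))%type.

Definition word_act (u : word (Deltap Phi)) (l : P') : P' :=
  lat_act [seq pos_root a | a <- u] l.

Definition smash_mul (x y : smash_monoid) : smash_monoid :=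
  (x.1 + word_act x.2 y.1, x.2 ++ y.2).
Definition smash_one : smash_monoid := (0, [::]).

Let word_act_is_zmod u : zmod_morphism (word_act u).
Proof.
move=> l m; apply: val_inj; rewrite /word_act /lat_act.
elim: u => //= a u ->; rewrite /refl copairB scalerBl !opprD !addrA.
by rewrite -!addrA; congr (_ + _); rewrite addrCA.
Qed.
HB.instance Definition _ u :=
  GRing.isZmodMorphism.Build P' P' (word_act u) (word_act_is_zmod u).

Let smash_mulA : associative smash_mul.
Proof.
move=> [l u] [m v] [p w]; rewrite /smash_mul /= catA raddfD /= addrA.
by congr (_ + _, _); rewrite /word_act /lat_act map_cat foldr_cat.
Qed.
Let smash_mul1 : left_id smash_one smash_mul.
Proof. by case=> l u; rewrite /smash_mul /= add0r. Qed.
Let smash_mulr1 : right_id smash_one smash_mul.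
Proof. by case=> l u; rewrite /smash_mul /= raddf0 addr0 cats0. Qed.
HB.instance Definition _ :=
  isMonoid.Build smash_monoid smash_mulA smash_mul1 smash_mulr1.

Local Notation ZPT := (monalg rat smash_monoid).

Definition TVW_to_ZPT (x : TVW) : ZPT :=
  mextend (@mconst rat smash_monoid)
    (fun t => mbasis rat ((0, t) : smash_monoid)) x.

(* B(V_W)<P'> = Z[P'] (x) B(V_W), as the quotient of Z[P'] (x) T(V_W) by
   Z[P'] (x) Ker, where Ker is the kernel of T(V_W) -> B(V_W): as Ker is
   W-graded, Z[P'] (x) Ker is the two-sided ideal generated by
   the [sigma_n]-kernels.  By construction [[a] X^l = X^(s_a l) [a]]. *)
Definition BP :=
  ring_quot (TVW_to_ZPT @` nichols_rel VW_braiding)%classic.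
HB.instance Definition _ := GRing.PzRing.on BP.

Definition BP_X (l : P') : BP :=
  to_quot _ (mbasis rat ((l, [::]) : smash_monoid)).
Definition BP_symbol (v : V) : BP := to_quot _ (TVW_to_ZPT (root_symbol v)).
Definition ZP_to_BP (f : ZP Phi) : BP :=
  mextend (intmul 1) (fun l : expo P => BP_X (lat_incl h l)) f.

Variables (RT : comNzRingType) (iota : ZP Phi -> RT).

Definition BT := tensor (@weyl_inv R n Phi) iota ZP_to_BP.
HB.instance Definition _ := GRing.PzRing.on BT.

Definition RT_to_BT (r : RT) : BT := tens _ _ _ r 1.
Definition BP_to_BT (x : BP) : BT := tens _ _ _ 1 x.

Definition H_elt (b : Delta Phi) : BT :=
  BP_to_BT (BP_X (lat_div h (rho_lat Phi))
    * (BP_X (lat_div h (root_lat b)) + BP_symbol (val b))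
    * BP_X (- lat_div h (rho_lat Phi))).

(* [Xi l] is computed from some l-chain, for each l. *)
Definition Xi_eq_family (Xi : P -> BT) : Prop :=
  forall l, exists2 s, lambda_chain l s & Xi l = \prod_(b <- rev s) H_elt b.

(* K_T(G/B) = R(T)[P] / J *)
Definition KT_rel : set (monalg RT (expo P)) :=
  [set mextend (intmul 1) (fun l : expo P => mbasis RT l) f
       - mconst (expo P) (iota f) | f in @weyl_inv R n Phi]%classic.
Definition KT := ring_quot KT_rel.
HB.instance Definition _ := GRing.PzRing.on KT.

Definition RT_to_KT (r : RT) : KT := to_quot _ (mconst (expo P) r).

End BT.

Definition subring_set (A : pzRingType) (B : set A) : Prop :=
  [/\ B 1, forall x y, B x -> B y -> B (x - y) &
      forall x y, B x -> B y -> B (x * y)].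
Definition subalg_gen (K : Type) (A : pzRingType) (f : K -> A) (G : set A) :
  set A := smallest (@subring_set A) (range f `|` G)%classic.

(* Main.v *)
(** Up to conjugation by X^(rho/h), the product along an alcove path lies in
    Z[P']<T(V_W)>, where every positive root b defines a twisted derivation
    D_b(x y) = x D_b(y) + D_b(x) s_b(y) with D_b [a] = delta_{a,b} and
    D_b X^l = 0.  The degree 0 parts of iterated derivatives compute the entries
    of sigma_n, so an element for which they all vanish is 0 in B(V_W)<P'>.
    Since D_b replaces the factor of each crossing of a wall H_{b,k} by a path
    reflected in that wall, an induction on length shows that products along
    alcove paths depend only on their end points, so that Xi is multiplicative,
    and that sum_l c_l Xi^l = sum_l c_l X^l in the invariant case, because
    D_b Xi^(s_b l) = - D_b Xi^l.  The degree 0 part of Xi^l is X^l by the identity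
    sum_(b > 0) <l, b^vee> b = h l, a consequence of |Delta| = h rank.  This gives
    the homomorphism from K_T(G/B).

    For injectivity, K_T(G/B) is spanned over R(T) by Steinberg's weights e_w,
    w in W.  The specializations "degree 0 part, then u", u in W, send
    sum_w r_w Xi^(e_w) to sum_w r_w X^(u e_w), and the matrix (X^(u e_w)) has
    trivial kernel because the Vandermonde matrix of the X^(u rho) factors
    through it. *)
From HB Require Import structures.
Require Import Defs.
From mathcomp Require Import all_boot all_order all_algebra all_fingroup finmap.
From mathcomp Require Import archimedean generic_quotient ring lra zify.
From mathcomp Require Import boolp classical_sets reals topology normedtype.

Set Implicit Arguments.
Unset Strict Implicit.
Unset Printing Implicit Defensive.

Import Order.TTheory GRing.Theory Num.Theory.

(** * Reduced words of permutations *)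

(** Path independence can be proved by induction because a derivative drops one crossing. The
    factors to the right of the dropped one belong to the earlier crossings and get reflected by
    s_b; reflecting this initial piece in the crossed wall leaves a path from the reflected starting
    point to the old end point. A path may cross the same H_{b,k} several times, but by induction
    its terms for one k agree up to the sign given by the direction, so only the net number of
    crossings matters, which the end points determine. Walls are recorded by integer parts of
    pairings with coroots, so the topology of alcoves enters only when a chain is translated. For an
    invariant combination the derivative is its own negative, and rational coefficients allow
    division by 2. The number h is given as the order of a Coxeter element, so |Delta| = h rank
    comes from counting the orbits of that element on the roots. In the ring where the
    specializations take values, the differences X^(u rho) - X^(v rho) are regular because weights
    have no torsion, and this is all that the Vandermonde argument asks of the ring beyond
    commutativity. *)

Section ReducedWords.
Variable n : nat.
Implicit Types (w : 'S_n) (s : seq nat).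
Local Open Scope group_scope.

Definition inversions w : {set 'I_n * 'I_n} :=
  [set p : 'I_n * 'I_n | (p.1 < p.2)%N && (w p.2 < w p.1)%N].
Definition num_inv w := #|inversions w|.

Lemma adj_transpK i : adj_transp n i * adj_transp n i = 1.
Proof. by case: n => [|m] /=; rewrite ?mulg1 ?tperm2. Qed.

End ReducedWords.

(** The adjacent transposition on natural numbers, so that statements about order reduce to linear
    arithmetic. *)
Definition swap_nat (i x : nat) : nat :=
  if x == i then i.+1 else if x == i.+1 then i else x.

Lemma swap_nat_lt (i x y : nat) : (x < y)%N -> ~~ ((x == i) && (y == i.+1)) ->
  (swap_nat i x < swap_nat i y)%N.
Proof.
by rewrite /swap_nat; case: (x =P i) => ?; case: (y =P i) => ?; case: (x =P i.+1) => ?; case: (y =P i.+1) => ? //=; lia.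
Qed.

Section ReducedWordsS.
Variable m : nat.
Local Notation n := m.+1.
Implicit Types (w : 'S_n) (s : seq nat).
Local Open Scope group_scope.

Variables (i : nat) (lt_i : (i.+1 < n)%N).
Let x0 : 'I_n := inord i.
Let x1 : 'I_n := inord i.+1.
Let t : 'S_n := adj_transp n i.

Let x0E : x0 = i :> nat. Proof. by rewrite inordK // ltnW. Qed.
Let x1E : x1 = i.+1 :> nat. Proof. by rewrite inordK. Qed.

Lemma adj_transp_lt (x y : 'I_n) : (x < y)%N -> ~~ ((x == x0) && (y == x1)) -> (t x < t y)%N.
Proof.
have tE (z : 'I_n) : t z = swap_nat i z :> nat.
  rewrite /t /swap_nat /=; case: tpermP => [->|->|/eqP z0 /eqP z1].
  - by rewrite x0E eqxx x1E.
  - by rewrite x1E eqxx gtn_eqF // x0E.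
  - have /negbTE-> : (z : nat) != i by rewrite -x0E val_eqE.
    by have /negbTE-> : (z : nat) != i.+1 by rewrite -x1E val_eqE.
by rewrite -!(inj_eq val_inj) /= x0E x1E !tE; exact: swap_nat_lt.
Qed.

(** Precomposing with an adjacent transposition changes the relative order of the pair (i, i+1)
    only, so the old inversions are carried over and that pair is new. *)
Lemma inversions_adj w : (w x0 < w x1)%N ->
  inversions (t * w) = (x0, x1) |: [set (t p.1, t p.2) | p in inversions w].
Proof.
move=> w01; have tt x : t (t x) = x by rewrite -permM adj_transpK perm1.
have t0 : t x0 = x1 by rewrite /t /= tpermL.
have t1 : t x1 = x0 by rewrite /t /= tpermR.
have x01 : x0 != x1 by rewrite -val_eqE /= x0E x1E; lia.
apply/setP => -[x y]; rewrite !inE /= !permM; apply/andP/orP.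
- case=> xy wyx; case: (boolP ((x == x0) && (y == x1))) => [/andP[/eqP-> /eqP->]|nxy].
    by left.
  right; apply/imsetP; exists (t x, t y); last by rewrite /= !tt.
  by rewrite inE /= wyx adj_transp_lt.
- case=> [/eqP[-> ->]|/imsetP[[u v]]].
    by rewrite t0 t1 x0E x1E ltnS leqnn w01.
  rewrite inE /= => /andP[uv wvu] [-> ->]; rewrite !tt wvu adj_transp_lt //.
  by apply: contraL wvu => /andP[/eqP-> /eqP->]; rewrite -leqNgt ltnW.
Qed.

Lemma num_inv_adj w : (w x0 < w x1)%N -> num_inv (t * w) = (num_inv w).+1.
Proof.
move=> w01; rewrite /num_inv inversions_adj // cardsU1 card_imset; last first.
  by move=> [a b] [c d] /= [/perm_inj -> /perm_inj ->].
rewrite (_ : (_ \notin _) = true) //; apply/negP => /imsetP[[u v]].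
have tt x : t (t x) = x by rewrite -permM adj_transpK perm1.
rewrite inE /= => /andP[uv wvu] [/(congr1 t) + /(congr1 t)]; rewrite !tt.
rewrite /t /= tpermL tpermR => vE uE; move: uv; rewrite -uE -vE.
by rewrite -/x0 -/x1 x0E x1E ltnNge ltnW.
Qed.

Lemma num_inv_adj_gt w : (w x1 < w x0)%N -> num_inv w = (num_inv (t * w)).+1.
Proof.
move=> w10; rewrite -num_inv_adj; first by rewrite mulgA adj_transpK mul1g.
by rewrite !permM /t /= tpermL tpermR.
Qed.

Lemma num_inv_adj_le w : (num_inv (t * w) <= (num_inv w).+1)%N.
Proof.
case: (ltngtP (w x0) (w x1)) => [/num_inv_adj->//|/num_inv_adj_gt ->|].
  by rewrite ltnW // ltnW.
by move=> /val_inj/perm_inj/(congr1 val) /=; rewrite x0E x1E => /n_Sn.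
Qed.

End ReducedWordsS.

Section Reduced.
Variable m : nat.
Local Notation n := m.+1.
Implicit Types (w : 'S_n) (s : seq nat).
Local Open Scope group_scope.

Lemma num_inv0 w : num_inv w = 0 -> w = 1.
Proof.
move=> w0; have inc (x y : 'I_n) : (x < y)%N -> (w x < w y)%N.
  move=> xy; rewrite ltn_neqAle leqNgt; apply/andP; split.
    by rewrite val_eqE (inj_eq perm_inj); apply: contraTneq xy => ->; rewrite ltnn.
  apply/negP => wyx; have /eqP := w0; rewrite cards_eq0 => /eqP/setP/(_ (x, y)).
  by rewrite !inE /= xy wyx.
have wge (x : 'I_n) : (x <= w x)%N.
  case: x => x; elim: x => // x IH ltx; have := IH (ltnW ltx).
  by move=> /leq_ltn_trans; apply; apply: inc.
apply/permP => x; rewrite perm1.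
apply/val_inj => /=; apply/eqP; rewrite eqn_leq wge andbT leqNgt; apply/negP => lt_x.
(* [w] moves no point down; moving [x] up would make the sum of the values larger than that of the
   points, although [w] permutes them. *)
have: (\sum_(y : 'I_n) y < \sum_(y : 'I_n) w y)%N.
  rewrite (bigD1 x) //= [X in (_ < X)%N](bigD1 x) //= -addSn leq_add //.
  by apply: leq_sum.
by rewrite [X in (_ < X)%N](reindex_inj (@perm_inj _ w^-1)) /=;
  under [X in (_ < X)%N]eq_bigr do rewrite permKV; rewrite ltnn.
Qed.

Lemma descent_exists w : (0 < num_inv w)%N ->
  exists2 i, (i.+1 < n)%N & (w (inord i.+1) < w (inord i))%N.
Proof.
move=> w0; apply: contrapT => noex; move: w0; rewrite lt0n => /eqP; apply.
apply: eq_card0 => -[x y]; rewrite !inE /=; apply/negP => /andP[xy].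
suff h d : (x + d < n)%N -> (w x <= w (inord (x + d)))%N.
  have := h (y - x)%N; rewrite subnKC ?(ltnW xy) // ltn_ord inord_val => /(_ isT).
  by rewrite leqNgt => /negbTE->.
elim: d => [|d IH]; first by rewrite addn0 inord_val.
rewrite addnS => ltd; apply: leq_trans (IH (ltnW ltd)) _.
by rewrite leqNgt; apply/negP => h; apply: noex; exists (x + d)%N.
Qed.

Lemma decomposition_exists w : exists2 s, decomposition w s & size s = num_inv w.
Proof.
move: {2}(num_inv w) (erefl (num_inv w)) => k; elim: k w => [|k IH] w wk.
  by exists [::] => //; split=> //; rewrite big_nil (num_inv0 wk).
have [|i lti wi] := @descent_exists w; first by rewrite wk.
have := num_inv_adj_gt lti wi; rewrite wk => -[/esym].
case/IH => s [sn sE] ss; exists (i :: s); last by rewrite /= ss -num_inv_adj_gt.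
split; first by rewrite /= lti.
by rewrite big_cons -sE mulgA adj_transpK mul1g.
Qed.

Lemma decomposition_size w s : decomposition w s -> (num_inv w <= size s)%N.
Proof.
elim: s w => [|i s IH] w [].
  move=> _ ->; rewrite big_nil leqn0 cards_eq0; apply/eqP/setP => -[x y].
  by rewrite !inE !perm1 /=; case: ltngtP.
move=> /= /andP[lti sn] ->; rewrite big_cons.
by apply: leq_trans (num_inv_adj_le lti _) _; rewrite ltnS; apply: IH.
Qed.

Lemma reduced_wordP w : decomposition w (reduced_word w) /\ size (reduced_word w) = num_inv w.
Proof.
have [s sD ss] := decomposition_exists w.
have: reduced_decomposition w (reduced_word w).
  apply: (xgetPex [::]); exists s; split => // s' /decomposition_size.
  by rewrite ss.
case=> rD /(_ _ sD) rs; split => //; apply/eqP; rewrite eqn_leq -{1}ss rs.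
exact: decomposition_size.
Qed.

(** The length of a reduced word is the number of inversions, so every letter prepended to a suffix
    adds an inversion: the strands in places i and i+1 have not crossed before. *)
Lemma decomposition_ind (P : 'S_n -> seq nat -> Prop) :
  P 1 [::] ->
  (forall i w s, (i.+1 < n)%N -> (w (inord i) < w (inord i.+1))%N -> P w s ->
     P (adj_transp n i * w) (i :: s)) ->
  forall w, P w (reduced_word w).
Proof.
move=> P1 PS w; have [] := reduced_wordP w.
move: (reduced_word w) => s; elim: s w => [|i s IH] w [].
  by move=> _ ->; rewrite big_nil.
move=> /= /andP[lti sn] wE sw; move: wE; rewrite big_cons.
set w' := \prod_(j <- s) _ => wE; have w's : decomposition w' s by [].
(* Were [num_inv w'] smaller than the length of [s], one more letter could not bring it up to that
   of [i :: s]. *)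
have := decomposition_size w's; rewrite leq_eqVlt => /orP[/eqP s'|s'].
  rewrite wE; apply: PS => //; last exact: IH.
  case: ltngtP => //; last first.
    by move=> /val_inj/perm_inj/(congr1 val); rewrite /= !inordK // 1?ltnW // => /n_Sn.
  by move=> /(num_inv_adj_gt lti); rewrite -wE -sw s' => /eqP; lia.
by have := num_inv_adj_le lti w'; rewrite -wE -sw ltnS leqNgt s'.
Qed.

End Reduced.

Local Open Scope ring_scope.

(** * Maps out of a monoid algebra *)

Section MonoidAlgebraExtension.
Variables (k : nzRingType) (M : monoidType) (A : pzRingType).

Lemma mextendw (u : {additive k -> A}) (g : M -> A) (d : {fset M})
    (f : monalg k M) : (msupp f `<=` d)%fset ->
  mextend u g f = \sum_(x <- d) u (mcoef x f) * g x.
Proof.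
move=> fd; rewrite /mextend (big_fset_incl _ fd) //= => x _ /mcoef_outdom ->.
by rewrite raddf0 mul0r.
Qed.

Lemma mextend_is_zmod (u : {additive k -> A}) (g : M -> A) :
  zmod_morphism (mextend u g).
Proof.
move=> f1 f2; pose d := (msupp f1 `|` msupp f2 `|` msupp (f1 - f2)%R)%fset.
rewrite !(@mextendw _ _ d) -?sumrB; first last.
- by apply/fsubsetP => x; rewrite !inE => ->; rewrite ?orbT.
- by apply/fsubsetP => x; rewrite !inE => ->; rewrite ?orbT.
- by apply/fsubsetP => x; rewrite !inE => ->; rewrite ?orbT.
by apply: eq_bigr => x _; rewrite raddfB /= raddfB mulrBl.
Qed.

HB.instance Definition _ (u : {additive k -> A}) (g : M -> A) :=
  GRing.isZmodMorphism.Build (monalg k M) A (mextend u g) (mextend_is_zmod u g).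

Lemma mextend_term (u : {additive k -> A}) (g : M -> A) x c :
  mextend u g (mterm x c) = u c * g x.
Proof.
rewrite (mextendw _ _ (msupp_term _ _)) big_seq_fset1.
by rewrite mcoef_term eqxx mulr1n.
Qed.

Lemma mextend_basis (u : {rmorphism k -> A}) (g : M -> A) x :
  mextend u g (mbasis k x) = g x.
Proof. by rewrite mextend_term /= rmorph1 mul1r. Qed.

Lemma mextendM (u : {rmorphism k -> A}) (g : M -> A) :
  (forall x y, g (x * y)%g = g x * g y) ->
  (forall c x, u c * g x = g x * u c) ->
  {morph mextend u g : x y / x * y}.
Proof.
move=> gM uC f1 f2; rewrite (monalgE f1) (monalgE f2).
rewrite mulr_suml !(raddf_sum (mextend u g)) mulr_suml; apply: eq_bigr => x _.
rewrite mulr_sumr raddf_sum /= mulr_sumr; apply: eq_bigr => y _.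
rewrite mtermM !mextend_term /= rmorphM gM -!mulrA; congr (_ * _).
by rewrite !mulrA uC.
Qed.

Lemma mextend1 (u : {rmorphism k -> A}) (g : M -> A) :
  g 1%g = 1 -> mextend u g 1 = 1.
Proof. by move=> g1; rewrite mextend_basis. Qed.

End MonoidAlgebraExtension.

Lemma mextend_eq (k : nzRingType) (M : monoidType) (A : pzRingType) (u v : k -> A)
  (g h : M -> A) f : u =1 v -> g =1 h -> mextend u g f = mextend v h f.
Proof. by move=> uv gh; apply: eq_bigr => x _; rewrite uv gh. Qed.

Lemma mextendDg (k : nzRingType) (M : monoidType) (A : pzRingType) (u : k -> A)
    (g g' : M -> A) (f : monalg k M) :
  mextend u g f + mextend u g' f = mextend u (fun x => g x + g' x) f.
Proof. by rewrite /mextend -big_split; apply: eq_bigr => x _; rewrite mulrDr. Qed.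

Lemma mterm_int (M : monoidType) (x : M) (c : int) :
  (c%:~R : monalg int M) * mbasis int x = mterm x c.
Proof. by rewrite mulrzl -[mbasis int x]/(mterm x 1) -raddfMz /= intz. Qed.

Lemma monalg_ind (k : nzRingType) (M : monoidType) (P : monalg k M -> Prop) :
  P 0 -> (forall x y, P x -> P y -> P (x + y)) ->
  (forall x c, P (mterm x c)) -> forall f, P f.
Proof.
move=> P0 PD PT f; rewrite (monalgE f); elim: (enum_fset (msupp f)) => [|x r IH].
  by rewrite big_nil.
by rewrite big_cons; apply: PD.
Qed.

Lemma mterm_const (k : nzRingType) (M : monoidType) c (x : M) :
  mterm x c = mconst M c * mbasis k x.
Proof. by rewrite mtermM mul1g mulr1. Qed.

Lemma mconst_comm (k : comNzRingType) (M : monoidType) c (f : monalg k M) :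
  mconst M c * f = f * mconst M c.
Proof.
elim/monalg_ind: f => [|f g Hf Hg|x d]; rewrite ?mulr0 ?mul0r ?mulrDl ?mulrDr ?Hf ?Hg //.
by rewrite !mtermM mul1g mulg1 mulrC.
Qed.

Lemma mconst_is_zmod (k : nzRingType) (M : monoidType) : zmod_morphism (@mconst k M).
Proof. exact: mterm_is_zmod. Qed.
HB.instance Definition _ (k : nzRingType) (M : monoidType) :=
  GRing.isZmodMorphism.Build k (monalg k M) (@mconst k M) (@mconst_is_zmod k M).
Lemma mconst_is_monoid (k : nzRingType) (M : monoidType) : monoid_morphism (@mconst k M).
Proof. by split => [|c d]; rewrite ?mtermM ?mulg1. Qed.
HB.instance Definition _ (k : nzRingType) (M : monoidType) :=
  GRing.isMonoidMorphism.Build k (monalg k M) (@mconst k M) (@mconst_is_monoid k M).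

Lemma mbasisM (k : nzRingType) (M : monoidType) (x y : M) :
  mbasis k (x * y)%g = mbasis k x * mbasis k y.
Proof. by rewrite mtermM mulr1. Qed.

Lemma mbasisM4 (k : nzRingType) (M : monoidType) (x y z t : M) :
  mbasis k x * (mbasis k y * (mbasis k z * mbasis k t)) = mbasis k (x * (y * (z * t)))%g.
Proof. by rewrite -!mbasisM. Qed.

Lemma mbasis1 (k : nzRingType) (M : monoidType) : mbasis k (1 : M)%g = 1.
Proof. by []. Qed.

Lemma mbasisE (k : nzRingType) (M : monoidType) (x : M) : mbasis k x = mterm x 1.
Proof. by []. Qed.
Lemma mconstE (k : nzRingType) (M : monoidType) (c : k) : mconst M c = mterm 1%g c.
Proof. by []. Qed.

Lemma root_symbolE (R : realType) (n : nat) (Phi : root_datum R n) (v : 'rV[R]_n) :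
  root_symbol Phi v =
  if insub v is Some a then mbasis rat ([:: a] : word (Deltap Phi))
  else if insub (- v) is Some a then - mbasis rat ([:: a] : word (Deltap Phi))
  else 0.
Proof. by []. Qed.

(* Otherwise unification unfolds sums and products of concrete group algebra elements. *)
#[global] Opaque mterm mbasis mconst mextend root_symbol to_quot mmul madd mopp.

(** * The braided symmetrizer on products of roots *)

Section Reflections.
Variables (R : realType) (n : nat).
Local Notation V := 'rV[R]_n.
Implicit Types (a b u v : V) (c : R).

Lemma dotvC u v : dotv u v = dotv v u.
Proof. by rewrite /dotv !mxE; apply: eq_bigr => i _; rewrite !mxE mulrC. Qed.

Lemma dotvDl u v w : dotv (u + v) w = dotv u w + dotv v w.
Proof. by rewrite /dotv mulmxDl mxE. Qed.
Lemma dotvDr u v w : dotv w (u + v) = dotv w u + dotv w v.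
Proof. by rewrite dotvC dotvDl !(dotvC w). Qed.
Lemma dotvZl c u v : dotv (c *: u) v = c * dotv u v.
Proof. by rewrite /dotv -scalemxAl mxE. Qed.
Lemma dotvZr c u v : dotv u (c *: v) = c * dotv u v.
Proof. by rewrite dotvC dotvZl dotvC. Qed.
Lemma dotvNl u v : dotv (- u) v = - dotv u v.
Proof. by rewrite -scaleN1r dotvZl mulN1r. Qed.
Lemma dotvNr u v : dotv u (- v) = - dotv u v.
Proof. by rewrite dotvC dotvNl dotvC. Qed.
Lemma dotvBl u v w : dotv (u - v) w = dotv u w - dotv v w.
Proof. by rewrite dotvDl dotvNl. Qed.
Lemma dotvBr u v w : dotv w (u - v) = dotv w u - dotv w v.
Proof. by rewrite dotvDr dotvNr. Qed.
Lemma dotv0l v : dotv 0 v = 0.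
Proof. by rewrite -(scale0r 0) dotvZl mul0r. Qed.
Lemma dotv0r v : dotv v 0 = 0.
Proof. by rewrite dotvC dotv0l. Qed.
Lemma dotv_suml (I : Type) (r : seq I) (P : pred I) (F : I -> V) v :
  dotv (\sum_(i <- r | P i) F i) v = \sum_(i <- r | P i) dotv (F i) v.
Proof. by apply: (big_morph (fun x => dotv x v)) => [x y|]; rewrite ?dotvDl ?dotv0l. Qed.
Lemma dotv_sumr (I : Type) (r : seq I) (P : pred I) (F : I -> V) v :
  dotv v (\sum_(i <- r | P i) F i) = \sum_(i <- r | P i) dotv v (F i).
Proof. by rewrite dotvC dotv_suml; apply: eq_bigr => i _; rewrite dotvC. Qed.

Lemma dotv_ge0 v : 0 <= dotv v v.
Proof. by rewrite /dotv mxE sumr_ge0 // => i _; rewrite mxE -expr2 sqr_ge0. Qed.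

Lemma dotv_eq0 v : (dotv v v == 0) = (v == 0).
Proof.
apply/eqP/eqP => [v0|->]; last exact: dotv0l.
apply/rowP => i; rewrite mxE; apply/eqP; rewrite -sqrf_eq0.
move: v0; rewrite /dotv mxE => /psumr_eq0P h.
by have := h _ i isT; rewrite mxE expr2 => -> // j _; rewrite mxE -expr2 sqr_ge0.
Qed.

Lemma dotv_gt0 v : (0 < dotv v v) = (v != 0).
Proof. by rewrite lt_neqAle dotv_ge0 andbT eq_sym dotv_eq0. Qed.

Lemma copairE v a : copair v a = 2 * dotv v a / dotv a a.
Proof. by []. Qed.

Lemma copairD u v a : copair (u + v) a = copair u a + copair v a.
Proof. by rewrite !copairE dotvDl mulrDr mulrDl. Qed.

Lemma copair0 a : copair 0 a = 0.
Proof. by rewrite copairE dotv0l mulr0 mul0r. Qed.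

Lemma copairNl v a : copair (- v) a = - copair v a.
Proof. by rewrite -scaleN1r copairZ mulN1r. Qed.

Lemma copairNr v a : copair v (- a) = - copair v a.
Proof. by rewrite !copairE !dotvNr dotvNl opprK mulrN mulNr. Qed.

Lemma reflZ c a v : refl a (c *: v) = c *: refl a v.
Proof. by rewrite /refl copairZ scalerBr scalerA. Qed.
Lemma reflD a u v : refl a (u + v) = refl a u + refl a v.
Proof. by rewrite /refl copairD scalerDl opprD addrACA. Qed.
Lemma reflB a u v : refl a (u - v) = refl a u - refl a v.
Proof. by rewrite reflD refl_opp. Qed.
Lemma refl0 a : refl a 0 = 0.
Proof. by rewrite /refl copair0 scale0r subrr. Qed.
Lemma refl_sum (I : Type) (r : seq I) (P : pred I) (F : I -> V) a :
  refl a (\sum_(i <- r | P i) F i) = \sum_(i <- r | P i) refl a (F i).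
Proof. by apply: (big_morph (refl a)) => [x y|]; rewrite ?reflD ?refl0. Qed.
Lemma refl_oppl a v : refl (- a) v = refl a v.
Proof. by rewrite /refl copairNr scalerN scaleNr opprK. Qed.
Lemma refl_signl (e : bool) a v : refl ((-1) ^+ e *: a) v = refl a v.
Proof. by case: e; rewrite ?scaleN1r ?refl_oppl ?scale1r. Qed.

Lemma refl_neg a : a != 0 -> refl a a = - a.
Proof.
move=> a0; rewrite /refl copairE mulfK ?dotv_eq0 //.
by rewrite scaler_nat mulr2n opprD addrA subrr sub0r.
Qed.

Lemma dotv_refl a u v : a != 0 -> dotv (refl a u) (refl a v) = dotv u v.
Proof.
rewrite -dotv_eq0 => a0; rewrite /refl !dotvBl !dotvBr !dotvZl !dotvZr !copairE.
by rewrite (dotvC a v); field.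
Qed.

Lemma copair_refl2 a u b : a != 0 -> copair (refl a u) (refl a b) = copair u b.
Proof. by move=> a0; rewrite !copairE !dotv_refl. Qed.

Lemma refl_conj a b v : a != 0 -> refl (refl a b) (refl a v) = refl a (refl b v).
Proof. by move=> a0; rewrite {1}/refl copair_refl2 // reflB reflZ. Qed.

End Reflections.

Section ReflectionFold.
Variables (R : realType) (n : nat) (I : eqType).
Local Notation V := 'rV[R]_n.

Implicit Types (t : I -> V) (P : pred I) (l : seq I) (a u v : V).

Definition sfold (t : I -> V) (P : pred I) (l : seq I) (v : V) : V :=
  foldr (fun k v => if P k then refl (t k) v else v) v l.

Lemma sfold_cat t P l1 l2 v : sfold t P (l1 ++ l2) v = sfold t P l1 (sfold t P l2 v).
Proof. exact: foldr_cat. Qed.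

Lemma sfold_false t P l v : {in l, P =1 pred0} -> sfold t P l v = v.
Proof.
elim: l => //= k l IH h; rewrite h ?mem_head //= IH // => x xl.
by apply: h; rewrite inE xl orbT.
Qed.

Lemma eq_in_sfold t t' P P' l v : {in l, P =1 P'} -> {in l, t =1 t'} ->
  sfold t P l v = sfold t' P' l v.
Proof.
elim: l => //= k l IH h h'; rewrite h ?h' ?mem_head // IH // => x xl.
  by apply: h; rewrite inE xl orbT.
by apply: h'; rewrite inE xl orbT.
Qed.

Lemma sfold_conj a t P l v : a != 0 ->
  refl a (sfold t P l v) = sfold (fun k => refl a (t k)) P l (refl a v).
Proof.
by move=> a0; elim: l => //= k l IH; case: ifP => _; rewrite -IH ?refl_conj.
Qed.

Lemma sfold_refl t P l u v : {in l, forall k, t k != 0} ->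
  refl (sfold t P l u) (sfold t P l v) = sfold t P l (refl u v).
Proof.
elim: l => //= k l IH h; have {}IH : refl (sfold t P l u) (sfold t P l v) = sfold t P l (refl u v).
  by apply: IH => x xl; apply: h; rewrite inE xl orbT.
by case: (P k); rewrite ?refl_conj ?IH ?h ?mem_head.
Qed.

End ReflectionFold.

(** * Splitting the ordered list of strands at one strand *)

Section EnumSplit.

Lemma mem_enum_ord n (x : 'I_n) : (x \in enum 'I_n) = true.
Proof. exact: mem_enum. Qed.

Lemma mem_filter_ord n (P : pred 'I_n) x : (x \in [seq k : 'I_n <- enum 'I_n | P k]) = P x.
Proof. by rewrite mem_filter mem_enum_ord andbT. Qed.

Lemma enum_ord_sorted n : sorted (fun x y : 'I_n => (x < y)%N) (enum 'I_n).
Proof. by rewrite -(@sorted_map _ _ val ltn) val_enum_ord iota_ltn_sorted. Qed.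

Lemma ord_sorted_eq n (s1 s2 : seq 'I_n) :
  sorted (fun x y : 'I_n => (x < y)%N) s1 ->
  sorted (fun x y : 'I_n => (x < y)%N) s2 -> s1 =i s2 -> s1 = s2.
Proof. by apply: irr_sorted_eq => [x y z|x] /=; [exact: ltn_trans|exact: ltnn]. Qed.

Lemma filter_ord_sorted n (P : pred 'I_n) :
  sorted (fun x y : 'I_n => (x < y)%N) [seq k : 'I_n <- enum 'I_n | P k].
Proof. by apply: sorted_filter; [move=> x y z; exact: ltn_trans|exact: enum_ord_sorted]. Qed.

Lemma cat_ord_sorted n (s1 s2 : seq 'I_n) :
  sorted (fun x y : 'I_n => (x < y)%N) s1 ->
  sorted (fun x y : 'I_n => (x < y)%N) s2 ->
  (forall x y, x \in s1 -> y \in s2 -> (x < y)%N) ->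
  sorted (fun x y : 'I_n => (x < y)%N) (s1 ++ s2).
Proof.
move=> h1 h2 h; have tr : transitive (fun x y : 'I_n => (x < y)%N).
  by move=> x y z; exact: ltn_trans.
rewrite !(sorted_pairwise tr) in h1 h2 *; rewrite pairwise_cat h1 h2 !andbT.
by apply/allrelP.
Qed.

Lemma enum_ord_split n (p : 'I_n) :
  enum 'I_n = [seq k : 'I_n <- enum 'I_n | (k < p)%N] ++ p :: [seq k : 'I_n <- enum 'I_n | (p < k)%N].
Proof.
apply: ord_sorted_eq => [||x]; first exact: enum_ord_sorted.
  rewrite -cat1s; apply: cat_ord_sorted => [||x y]; first exact: filter_ord_sorted.
    by apply: cat_ord_sorted => // [|x y]; [exact: filter_ord_sorted|];
      rewrite inE mem_filter => /eqP-> /andP[].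
  rewrite cat1s inE !mem_filter => /andP[xp _] /orP[/eqP->//|/andP[+ _]].
  exact: ltn_trans.
rewrite mem_enum_ord mem_cat inE !mem_filter_ord.
by rewrite -val_eqE; case: ltngtP.
Qed.

Lemma enum_ord_split_le n (p : nat) :
  enum 'I_n = [seq k : 'I_n <- enum 'I_n | (k < p)%N] ++ [seq k : 'I_n <- enum 'I_n | (p <= k)%N].
Proof.
apply: ord_sorted_eq => [||x]; first exact: enum_ord_sorted.
  apply: cat_ord_sorted => [||x y]; [exact: filter_ord_sorted|exact: filter_ord_sorted|].
  by rewrite !mem_filter => /andP[xp _] /andP[py _]; exact: leq_trans py.
by rewrite mem_enum_ord mem_cat !mem_filter_ord; case: leqP.
Qed.

Lemma lift_sorted n (j : 'I_n.+1) s : sorted (fun x y : 'I_n => (x < y)%N) s ->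
  sorted (fun x y : 'I_n.+1 => (x < y)%N) [seq lift j k | k <- s].
Proof.
rewrite sorted_map; apply: sub_sorted => x y /=.
by rewrite /bump; case: (leqP j x); case: (leqP j y) => //; lia.
Qed.

Lemma filter_lift_lt n (j : 'I_n.+1) : [seq k : 'I_n.+1 <- enum 'I_n.+1 | (k < j)%N] =
  [seq lift j k | k : 'I_n <- enum 'I_n & (k < j)%N].
Proof.
apply: ord_sorted_eq => [||x]; first exact: filter_ord_sorted.
  by apply: lift_sorted; exact: filter_ord_sorted.
rewrite mem_filter mem_enum_ord andbT; apply/idP/mapP => [xj|[k]].
  case: (unliftP j x) xj => [k ->|->]; last by rewrite ltnn.
  move=> h; exists k => //; rewrite mem_filter mem_enum_ord andbT.
  by move: h; rewrite /= /bump; case: leqP => //; lia.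
by rewrite mem_filter => /andP[kj _] -> /=; rewrite /bump (leqNgt j k) kj.
Qed.

Lemma filter_lift_gt n (j : 'I_n.+1) : [seq k : 'I_n.+1 <- enum 'I_n.+1 | (j < k)%N] =
  [seq lift j k | k : 'I_n <- enum 'I_n & (j <= k)%N].
Proof.
apply: ord_sorted_eq => [||x]; first exact: filter_ord_sorted.
  by apply: lift_sorted; exact: filter_ord_sorted.
rewrite mem_filter mem_enum_ord andbT; apply/idP/mapP => [xj|[k]].
  case: (unliftP j x) xj => [k ->|->]; last by rewrite ltnn.
  move=> h; exists k => //; rewrite mem_filter mem_enum_ord andbT.
  by move: h; rewrite /= /bump; case: leqP => //; lia.
by rewrite mem_filter => /andP[kj _] -> /=; rewrite /bump kj.
Qed.

End EnumSplit.

(** * Roots carried by the strands of a permutation *)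

Section StrandLabels.
Variables (R : realType) (d : nat).
Local Notation V := 'rV[R]_d.

(* The braiding reflects the root that moves left in the root it passes, so that
   a reduced word of w brings to position x the root at w x, reflected in those
   at the positions k < w x that it passes. *)
Definition strand_label n (w : 'S_n) (t : 'I_n -> V) (x : 'I_n) : V :=
  sfold t (fun k : 'I_n => (k < w x)%N && (x < (w^-1)%g k)%N) (enum 'I_n) (t (w x)).

Lemma strand_label1 n (t : 'I_n -> V) x : strand_label 1 t x = t x.
Proof.
rewrite /strand_label invg1 perm1 sfold_false // => k _ /=.
by rewrite perm1; case: ltngtP.
Qed.

Section AdjacentTransposition.
Variables (m : nat) (t : 'I_m.+1 -> V) (t0 : forall k, t k != 0).
Variables (i : nat) (lt_i : (i.+1 < m.+1)%N) (w : 'S_m.+1).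
Let x0 : 'I_m.+1 := inord i.
Let x1 : 'I_m.+1 := inord i.+1.
Hypothesis w01 : (w x0 < w x1)%N.
Let a : 'S_m.+1 := adj_transp m.+1 i.

Let x0E : x0 = i :> nat. Proof. by rewrite inordK // ltnW. Qed.
Let x1E : x1 = i.+1 :> nat. Proof. by rewrite inordK. Qed.
Let aL : a x0 = x1. Proof. by rewrite /a /= tpermL. Qed.
Let aR : a x1 = x0. Proof. by rewrite /a /= tpermR. Qed.
Let awV k : ((a * w)^-1)%g k = a ((w^-1)%g k).
Proof. by rewrite invMg permM /a /= tpermV. Qed.
Let aE (y : 'I_m.+1) : a y = swap_nat i y :> nat.
Proof.
rewrite /a /swap_nat /=; case: tpermP => [->|->|/eqP z0 /eqP z1].
- by rewrite -/x0 -/x1 x0E eqxx x1E.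
- by rewrite -/x0 -/x1 x1E eqxx gtn_eqF // x0E.
- have /negbTE-> : (y : nat) != i by rewrite -x0E val_eqE.
  by have /negbTE-> : (y : nat) != i.+1 by rewrite -x1E val_eqE.
Qed.

(** No strand changes its side with respect to a place other than i and i+1. *)
Lemma strand_label_far x : x != x0 -> x != x1 ->
  strand_label (a * w)%g t x = strand_label w t x.
Proof.
move=> xx0 xx1; have ax : a x = x.
  by rewrite /a /= tpermD // eq_sym.
rewrite /strand_label permM ax; apply: eq_in_sfold => // k _; congr (_ && _).
rewrite awV aE /swap_nat; set y : 'I_m.+1 := (w^-1)%g k.
move: xx0 xx1; rewrite -!(inj_eq val_inj) /= x0E x1E => /eqP xi /eqP xi1.
case: (eqVneq (y : nat) i) => [->|/eqP yi]; first by lia.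
by case: (eqVneq (y : nat) i.+1) => [->|//]; lia.
Qed.

Let q := w x1.
Let p := w x0.
Let wVp : (w^-1)%g p = x0. Proof. exact: permK. Qed.
Let wVq : (w^-1)%g q = x1. Proof. exact: permK. Qed.
Let C := fun k : 'I_m.+1 => (k < q)%N && (x1 < (w^-1)%g k)%N.

Let xi_out k : k != p -> k != q ->
  ((w^-1)%g k != i :> nat) /\ ((w^-1)%g k != i.+1 :> nat).
Proof.
move=> kp kq; split.
  by rewrite -x0E val_eqE; apply: contra kp => /eqP yx; rewrite -[k](permKV w) yx.
by rewrite -x1E val_eqE; apply: contra kq => /eqP yx; rewrite -[k](permKV w) yx.
Qed.

(** The strand that moves right keeps its root: none of the strands below it changes side. *)
Lemma strand_label_right : strand_label (a * w)%g t x1 = strand_label w t x0.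
Proof.
rewrite /strand_label permM aR; apply: eq_in_sfold => // k _ /=.
case: (ltnP k (w x0)) => //= kp; rewrite awV aE /swap_nat x0E x1E.
have [||/eqP y0 /eqP y1] := @xi_out k.
- by rewrite -val_eqE /= (ltn_eqF kp).
- by rewrite -val_eqE /= (ltn_eqF (ltn_trans kp w01)).
by case: eqP y0 => // y0 _; case: eqP y1 => // y1 _; lia.
Qed.

(** The strand [q] now passes [p] as well, so its ordered product of reflections gains a factor at
    [p]. The factors below [p], which are also those that [p] itself has passed, conjugate the
    reflection in [t p] into the reflection in the label of [p]. *)
Lemma strand_label_left : strand_label (a * w)%g t x0 =
  refl (strand_label w t x0) (strand_label w t x1).
Proof.
have lE : strand_label w t x1 = sfold t C (enum 'I_m.+1) (t q) by [].
have rE : strand_label (a * w)%g t x0 =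
    sfold t (fun k => C k || (k == p)) (enum 'I_m.+1) (t q).
  rewrite /strand_label permM aL; apply: eq_in_sfold => // k _ /=.
  rewrite awV aE /swap_nat /C x0E x1E.
  case: (eqVneq k p) => [->|kp]; first by rewrite wVp x0E eqxx -/q w01 orbT ltnSn.
  rewrite orbF -/q; case: (ltnP k q) => //= kq.
  have [//||/eqP y0 /eqP y1] := @xi_out k; first by rewrite -val_eqE /= (ltn_eqF kq).
  by case: eqP y0 => // y0 _; case: eqP y1 => // y1 _; lia.
have pE : strand_label w t x0 = sfold t (fun k => C k && (k < p)%N) (enum 'I_m.+1) (t p).
  apply: eq_in_sfold => // k _ /=; rewrite /C -/p; case: (ltnP k p) => //= [kp|_]; last by rewrite andbF.
  rewrite andbT (ltn_trans kp w01) /= x0E x1E.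
  have [||/eqP y0 /eqP y1] := @xi_out k.
  - by rewrite -val_eqE /= (ltn_eqF kp).
  - by rewrite -val_eqE /= (ltn_eqF (ltn_trans kp w01)).
  by lia.
have Cp : C p = false by rewrite /C wVp x1E x0E (ltnNge i.+1) leqnSn andbF.
rewrite rE pE lE (enum_ord_split p).
set l1 := [seq k <- _ | _]; set l2 := [seq k <- _ | _].
rewrite -cat1s !sfold_cat /= eqxx orbT Cp /= .
have l1P (Q Q' : pred 'I_m.+1) u : (forall k : 'I_m.+1, (k < p)%N -> Q k = Q' k) ->
    sfold t Q l1 u = sfold t Q' l1 u.
  by move=> QQ; apply: eq_in_sfold => // k; rewrite mem_filter => /andP[/QQ].
have l2P (Q Q' : pred 'I_m.+1) u : (forall k : 'I_m.+1, (p < k)%N -> Q k = Q' k) ->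
    sfold t Q l2 u = sfold t Q' l2 u.
  by move=> QQ; apply: eq_in_sfold => // k; rewrite mem_filter => /andP[/QQ].
rewrite (l2P (fun k => C k && (k < p)%N) pred0); last first.
  by move=> k pk; rewrite ltnNge (ltnW pk) andbF.
rewrite [sfold t pred0 _ _]sfold_false //.
rewrite (l1P (fun k => C k && (k < p)%N) C) => [|k ->]; last by rewrite andbT.
rewrite sfold_refl //.
rewrite (l1P (fun k => C k || (k == p)) C); last first.
  by move=> k kp; rewrite -val_eqE /= (ltn_eqF kp) orbF.
congr (sfold _ _ _ (refl _ _)); apply: l2P => k pk.
by rewrite -val_eqE /= (gtn_eqF pk) orbF.
Qed.

End AdjacentTransposition.

(** What remains when factor j is moved to the far right: the factors that it meets are reflected in
    [t j]. *)
Definition drop_strand m (j : 'I_m.+1) (t : 'I_m.+1 -> V) (x : 'I_m) : V :=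
  if (j <= x)%N then refl (t j) (t (lift j x)) else t (lift j x).

Lemma strand_label_last m (w : 'S_m) j (t : 'I_m.+1 -> V) :
  strand_label (lift_perm ord_max j w) t ord_max = t j.
Proof.
rewrite /strand_label lift_perm_id sfold_false // => k _ /=.
by set y := (_ k : 'I_m.+1); rewrite [X in _ && X]ltnNge -(ltnS y) ltn_ord andbF.
Qed.

Lemma lift_leq m (j : 'I_m.+1) (x y : 'I_m) : (lift j x < lift j y)%N = (x < y)%N.
Proof.
rewrite /= /bump; case: (leqP j x); case: (leqP j y) => /=; lia.
Qed.

(** Strand j ends last, so exactly the strands above it pass it. Reflecting their roots in [t j]
    beforehand conjugates their reflections and has the same effect; strands below j never pass
    it. *)
Lemma strand_label_lift m (w : 'S_m) j (t : 'I_m.+1 -> V) (x : 'I_m) :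
  (forall k, t k != 0) ->
  strand_label (lift_perm ord_max j w) t (lift ord_max x) =
  strand_label w (drop_strand j t) x.
Proof.
move=> t0; rewrite /strand_label lift_perm_lift.
set q := w x; pose D (k : 'I_m) := (k < q)%N && (x < (w^-1)%g k)%N.
rewrite (enum_ord_split j) filter_lift_lt filter_lift_gt.
rewrite [in RHS](enum_ord_split_le m j).
set l1 := [seq k : 'I_m <- _ | _]; set l2 := [seq k : 'I_m <- _ | _].
have mapE (l : seq 'I_m) u : sfold t (fun k : 'I_m.+1 => (k < lift j q)%N &&
   (lift ord_max x < ((lift_perm ord_max j w)^-1)%g k)%N) [seq lift j k | k <- l] u =
   sfold (fun k => t (lift j k)) D l u.
  elim: l => //= k l ->; rewrite lift_permV lift_perm_lift.
  have -> : (bump j k < bump j q)%N = (k < q)%N by exact: (lift_leq j).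
  by have -> : (bump m x < bump m ((w^-1)%g k))%N = (x < (w^-1)%g k)%N by exact: (lift_leq ord_max).
rewrite -cat1s !sfold_cat !mapE /= lift_permV lift_perm_id.
have -> : (bump m x < m)%N = true.
  by rewrite /bump (leqNgt m x) ltn_ord /= add0n ltn_ord.
rewrite andbT -/D.
rewrite [sfold _ D l1 _ in RHS](@eq_in_sfold _ _ _ _ (fun k => t (lift j k)) D D) //; last first.
  by move=> k; rewrite mem_filter => /andP[kj _]; rewrite /drop_strand leqNgt kj.
congr (sfold _ _ _ _).
case: (leqP j q) => jq.
  have -> : (j < bump j q)%N = true by rewrite /bump jq add1n ltnS.
  have -> : drop_strand j t q = refl (t j) (t (lift j q)) by rewrite /drop_strand jq.
  rewrite sfold_conj //.
  apply: eq_in_sfold => // k; rewrite mem_filter => /andP[jk _].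
  by rewrite /drop_strand jk.
have -> : (j < bump j q)%N = false by rewrite /bump (leqNgt j q) jq /= add0n ltnNge ltnW.
have -> : drop_strand j t q = t (lift j q) by rewrite /drop_strand leqNgt jq.
rewrite !sfold_false // => k; rewrite mem_filter => /andP[jk _] /=; rewrite /D.
  by rewrite ltnNge (leq_trans (ltnW jq) jk).
by rewrite ltnNge (leq_trans (ltnW jq) jk).
Qed.

End StrandLabels.

Lemma mul_sign2 (A : pzRingType) (e f : bool) (x y : A) :
  ((-1) ^+ e * x) * ((-1) ^+ f * y) = (-1) ^+ (e (+) f) * (x * y).
Proof.
by rewrite signr_addb -!mulrA; congr (_ * _); rewrite !mulrA (commr_sign x f).
Qed.

Lemma mul_sign4 (A : pzRingType) (e f g k : bool) (x y z t : A) :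
  ((-1) ^+ e * x) * (((-1) ^+ f * y) * (((-1) ^+ g * z) * ((-1) ^+ k * t))) =
  (-1) ^+ (e (+) (f (+) (g (+) k))) * (x * (y * (z * t))).
Proof. by rewrite !mul_sign2. Qed.

(** * The braiding on words of root symbols *)

Section RootWords.
Variables (R : realType) (d : nat) (Phi : root_datum R d).
Local Notation V := 'rV[R]_d.
Local Notation TVW := (monalg rat (word (Deltap Phi))).
Local Notation psi := (@VW_braiding R d Phi).

Lemma root_neq0P (a : V) : a \in Delta Phi -> a != 0.
Proof. by move=> aD; apply: contraTneq aD => ->; exact: root_neq0. Qed.

Lemma pos_root_symbol (a : Deltap Phi) :
  root_symbol Phi (val a) = mbasis rat ([:: a] : word (Deltap Phi)).
Proof. by rewrite root_symbolE valK. Qed.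

Lemma pos_oppF (a : V) : a \in Deltap Phi -> (- a \in Deltap Phi) = false.
Proof. by move=> ap; have := pos_xor (pos_sub ap); rewrite ap => /esym/negbTE. Qed.

Lemma neg_root_symbol (a : Deltap Phi) :
  root_symbol Phi (- val a) = - mbasis rat ([:: a] : word (Deltap Phi)).
Proof.
rewrite root_symbolE opprK valK; case: insubP => // u.
by rewrite (pos_oppF (valP a)).
Qed.

Lemma root_signP (v : V) : v \in Delta Phi ->
  exists (e : bool) (a : Deltap Phi), v = (-1) ^+ e *: val a.
Proof.
move=> vD; case: (boolP (v \in Deltap Phi)) => [vp|].
  by exists false, [` vp]%fset; rewrite scale1r.
rewrite pos_xor // negbK => vn; exists true, [` vn]%fset.
by rewrite scaleN1r opprK.
Qed.

Lemma root_symbol_sign (e : bool) (a : Deltap Phi) :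
  root_symbol Phi ((-1) ^+ e *: val a) = (-1) ^+ e * mbasis rat ([:: a] : word (Deltap Phi)).
Proof.
by case: e; rewrite ?scaleN1r ?neg_root_symbol ?mulN1r // scale1r mul1r pos_root_symbol.
Qed.

Lemma root_symbolN (v : V) : v \in Delta Phi ->
  root_symbol Phi (- v) = - root_symbol Phi v.
Proof.
case/root_signP => e [a ->]; rewrite -scaleN1r scalerA root_symbol_sign.
by case: e; rewrite ?mulrNN ?mulr1 ?scale1r ?scaleN1r ?pos_root_symbol ?neg_root_symbol ?mul1r ?mulN1r ?opprK.
Qed.

Definition root_word (l : seq V) : TVW := \prod_(v <- l) root_symbol Phi v.

Lemma root_word_cat l1 l2 : root_word (l1 ++ l2) = root_word l1 * root_word l2.
Proof. exact: big_cat. Qed.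

Lemma root_word_cons v l : root_word (v :: l) = root_symbol Phi v * root_word l.
Proof. exact: big_cons. Qed.

Lemma root_wordE l : {subset l <= Delta Phi} ->
  exists (e : bool) (w : word (Deltap Phi)),
    size w = size l /\ root_word l = (-1) ^+ e * mbasis rat w.
Proof.
elim: l => [|v l IH] lD; first by exists false, [::]; rewrite /root_word big_nil mul1r.
have [e [w [sw wE]]] : exists (e : bool) (w : word (Deltap Phi)),
    size w = size l /\ root_word l = (-1) ^+ e * mbasis rat w.
  by apply: IH => x xl; apply: lD; rewrite inE xl orbT.
have [e' [a vE]] := root_signP (lD v (mem_head _ _)).
exists (e' (+) e), (a :: w); rewrite /= sw root_word_cons; split => //.
rewrite vE root_symbol_sign wE mul_sign2 (_ : a :: w = ([:: a] : word _) * w)%g //.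
by rewrite mbasisM.
Qed.

Lemma psi_at_is_zmod i : zmod_morphism (psi_at psi i).
Proof. exact: mextend_is_zmod. Qed.
HB.instance Definition _ i :=
  GRing.isZmodMorphism.Build TVW TVW (psi_at psi i) (psi_at_is_zmod i).

Lemma psi_at_basis i w : psi_at psi i (mbasis rat w) = psi_word psi i w.
Proof. exact: mextend_basis. Qed.

Lemma psi_at_sign i (e : bool) x : psi_at psi i ((-1) ^+ e * x) = (-1) ^+ e * psi_at psi i x.
Proof. by case: e; rewrite ?mul1r // !mulN1r raddfN. Qed.

Lemma psi_at_swap l1 l2 a b : {subset l1 <= Delta Phi} -> {subset l2 <= Delta Phi} ->
  a \in Delta Phi -> b \in Delta Phi ->
  psi_at psi (size l1) (root_word (l1 ++ a :: b :: l2)) =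
  root_word (l1 ++ refl a b :: a :: l2).
Proof.
move=> /root_wordE[e1 [w1 [s1 E1]]] /root_wordE[e2 [w2 [s2 E2]]].
case/root_signP => ea [a' ->] /root_signP[eb [b' ->]].
(* The signs of the factors are pulled out, so that the braiding acts on a word in positive roots;
   the sign of [a] does not affect the reflection. *)
rewrite !root_word_cat !root_word_cons refl_signl reflZ E1 E2.
have rD : refl (val a') (val b') \in Delta Phi by apply: root_refl; apply/pos_sub/valP.
have -> : root_symbol Phi ((-1) ^+ eb *: refl (val a') (val b')) =
    (-1) ^+ eb * root_symbol Phi (refl (val a') (val b')).
  by case: eb; rewrite ?scale1r ?mul1r // scaleN1r root_symbolN // mulN1r.
rewrite !root_symbol_sign.
move E1w: (mbasis rat w1) => B1; move E2w: (mbasis rat w2) => B2.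
move Ea: (mbasis rat ([:: a'] : word (Deltap Phi))) => Ba; move Eb: (mbasis rat ([:: b'] : word (Deltap Phi))) => Bb.
move Er: (root_symbol Phi (refl _ _)) => Br.
rewrite (mul_sign4 e1 ea eb e2) (mul_sign4 e1 eb ea e2) (addbCA eb ea e2) psi_at_sign.
rewrite -{}E1w -{}E2w -{}Ea -{}Eb -{}Er.
congr (_ * _).
have H : mbasis rat w1 * (mbasis rat ([:: a'] : word (Deltap Phi)) *
    (mbasis rat ([:: b'] : word (Deltap Phi)) * mbasis rat w2)) =
    mbasis rat (w1 ++ [:: a', b' & w2] : word (Deltap Phi)).
  exact: mbasisM4.
rewrite [X in psi_at psi _ X]H psi_at_basis /psi_word -s1 drop_size_cat // take_size_cat //.
by rewrite /VW_braiding pos_root_symbol -!mulrA.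
Qed.

Definition fun_word n (t : 'I_n -> V) : TVW := \prod_(x < n) root_symbol Phi (t x).

Lemma fun_wordE m (t : 'I_m.+1 -> V) : fun_word t = root_word [seq t (inord x) | x <- iota 0 m.+1].
Proof.
rewrite /fun_word /root_word big_map -[iota 0 m.+1]/(index_iota 0 m.+1) big_mkord.
by apply: eq_bigr => x _; rewrite inord_val.
Qed.

Lemma iota_split i n : (i.+1 < n)%N ->
  iota 0 n = iota 0 i ++ i :: i.+1 :: iota i.+2 (n - i.+2).
Proof.
move=> lt_i; by rewrite -[n in LHS](subnKC lt_i) !addSnnS iotaD add0n.
Qed.

Lemma strand_label_root n (w : 'S_n) (t : 'I_n -> V) :
  (forall k, t k \in Delta Phi) -> forall x, strand_label w t x \in Delta Phi.
Proof.
move=> tD x; rewrite /strand_label /sfold; elim: (enum _) => //= k l IH.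
by case: ifP => _ //; apply: root_refl.
Qed.

(** Each letter of a reduced word makes the root in place i+1 pass the one in place i, and the
    labels change in the same way under an adjacent transposition. *)
Lemma Psi_fun_word n (w : 'S_n) (t : 'I_n -> V) : (forall k, t k \in Delta Phi) ->
  Psi psi w (fun_word t) = fun_word (strand_label w t).
Proof.
case: n w t => [|m] w t tD.
  rewrite /Psi (_ : reduced_word w = [::]); last first.
    have [] : reduced_decomposition w (reduced_word w).
      apply: (xgetPex [::]); exists [::]; split => //; split => //.
      by apply/permP => -[].
    by move=> [+ _]; case: (reduced_word w).
  by rewrite /= /fun_word !big_ord0.
have t0 k : t k != 0 by exact: root_neq0P.
rewrite /Psi; move: w.
apply: (decomposition_ind (P := fun w s => foldr (psi_at psi) (fun_word t) s = fun_word (strand_label w t))) => [|i w s lt_i w01 IH] /=.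
  by apply: eq_bigr => x _; rewrite strand_label1.
rewrite IH !fun_wordE (iota_split lt_i) !map_cat /=.
have szE : size [seq strand_label w t (inord x) | x <- iota 0 i] = i.
  by rewrite size_map size_iota.
rewrite -[X in psi_at _ X]szE psi_at_swap; first last.
- exact: strand_label_root.
- exact: strand_label_root.
- by move=> v /mapP[x _ ->]; exact: strand_label_root.
- by move=> v /mapP[x _ ->]; exact: strand_label_root.
rewrite strand_label_left // strand_label_right //.
congr (root_word (_ ++ _ :: _ :: _)); apply/eq_in_map => x; rewrite mem_iota => xi.
  rewrite strand_label_far // -(inj_eq val_inj) /= !inordK ?(ltnW lt_i) //; move: xi lt_i; lia.
rewrite strand_label_far // -(inj_eq val_inj) /= !inordK ?(ltnW lt_i) //; move: xi lt_i; lia.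
Qed.

Lemma drop_strand_root m (j : 'I_m.+1) (t : 'I_m.+1 -> V) :
  (forall k, t k \in Delta Phi) -> forall k, drop_strand j t k \in Delta Phi.
Proof. by move=> tD k; rewrite /drop_strand; case: ifP => _ //; apply: root_refl. Qed.

Lemma braided_sym_fun_word0 (t : 'I_0 -> V) : braided_sym psi 0 (fun_word t) = 1.
Proof.
rewrite /braided_sym (eq_bigr (fun=> 1)) => [|w _]; last first.
  by rewrite Psi_fun_word => [|[]//]; rewrite /fun_word big_ord0.
by rewrite sumr_const cardT -cardE card_Sn.
Qed.

(** The permutations are grouped by the strand j that ends last: it leaves its own root as the last
    factor, and the other strands form the symmetrizer of one strand fewer on [drop_strand j t]. *)
Lemma braided_sym_fun_word m (t : 'I_m.+1 -> V) : (forall k, t k \in Delta Phi) ->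
  braided_sym psi m.+1 (fun_word t) =
  \sum_j braided_sym psi m (fun_word (drop_strand j t)) * root_symbol Phi (t j).
Proof.
move=> tD; have t0 k : t k != 0 by exact: root_neq0P.
rewrite /braided_sym (eq_bigr _ (fun w _ => Psi_fun_word w tD)).
pose F (w : 'S_m.+1) := w ord_max.
rewrite (partition_big F xpredT) //=; apply: eq_bigr => j _.
rewrite mulr_suml (reindex (lift_perm ord_max j)); last first.
  (* The inverse of [lift_perm]: delete the last place together with its image. *)
  pose ulsf i (s : 'S_m.+1) k := odflt k (unlift (s i) (s (lift i k))).
  have ulsfK i (s : 'S_m.+1) k: lift (s i) (ulsf i s k) = s (lift i k).
    rewrite /ulsf; have:= neq_lift i k.
    by rewrite -(can_eq (permK s)) => /unlift_some[] ? ? ->.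
  have inj_ulsf : injective (ulsf ord_max _).
    move=> s; apply: can_inj (ulsf (s ord_max) s^-1%g) _ => k'.
    by rewrite {1}/ulsf ulsfK !permK liftK.
  exists (fun s => perm (inj_ulsf s)) => [s _ | s].
    by apply/permP=> k'; rewrite permE /ulsf lift_perm_lift lift_perm_id liftK.
  rewrite /F inE => /eqP si; apply/permP => k.
  case: (unliftP ord_max k) => [k'|] ->; rewrite ?lift_perm_id // lift_perm_lift -si.
  by rewrite permE ulsfK.
apply: eq_big => [w|w _]; first by rewrite /F lift_perm_id eqxx.
rewrite (Psi_fun_word w (drop_strand_root _ tD)) {1}/fun_word big_ord_recr /=.
rewrite strand_label_last; congr (_ * _); apply: eq_bigr => x _.
by rewrite -(strand_label_lift _ _ _ t0); congr (root_symbol _ (strand_label _ _ _)); apply/val_inj; rewrite /= /bump leqNgt ltn_ord.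
Qed.

End RootWords.

(** * Twisted derivations *)

(* A twisted derivation D(x y) = x D(y) + D(x) s(y) is the upper right entry of a
   ring morphism with values x |-> [[x, D x], [0, s x]]. *)
Section UpperTriangular.
Variable A : nzRingType.

Definition utri (x y z : A) : 'M[A]_2 :=
  \matrix_(i, j) if i == 0 then if j == 0 then x else y else if j == 0 then 0 else z.

Lemma utriM x y z x' y' z' :
  utri x y z * utri x' y' z' = utri (x * x') (x * y' + y * z') (z * z').
Proof.
apply/matrixP => i j; rewrite -mulmxE !mxE !big_ord_recl big_ord0 /= !mxE /= addr0.
by case: (i == 0); case: (j == 0); rewrite ?mulr0 ?mul0r ?addr0 ?add0r.
Qed.

Lemma utriD x y z x' y' z' :
  utri x y z + utri x' y' z' = utri (x + x') (y + y') (z + z').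
Proof.
apply/matrixP => i j; rewrite !mxE.
by case: (i == 0); case: (j == 0); rewrite ?addr0.
Qed.

Lemma utri0 : utri 0 0 0 = 0.
Proof. by apply/matrixP => i j; rewrite !mxE; case: (i == 0); case: (j == 0). Qed.

Lemma utri_scalar x : x%:M = utri x 0 x.
Proof.
apply/matrixP => i j; rewrite !mxE.
by case: i => -[|[|//]] ?; case: j => -[|[|//]] ?.
Qed.

Lemma utri1 : utri 1 0 1 = 1.
Proof. by rewrite -utri_scalar. Qed.

Lemma utri_inj x y z x' y' z' : utri x y z = utri x' y' z' -> [/\ x = x', y = y' & z = z'].
Proof.
move/matrixP => h; split.
- by have := h 0 0; rewrite !mxE.
- by have := h 0 1; rewrite !mxE.
- by have := h 1 1; rewrite !mxE.
Qed.

End UpperTriangular.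

Section TriangularMorphism.
Variables (A : nzRingType) (M : {rmorphism A -> 'M[A]_2}).

Definition triangular_at (x : A) : Prop := exists y z, M x = utri x y z.

Lemma triangular_atD x y : triangular_at x -> triangular_at y -> triangular_at (x + y).
Proof.
by case=> x1 [x2 xE] [y1 [y2 yE]]; exists (x1 + y1), (x2 + y2); rewrite rmorphD /= xE yE utriD.
Qed.

Lemma triangular_at0 : triangular_at 0.
Proof. by exists 0, 0; rewrite rmorph0 utri0. Qed.

Lemma triangular_at1 : triangular_at 1.
Proof. by exists 0, 1; rewrite rmorph1 utri1. Qed.

Lemma triangular_atM x y : triangular_at x -> triangular_at y -> triangular_at (x * y).
Proof.
case=> x1 [x2 xE] [y1 [y2 yE]]; exists (x * y1 + x1 * y2), (x2 * y2).
by rewrite rmorphM /= xE yE utriM.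
Qed.

Lemma triangular_at_prod (I : Type) (r : seq I) (F : I -> A) :
  (forall i, triangular_at (F i)) -> triangular_at (\prod_(i <- r) F i).
Proof.
move=> FT; elim: r => [|i r IH]; first by rewrite big_nil; exact: triangular_at1.
by rewrite big_cons; apply: triangular_atM.
Qed.

Hypothesis MT : forall x, triangular_at x.

Definition tri_der (x : A) : A := M x 0 1.
Definition tri_end (x : A) : A := M x 1 1.

Lemma triE x : M x = utri x (tri_der x) (tri_end x).
Proof.
by have [y [z xE]] := MT x; rewrite xE; congr (utri _ _ _); rewrite /tri_der /tri_end xE !mxE.
Qed.

Lemma tri_der_utri x y z : M x = utri x y z -> tri_der x = y.
Proof. by rewrite triE => /utri_inj[]. Qed.
Lemma tri_end_utri x y z : M x = utri x y z -> tri_end x = z.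
Proof. by rewrite triE => /utri_inj[]. Qed.

Lemma tri_derB : zmod_morphism tri_der.
Proof. by move=> x y; rewrite /tri_der rmorphB /= !mxE. Qed.
Lemma tri_endB : zmod_morphism tri_end.
Proof. by move=> x y; rewrite /tri_end rmorphB /= !mxE. Qed.

Lemma tri_derM x y : tri_der (x * y) = x * tri_der y + tri_der x * tri_end y.
Proof. by apply: (@tri_der_utri _ _ (tri_end x * tri_end y)); rewrite rmorphM /= !triE utriM. Qed.
Lemma tri_endM x y : tri_end (x * y) = tri_end x * tri_end y.
Proof. by apply: (@tri_end_utri _ (x * tri_der y + tri_der x * tri_end y)); rewrite rmorphM /= !triE utriM. Qed.
Lemma tri_der1 : tri_der 1 = 0.
Proof. by apply: (@tri_der_utri _ _ 1); rewrite rmorph1 utri1. Qed.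
Lemma tri_end1 : tri_end 1 = 1.
Proof. by apply: (@tri_end_utri _ 0); rewrite rmorph1 utri1. Qed.

End TriangularMorphism.

(** * The smash product of the lattice group algebra with the tensor algebra *)

Section Smash.
Variables (R : realType) (d : nat) (Phi : root_datum R d) (h : nat).
Local Notation V := 'rV[R]_d.
Local Notation TVW := (monalg rat (word (Deltap Phi))).
Local Notation P' := (lat Phi h).
Local Notation ZPT := (monalg rat (smash_monoid Phi h)).
Local Notation QP := (monalg rat (expo P')).

Lemma smash_mulE (x y : smash_monoid Phi h) :
  (x * y)%g = (x.1 + word_act x.2 y.1, x.2 ++ y.2).
Proof. by []. Qed.

Section UniversalProperty.
Variables (A : pzRingType) (u : {rmorphism rat -> A}) (X : P' -> A) (v : Deltap Phi -> A).
Hypothesis uX : forall c l, u c * X l = X l * u c.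
Hypothesis uv : forall c a, u c * v a = v a * u c.
Hypothesis X0 : X 0 = 1.
Hypothesis XD : forall l m, X (l + m) = X l * X m.
Hypothesis vX : forall a l, v a * X l = X (lat_refl (pos_root a) l) * v a.

(** The letters are free, so moving a letter past X^l is the only relation that mixes the images of
    the letters and of the X^l. *)
Definition smash_basis_hom (y : smash_monoid Phi h) : A := X y.1 * \prod_(a <- y.2) v a.
Definition smash_hom : ZPT -> A := mextend u smash_basis_hom.

Let wordX (t : word (Deltap Phi)) l :
  (\prod_(a <- t) v a) * X l = X (word_act t l) * \prod_(a <- t) v a.
Proof.
elim: t => [|a t IH]; first by rewrite !big_nil mul1r mulr1.
by rewrite !big_cons -mulrA IH !mulrA vX.
Qed.

Lemma smash_basis_homM x y : smash_basis_hom (x * y)%g = smash_basis_hom x * smash_basis_hom y.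
Proof.
rewrite /smash_basis_hom smash_mulE /= XD big_cat /= -!mulrA; congr (_ * _).
by rewrite !mulrA wordX.
Qed.

Lemma smash_basis_hom_comm c x : u c * smash_basis_hom x = smash_basis_hom x * u c.
Proof.
rewrite /smash_basis_hom mulrA uX -!mulrA; congr (_ * _).
elim: x.2 => [|a t IH]; first by rewrite big_nil mulr1 mul1r.
by rewrite big_cons mulrA uv -!mulrA IH.
Qed.

Lemma smash_hom_is_zmod : zmod_morphism smash_hom.
Proof. exact: mextend_is_zmod. Qed.

Lemma smash_hom_is_monoid : monoid_morphism smash_hom.
Proof.
split; last exact: mextendM smash_basis_homM smash_basis_hom_comm.
by apply: mextend1; rewrite /smash_basis_hom X0 big_nil mulr1.
Qed.

Lemma smash_hom_term y c : smash_hom (mterm y c) = u c * (X y.1 * \prod_(a <- y.2) v a).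
Proof. exact: mextend_term. Qed.

Lemma smash_hom_basis y : smash_hom (mbasis rat y) = X y.1 * \prod_(a <- y.2) v a.
Proof. exact: mextend_basis. Qed.

End UniversalProperty.

Definition ZX (l : P') : ZPT := mbasis rat ((l, [::]) : smash_monoid Phi h).
Definition Zletter (a : Deltap Phi) : ZPT := mbasis rat ((0, [:: a]) : smash_monoid Phi h).
Definition Zroot (v : V) : ZPT := @TVW_to_ZPT R d Phi h (root_symbol Phi v).

Lemma ZXD l m : ZX (l + m) = ZX l * ZX m.
Proof.
by rewrite /ZX -mbasisM; congr (mbasis _ _); rewrite smash_mulE /=.
Qed.

Lemma ZX0 : ZX 0 = 1.
Proof. exact: mbasis1. Qed.

Lemma Zletter_X a l : Zletter a * ZX l = ZX (lat_refl (pos_root a) l) * Zletter a.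
Proof.
rewrite /ZX /Zletter -!mbasisM; congr (mbasis _ _); rewrite !smash_mulE /=.
by rewrite addr0 add0r.
Qed.

Lemma TVW_to_ZPT_is_zmod : zmod_morphism (@TVW_to_ZPT R d Phi h).
Proof. exact: mextend_is_zmod. Qed.
HB.instance Definition _ := GRing.isZmodMorphism.Build TVW ZPT _ TVW_to_ZPT_is_zmod.

Lemma TVW_to_ZPT_is_monoid : monoid_morphism (@TVW_to_ZPT R d Phi h).
Proof.
split; first exact: mextend1.
apply: mextendM => [x y|c x]; last exact: mconst_comm.
by rewrite -mbasisM; congr (mbasis _ _); rewrite smash_mulE /= raddf0 addr0.
Qed.
HB.instance Definition _ := GRing.isMonoidMorphism.Build TVW ZPT _ TVW_to_ZPT_is_monoid.

Lemma TVW_to_ZPT_basis t : @TVW_to_ZPT R d Phi h (mbasis rat t) = mbasis rat ((0, t) : smash_monoid Phi h).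
Proof. exact: mextend_basis. Qed.

Lemma Zroot_pos (a : Deltap Phi) : Zroot (val a) = Zletter a.
Proof. by rewrite /Zroot pos_root_symbol TVW_to_ZPT_basis. Qed.

Lemma ZrootN v : v \in Delta Phi -> Zroot (- v) = - Zroot v.
Proof. by move=> vD; rewrite /Zroot root_symbolN // raddfN. Qed.

Lemma Zroot_sign (e : bool) v : v \in Delta Phi -> Zroot ((-1) ^+ e *: v) = (-1) ^+ e * Zroot v.
Proof. by case: e => vD; rewrite ?scale1r ?mul1r // scaleN1r mulN1r ZrootN. Qed.

Lemma lat_refl_conj (b : Delta Phi) (a a' : Delta Phi) (l : P') :
  val a' = refl (val b) (val a) ->
  lat_refl a' (lat_refl b l) = lat_refl b (lat_refl a l).
Proof.
by move=> E; apply: val_inj; rewrite /= E refl_conj // (root_neq0P (valP b)).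
Qed.

Lemma Zroot_X (v : Delta Phi) l : Zroot (val v) * ZX l = ZX (lat_refl v l) * Zroot (val v).
Proof.
have [e [a E]] := root_signP (valP v); rewrite E.
rewrite (Zroot_sign _ (pos_sub (valP a))) Zroot_pos -mulrA Zletter_X.
have -> : lat_refl v l = lat_refl (pos_root a) l.
  by apply: val_inj; rewrite /= E refl_signl.
by rewrite !mulrA; congr (_ * _); rewrite commr_sign.
Qed.

Lemma ZPT_term (y : smash_monoid Phi h) c :
  mterm y c = mconst _ c * (ZX y.1 * \prod_(a <- y.2) Zletter a).
Proof.
rewrite mterm_const; congr (_ * _); case: y => l t /=.
have -> : \prod_(a <- t) Zletter a = mbasis rat ((0, t) : smash_monoid Phi h).
  elim: t => [|a t IH]; first by rewrite big_nil.
  by rewrite big_cons IH /Zletter -mbasisM smash_mulE /= raddf0 addr0.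
by rewrite /ZX -mbasisM smash_mulE /= addr0.
Qed.

Definition mconst_mx (c : rat) : 'M[ZPT]_2 :=
  utri (mconst (smash_monoid Phi h) c) 0 (mconst (smash_monoid Phi h) c).

Lemma mconst_mx_is_zmod : zmod_morphism mconst_mx.
Proof.
move=> c e; rewrite /mconst_mx !raddfB /=; apply/matrixP => i j; rewrite !mxE.
by case: (i == 0); case: (j == 0); rewrite ?subr0.
Qed.
HB.instance Definition _ := GRing.isZmodMorphism.Build rat 'M[ZPT]_2 _ mconst_mx_is_zmod.
Lemma mconst_mx_is_monoid : monoid_morphism mconst_mx.
Proof.
split=> [|c e]; first by rewrite /mconst_mx rmorph1 utri1.
by rewrite /mconst_mx utriM !rmorphM /= mulr0 mul0r addr0.
Qed.
HB.instance Definition _ := GRing.isMonoidMorphism.Build rat 'M[ZPT]_2 _ mconst_mx_is_monoid.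

Lemma mconst_mx_utri c x y z : mconst_mx c * utri x y z =
  utri (mconst _ c * x) (mconst _ c * y) (mconst _ c * z).
Proof. by rewrite /mconst_mx utriM mul0r addr0. Qed.

Lemma mconst_mx_comm c x y z : mconst_mx c * utri x y z = utri x y z * mconst_mx c.
Proof.
rewrite mconst_mx_utri /mconst_mx utriM mulr0 add0r.
by rewrite (mconst_comm c x) (mconst_comm c y) (mconst_comm c z).
Qed.

Section TwistedDerivation.
Variable b : Deltap Phi.

Definition tder_X (l : P') := utri (ZX l) 0 (ZX (lat_refl (pos_root b) l)).
Definition tder_letter (a : Deltap Phi) :=
  utri (Zletter a) (a == b)%:R (Zroot (refl (val b) (val a))).
Definition tder_mx : ZPT -> 'M[ZPT]_2 := smash_hom mconst_mx tder_X tder_letter.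

Lemma lat_reflD h' (a : Delta Phi) (l m : lat Phi h') :
  lat_refl a (l + m) = lat_refl a l + lat_refl a m.
Proof. by apply: val_inj; rewrite /= reflD. Qed.

Lemma lat_refl0 h' (a : Delta Phi) : lat_refl a (0 : lat Phi h') = 0.
Proof. by apply: val_inj; rewrite /= refl0. Qed.

Lemma tder_X0 : tder_X 0 = 1.
Proof. by rewrite /tder_X lat_refl0 !ZX0 utri1. Qed.

Lemma tder_XD l m : tder_X (l + m) = tder_X l * tder_X m.
Proof. by rewrite /tder_X utriM lat_reflD !ZXD mulr0 mul0r addr0. Qed.

(** The lower right entries agree because conjugating s_a by s_b gives the reflection in s_b a. The
    upper right entry is nonzero only for a = b, where both sides give X^(s_b l). *)
Lemma tder_letter_X a l :
  tder_letter a * tder_X l = tder_X (lat_refl (pos_root a) l) * tder_letter a.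
Proof.
pose b' := pos_root b; pose a' := pos_root a.
pose ba : Delta Phi := FSetSub (root_refl (valP b') (valP a')).
rewrite /tder_X /tder_letter !utriM !mulr0 !mul0r !add0r !addr0 Zletter_X; congr (utri _ _ _).
  case: eqP => [->|_]; last by rewrite mul0r mulr0.
  by rewrite mul1r mulr1.
rewrite -[refl (val b) (val a)]/(val ba) Zroot_X.
by rewrite (@lat_refl_conj b' a' ba l).
Qed.

Lemma tder_mx_is_zmod : zmod_morphism tder_mx.
Proof. exact: smash_hom_is_zmod. Qed.
HB.instance Definition _ := GRing.isZmodMorphism.Build ZPT 'M[ZPT]_2 tder_mx tder_mx_is_zmod.

Lemma tder_mx_is_monoid : monoid_morphism tder_mx.
Proof.
apply: smash_hom_is_monoid => *; try exact: mconst_mx_comm.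
- exact: tder_X0.
- exact: tder_XD.
- exact: tder_letter_X.
Qed.
HB.instance Definition _ := GRing.isMonoidMorphism.Build ZPT 'M[ZPT]_2 tder_mx tder_mx_is_monoid.

Lemma tder_mx_X l : tder_mx (ZX l) = tder_X l.
Proof. by rewrite [LHS]smash_hom_basis big_nil mulr1. Qed.

Lemma tder_mx_letter a : tder_mx (Zletter a) = tder_letter a.
Proof. by rewrite [LHS]smash_hom_basis tder_X0 mul1r big_seq1. Qed.

Lemma tder_mx_const c : tder_mx (mconst _ c) = mconst_mx c.
Proof. by rewrite mconstE [LHS]smash_hom_term tder_X0 big_nil !mulr1. Qed.

Lemma tder_triangular x : triangular_at tder_mx x.
Proof.
elim/monalg_ind: x => [|x y IHx IHy|y c]; first exact: triangular_at0.
  exact: triangular_atD.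
rewrite ZPT_term; apply: triangular_atM.
  by exists 0, (mconst _ c); exact: tder_mx_const.
apply: triangular_atM.
  by exists 0, (ZX (lat_refl (pos_root b) y.1)); exact: tder_mx_X.
apply: triangular_at_prod => a.
by do 2 eexists; exact: tder_mx_letter.
Qed.

Definition tder : ZPT -> ZPT := tri_der tder_mx.
Definition trefl : ZPT -> ZPT := tri_end tder_mx.

Lemma tder_is_zmod : zmod_morphism tder.
Proof. exact: tri_derB. Qed.
HB.instance Definition _ := GRing.isZmodMorphism.Build ZPT ZPT tder tder_is_zmod.
Lemma trefl_is_zmod : zmod_morphism trefl.
Proof. exact: tri_endB. Qed.
HB.instance Definition _ := GRing.isZmodMorphism.Build ZPT ZPT trefl trefl_is_zmod.

Lemma tderM x y : tder (x * y) = x * tder y + tder x * trefl y.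
Proof. exact: (tri_derM tder_triangular). Qed.
Lemma treflM x y : trefl (x * y) = trefl x * trefl y.
Proof. exact: (tri_endM tder_triangular). Qed.
Lemma tder1 : tder 1 = 0.
Proof. exact: (tri_der1 tder_triangular). Qed.
Lemma trefl1 : trefl 1 = 1.
Proof. exact: (tri_end1 tder_triangular). Qed.

Lemma tder_ZX l : tder (ZX l) = 0.
Proof. exact: (tri_der_utri tder_triangular (tder_mx_X l)). Qed.
Lemma trefl_ZX l : trefl (ZX l) = ZX (lat_refl (pos_root b) l).
Proof. exact: (tri_end_utri tder_triangular (tder_mx_X l)). Qed.
Lemma tder_letterE a : tder (Zletter a) = (a == b)%:R.
Proof. exact: (tri_der_utri tder_triangular (tder_mx_letter a)). Qed.
Lemma trefl_letter a : trefl (Zletter a) = Zroot (refl (val b) (val a)).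
Proof. exact: (tri_end_utri tder_triangular (tder_mx_letter a)). Qed.
Lemma tder_const c : tder (mconst _ c) = 0.
Proof. exact: (tri_der_utri tder_triangular (tder_mx_const c)). Qed.

Lemma tder_constM c x : tder (mconst _ c * x) = mconst _ c * tder x.
Proof. by rewrite tderM tder_const mul0r addr0. Qed.
Lemma tder_ZXM l x : tder (ZX l * x) = ZX l * tder x.
Proof. by rewrite tderM tder_ZX mul0r addr0. Qed.

Lemma tder_sign (e : bool) x : tder ((-1) ^+ e * x) = (-1) ^+ e * tder x.
Proof. by case: e; rewrite ?mul1r // !mulN1r raddfN. Qed.
Lemma trefl_sign (e : bool) x : trefl ((-1) ^+ e * x) = (-1) ^+ e * trefl x.
Proof. by case: e; rewrite ?mul1r // !mulN1r raddfN. Qed.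

Definition root_sign (v : V) : ZPT := (v == val b)%:R - (v == - val b)%:R.

Lemma tder_Zroot v : v \in Delta Phi -> tder (Zroot v) = root_sign v.
Proof.
case/root_signP => e [a ->]; rewrite (Zroot_sign _ (pos_sub (valP a))) tder_sign Zroot_pos.
rewrite tder_letterE /root_sign.
have anb : (val a == - val b) = false.
  by apply/eqP => E; have := valP a; rewrite E (pos_oppF (valP b)).
case: e; rewrite ?scale1r ?mul1r ?scaleN1r ?mulN1r.
  by rewrite eqr_oppLR anb sub0r eqr_opp val_eqE.
by rewrite anb subr0 val_eqE.
Qed.

Lemma trefl_Zroot v : v \in Delta Phi -> trefl (Zroot v) = Zroot (refl (val b) v).
Proof.
case/root_signP => e [a ->]; rewrite (Zroot_sign _ (pos_sub (valP a))) trefl_sign Zroot_pos.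
rewrite trefl_letter reflZ Zroot_sign //; apply: root_refl; apply: pos_sub; exact: valP.
Qed.

End TwistedDerivation.

Definition degree0 : ZPT -> QP :=
  smash_hom (@mconst rat (expo P')) (fun l => mbasis rat (l : expo P')) (fun=> 0).

Lemma degree0_is_zmod : zmod_morphism degree0.
Proof. exact: smash_hom_is_zmod. Qed.
HB.instance Definition _ := GRing.isZmodMorphism.Build ZPT QP degree0 degree0_is_zmod.
Lemma degree0_is_monoid : monoid_morphism degree0.
Proof.
apply: smash_hom_is_monoid => [*|*||l m|*]; try exact: mconst_comm.
- exact: mbasis1.
- by rewrite -mbasisM.
- by rewrite mul0r mulr0.
Qed.
HB.instance Definition _ := GRing.isMonoidMorphism.Build ZPT QP degree0 degree0_is_monoid.

Lemma degree0_ZX l : degree0 (ZX l) = mbasis rat (l : expo P').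
Proof. by rewrite [LHS]smash_hom_basis big_nil mulr1. Qed.
Lemma degree0_letter a : degree0 (Zletter a) = 0.
Proof. by rewrite [LHS]smash_hom_basis big_seq1 mulr0. Qed.
Lemma degree0_const c : degree0 (mconst _ c) = mconst _ c.
Proof. by rewrite (mconstE (smash_monoid Phi h)) [LHS]smash_hom_term big_nil mulr1 mulr1. Qed.
Lemma degree0_Zroot v : v \in Delta Phi -> degree0 (Zroot v) = 0.
Proof.
case/root_signP => e [a ->]; rewrite (Zroot_sign _ (pos_sub (valP a))) Zroot_pos.
by rewrite rmorphM /= degree0_letter mulr0.
Qed.

End Smash.

Lemma mcoef_constM (k : nzRingType) (M : monoidType) (c : k) (f : monalg k M) x :
  mcoef x (mconst M c * f) = c * mcoef x f.
Proof.
elim/monalg_ind: f => [|f g Hf Hg|y e]; rewrite ?mulr0 ?raddf0 ?mulr0 //.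
  by rewrite mulrDr !raddfD /= mulrDr Hf Hg.
by rewrite mconstE mtermM mul1g !mcoef_term mulrnAr.
Qed.

Lemma mcoef_const0 (k : nzRingType) (M : monoidType) (c : k) :
  mcoef (1 : M)%g (mconst M c) = c.
Proof. by rewrite mconstE mcoef_term eqxx. Qed.

(** * Iterated derivations and the kernel of the braided symmetrizer *)

Section Pairing.
Variables (R : realType) (d : nat) (Phi : root_datum R d) (h : nat).
Local Notation V := 'rV[R]_d.
Local Notation TVW := (monalg rat (word (Deltap Phi))).
Local Notation P' := (lat Phi h).
Local Notation ZPT := (monalg rat (smash_monoid Phi h)).
Local Notation psi := (@VW_braiding R d Phi).
Local Notation Zroot := (@Zroot R d Phi h).
Local Notation tder := (@tder R d Phi h).
Local Notation degree0 := (@degree0 R d Phi h).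

Definition sign_at (b : Deltap Phi) (v : V) : rat := (v == val b)%:R - (v == - val b)%:R.

Lemma root_signE b v : root_sign h b v = mconst (smash_monoid Phi h) (sign_at b v).
Proof. by rewrite /root_sign /sign_at rmorphB /= !rmorph_nat. Qed.

Definition iter_tder (bs : seq (Deltap Phi)) (x : ZPT) : ZPT :=
  foldl (fun y b => tder b y) x bs.

Lemma iter_tder_is_zmod bs : zmod_morphism (iter_tder bs).
Proof.
by elim: bs => [|b bs IH] x y //=; rewrite [tder b _]raddfB IH.
Qed.
HB.instance Definition _ bs :=
  GRing.isZmodMorphism.Build ZPT ZPT (iter_tder bs) (iter_tder_is_zmod bs).

Lemma iter_tder_constM bs c x : iter_tder bs (mconst _ c * x) = mconst _ c * iter_tder bs x.
Proof. by elim: bs x => [|b bs IH] x //=; rewrite tder_constM IH. Qed.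
Lemma iter_tder_ZXM bs l x : iter_tder bs (ZX l * x) = ZX l * iter_tder bs x.
Proof. by elim: bs x => [|b bs IH] x //=; rewrite tder_ZXM IH. Qed.

Definition Zfun n (t : 'I_n -> V) : ZPT := \prod_(x < n) Zroot (t x).

Lemma ZfunE n (t : 'I_n -> V) : Zfun t = TVW_to_ZPT h (fun_word Phi t).
Proof. by rewrite /Zfun /fun_word rmorph_prod. Qed.

Lemma Zfun_recl m (t : 'I_m.+1 -> V) : Zfun t = Zroot (t ord0) * Zfun (t \o lift ord0).
Proof. exact: big_ord_recl. Qed.

Lemma eq_Zfun n (t t' : 'I_n -> V) : t =1 t' -> Zfun t = Zfun t'.
Proof. by move=> tt'; apply: eq_bigr => x _; rewrite tt'. Qed.

Lemma trefl_Zfun b n (t : 'I_n -> V) : (forall k, t k \in Delta Phi) ->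
  trefl b (Zfun t) = Zfun (fun k => refl (val b) (t k)).
Proof.
elim: n t => [|n IH] t tD; first by rewrite /Zfun !big_ord0 trefl1.
by rewrite !Zfun_recl treflM trefl_Zroot // IH //= => k; exact: tD.
Qed.

Lemma drop_strand0 m (t : 'I_m.+1 -> V) : drop_strand ord0 t =1 refl (t ord0) \o (t \o lift ord0).
Proof. by move=> x; rewrite /drop_strand. Qed.

Lemma drop_strand_lift0 m (t : 'I_m.+2 -> V) j :
  drop_strand (lift ord0 j) t ord0 = t ord0.
Proof. by rewrite /drop_strand /=; congr t; apply: val_inj. Qed.

Lemma drop_strand_lift m (t : 'I_m.+2 -> V) j x :
  drop_strand (lift ord0 j) t (lift ord0 x) = drop_strand j (t \o lift ord0) x.
Proof.
rewrite /drop_strand /= /bump !leq0n !add1n ltnS.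
have -> : lift (lift ord0 j) (lift ord0 x) = lift ord0 (lift j x); last by [].
by apply: val_inj; rewrite /= /bump !leq0n !add1n ltnS addnS.
Qed.

(** The Leibniz rule removes factor j and applies s_b to the factors on its right. A term survives
    only if [t j] is plus or minus b, and then s_b is the reflection in [t j], so [drop_strand j t]
    remains. *)
Lemma tder_Zfun b m (t : 'I_m.+1 -> V) : (forall k, t k \in Delta Phi) ->
  tder b (Zfun t) = \sum_j mconst _ (sign_at b (t j)) * Zfun (drop_strand j t).
Proof.
elim: m t => [|m IH] t tD.
  rewrite Zfun_recl big_ord_recl big_ord0 addr0 /Zfun !big_ord0 !mulr1.
  by rewrite tder_Zroot // root_signE.
rewrite Zfun_recl tderM tder_Zroot // root_signE IH => [|k]; last exact: tD.
rewrite [RHS]big_ord_recl addrC; congr (_ + _).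
  rewrite (eq_Zfun (drop_strand0 t)) trefl_Zfun => [|k]; last exact: tD.
  rewrite /sign_at; case: eqP => [tb|_].
    by congr (_ * _); apply: eq_Zfun => k /=; rewrite tb.
  case: eqP => [tb|_]; last by rewrite subr0 raddf0 !mul0r.
  by congr (_ * _); apply: eq_Zfun => k /=; rewrite tb refl_oppl.
rewrite mulr_sumr; apply: eq_bigr => j _.
rewrite mulrA -(mconst_comm _ (Zroot (t ord0))) -mulrA; congr (_ * _).
rewrite [RHS]Zfun_recl drop_strand_lift0; congr (_ * _).
by apply: eq_Zfun => x /=; rewrite drop_strand_lift.
Qed.

Lemma mcoef_rcons (c : word (Deltap Phi)) b (y : TVW) v : v \in Delta Phi ->
  mcoef (rcons c b : word (Deltap Phi)) (y * root_symbol Phi v) = sign_at b v * mcoef c y.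
Proof.
case/root_signP => e [a ->]; rewrite root_symbol_sign mulrA (commr_sign y e) -mulrA.
have -> : ((-1) ^+ e : TVW) = mconst (word (Deltap Phi)) ((-1) ^+ e).
  by rewrite rmorphXn /= rmorphN1.
rewrite mcoef_constM.
have -> : sign_at b ((-1) ^+ e *: val a) = (-1) ^+ e * (a == b)%:R.
  have anb : (val a == - val b) = false.
    by apply/eqP => E; have := valP a; rewrite E (pos_oppF (valP b)).
  rewrite /sign_at; case: e; rewrite ?scale1r ?mul1r ?scaleN1r ?mulN1r.
    by rewrite eqr_oppLR anb sub0r eqr_opp val_eqE.
  by rewrite anb subr0 val_eqE.
rewrite -mulrA; congr (_ * _).
elim/monalg_ind: y => [|f g Hf Hg|w q].
- by rewrite mul0r !raddf0 mulr0.
- by rewrite mulrDl !raddfD /= mulrDr Hf Hg.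
rewrite mbasisE mtermM mulr1 !mcoef_term.
have -> : ((w * ([:: a] : word (Deltap Phi)))%g == rcons c b :> word (Deltap Phi)) = (w == c) && (a == b).
  by rewrite -[(_ * _)%g]/(w ++ [:: a]) cats1 eqseq_rcons.
by case: (w == c); case: (a == b); rewrite ?mul0r ?mul1r ?mulr0n.
Qed.

Lemma degree0_Zfun m (t : 'I_m.+1 -> V) : (forall k, t k \in Delta Phi) -> degree0 (Zfun t) = 0.
Proof. by move=> tD; rewrite Zfun_recl rmorphM /= degree0_Zroot // mul0r. Qed.

Lemma degree0M x y : degree0 (x * y) = degree0 x * degree0 y.
Proof. exact: rmorphM. Qed.
Lemma TVW_to_ZPTM (x y : TVW) : TVW_to_ZPT h (x * y) = TVW_to_ZPT h x * TVW_to_ZPT h y.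
Proof. exact: rmorphM. Qed.

Lemma iter_tder0 bs : iter_tder bs 0 = 0.
Proof. exact: raddf0. Qed.

(* In the sum over S_(n+1), the permutations moving position j last give the
   derivative of the factor t j, the other factors being those of drop_strand. *)
Theorem braided_sym_pairing n (t : 'I_n -> V) (c : word (Deltap Phi)) :
  (forall k, t k \in Delta Phi) ->
  degree0 (iter_tder (rev c) (Zfun t)) =
  mconst _ (if size c == n then mcoef c (braided_sym psi n (fun_word Phi t)) else 0).
Proof.
elim: n t c => [|n IH] t c tD.
  rewrite /Zfun big_ord0; case/lastP: c => [|c b].
    have -> : mcoef (1 : word (Deltap Phi))%g (braided_sym psi 0 (fun_word Phi t)) = 1.
      by rewrite braided_sym_fun_word0 -(rmorph1 (@mconst rat (word (Deltap Phi)))) mcoef_const0.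
    by rewrite /= [RHS]rmorph1; exact: (rmorph1 degree0).
  by rewrite rev_rcons size_rcons /= tder1 iter_tder0 !raddf0.
case/lastP: c => [|c b]; first by rewrite /= degree0_Zfun // raddf0.
rewrite rev_rcons size_rcons /= tder_Zfun // eqSS braided_sym_fun_word //.
rewrite (raddf_sum (iter_tder (rev c))) (raddf_sum degree0).
transitivity (\sum_j mconst (expo P') (if size c == n then
    sign_at b (t j) * mcoef (c : word (Deltap Phi)) (braided_sym psi n (fun_word Phi (drop_strand j t))) else 0)).
  apply: eq_bigr => j _; rewrite /= iter_tder_constM degree0M degree0_const.
  rewrite [X in _ * X]IH; last exact: drop_strand_root.
  by rewrite -[in LHS]rmorphM; case: ifP => _ //; rewrite mulr0.
case: ifP => _; last by rewrite raddf0 big1 // => j _; rewrite raddf0.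
by rewrite !raddf_sum; apply: eq_bigr => j _; rewrite /= mcoef_rcons.
Qed.

(** The working criterion for vanishing in B(V_W)<P'>, by [killed_nichols]. It is stable under sums
    and rational multiples and, by [killedP], can be tested on the degree 0 part and the first
    derivatives. *)
Definition killed (x : ZPT) : Prop := forall bs, degree0 (iter_tder bs x) = 0.

Lemma killed0 : killed 0.
Proof. by move=> bs; rewrite !raddf0. Qed.
Lemma killedD x y : killed x -> killed y -> killed (x + y).
Proof. by move=> kx ky bs; rewrite !raddfD /= kx ky addr0. Qed.
Lemma killedN x : killed x -> killed (- x).
Proof. by move=> kx bs; rewrite !raddfN /= kx oppr0. Qed.
Lemma killedB x y : killed x -> killed y -> killed (x - y).
Proof. by move=> kx /killedN; exact: killedD. Qed.
Lemma killed_constM c x : killed x -> killed (mconst _ c * x).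
Proof. by move=> kx bs; rewrite iter_tder_constM rmorphM /= kx mulr0. Qed.

Lemma killedP x : degree0 x = 0 -> (forall b, killed (tder b x)) -> killed x.
Proof. by move=> x0 kx [//|b bs] /=; exact: kx. Qed.

(** The kernels generating the Nichols ideal lie in the tensor algebra and are homogeneous in
    length, so [x] is cut up both by the power of X and by length. *)
Definition component (l : P') (n : nat) (x : ZPT) : TVW :=
  \sum_(y <- msupp x | (y.1 == l) && (size y.2 == n)) mterm y.2 (mcoef y x).

Lemma mterm_word (t : word (Deltap Phi)) q :
  mterm t q = mconst (word (Deltap Phi)) q * fun_word Phi (fun i => val (tnth (in_tuple t) i)).
Proof.
rewrite mterm_const; congr (_ * _); rewrite /fun_word.
rewrite -(big_tuple _ _ (in_tuple t) xpredT (fun a => root_symbol Phi (val a))) /=.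
elim: t => [|a t IH]; first by rewrite big_nil.
by rewrite big_cons -IH pos_root_symbol -mbasisM.
Qed.

Lemma psi_at_constM i c x : psi_at psi i (mconst _ c * x) = mconst _ c * psi_at psi i x.
Proof.
elim/monalg_ind: x => [|f g Hf Hg|y e].
- by rewrite !(mulr0, raddf0).
- by rewrite mulrDr !raddfD /= mulrDr Hf Hg.
rewrite mconstE mtermM mul1g /psi_at !mextend_term /= -mconstE rmorphM.
by rewrite mulrA.
Qed.

Lemma Psi_is_zmod n (w : 'S_n) : zmod_morphism (Psi psi w).
Proof.
move=> x y; rewrite /Psi; elim: (reduced_word w) => //= i s ->.
by rewrite [LHS]raddfB.
Qed.
HB.instance Definition _ n (w : 'S_n) :=
  GRing.isZmodMorphism.Build TVW TVW (Psi psi w) (Psi_is_zmod w).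

Lemma braided_sym_is_zmod n : zmod_morphism (@braided_sym _ psi n).
Proof.
by move=> x y; rewrite /braided_sym -sumrB; apply: eq_bigr => w _; rewrite raddfB.
Qed.
HB.instance Definition _ n :=
  GRing.isZmodMorphism.Build TVW TVW (@braided_sym _ psi n) (@braided_sym_is_zmod n).

Lemma braided_sym_constM n c x : braided_sym psi n (mconst _ c * x) = mconst _ c * braided_sym psi n x.
Proof.
rewrite /braided_sym mulr_sumr; apply: eq_bigr => w _; rewrite /Psi.
by elim: (reduced_word w) => //= i s ->; rewrite psi_at_constM.
Qed.

Lemma ZPT_termE (y : smash_monoid Phi h) c :
  mterm y c = mconst _ c * (ZX y.1 * Zfun (fun i => val (tnth (in_tuple y.2) i))).
Proof.
rewrite ZPT_term; congr (_ * (_ * _)); rewrite /Zfun.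
rewrite -(big_tuple _ _ (in_tuple y.2) xpredT (fun a => Zroot (val a))) /=.
by apply: eq_bigr => a _; rewrite Zroot_pos.
Qed.

Lemma degree0_iter_tder_term (c : word (Deltap Phi)) l (y : smash_monoid Phi h) q :
  mcoef (l : expo P') (degree0 (iter_tder (rev c) (mterm y q))) =
  (if (y.1 == l) && (size y.2 == size c) then mcoef c (braided_sym psi (size c) (mterm y.2 q)) else 0).
Proof.
rewrite ZPT_termE iter_tder_constM iter_tder_ZXM !degree0M degree0_const degree0_ZX.
have tD k : val (tnth (in_tuple y.2) k) \in Delta Phi by apply: pos_sub; exact: valP.
rewrite [X in _ * (_ * X)](braided_sym_pairing c tD) mbasisE mconstE (mconstE _ (if _ then _ else _)).
rewrite !mtermM mul1g mulg1 mul1r mcoef_term (eq_sym (size c)).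
have -> : (y.1 == l :> expo P') = (y.1 == l :> P') by [].
case: (y.1 == l :> P'); rewrite ?mulr0n // mulr1n /=.
case: eqP => [e|_]; last by rewrite mulr0.
by rewrite -e mterm_word braided_sym_constM mcoef_constM.
Qed.

Lemma mcoef_braided_sym_size n (t c : word (Deltap Phi)) q : size t = n -> size c != n ->
  mcoef c (braided_sym psi n (mterm t q)) = 0.
Proof.
move=> tn cn; rewrite mterm_word braided_sym_constM mcoef_constM /braided_sym raddf_sum.
rewrite -tn big1 ?mulr0 // => w _.
have tD k : val (tnth (in_tuple t) k) \in Delta Phi by apply: pos_sub; exact: valP.
rewrite /= Psi_fun_word // /fun_word.
have -> : \prod_(x < size t) root_symbol Phi (strand_label w (fun i => val (tnth (in_tuple t) i)) x) =
   root_word Phi [seq strand_label w (fun i => val (tnth (in_tuple t) i)) x | x <- index_enum 'I_(size t)].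
  by rewrite /root_word big_map.
have [|e [w' [sw ->]]] := @root_wordE _ _ Phi [seq strand_label w (fun i => val (tnth (in_tuple t) i)) x | x <- index_enum 'I_(size t)].
  by move=> v /mapP[x _ ->]; exact: strand_label_root.
have -> : ((-1) ^+ e : TVW) = mconst (word (Deltap Phi)) ((-1) ^+ e).
  by rewrite rmorphXn /= rmorphN1.
rewrite mcoef_constM mbasisE mcoef_term; case: eqP => [E|_]; last by rewrite mulr0.
move: cn; rewrite -E sw size_map -tn -[index_enum _]enumT size_enum_ord.
by rewrite eqxx.
Qed.

(** The coefficient of a word of length n in sigma_n of the component is the coefficient of X^l in
    the degree 0 part of a derivative of [x], the letters being taken from the last to the first.
    Other words do not occur, since sigma_n preserves length. *)
Lemma braided_sym_component l n x : killed x -> braided_sym psi n (component l n x) = 0.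
Proof.
move=> kx; apply: monalgP => c; rewrite [RHS]raddf0 /component (raddf_sum (@braided_sym _ psi n)) raddf_sum /=.
case: (eqVneq (size c) n) => [cn|cn]; last first.
  by rewrite big1 // => y /andP[_ /eqP ys]; exact: mcoef_braided_sym_size.
have := kx (rev c) => /(congr1 (mcoef (l : expo P'))).
rewrite raddf0 {1}(monalgE x) (raddf_sum (iter_tder _)) (raddf_sum degree0) raddf_sum /= => H.
apply: etrans H; rewrite [LHS]big_mkcond /=.
by apply: eq_bigr => y _; rewrite degree0_iter_tder_term cn.
Qed.

Lemma component_size l n x t : t \in msupp (component l n x) -> size t = n.
Proof.
rewrite -mcoef_neq0 /component raddf_sum /= => h0; apply/eqP; apply: contraT => tn.
move: h0; rewrite big1 ?eqxx // => y /andP[_ ys]; rewrite mcoef_term.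
by case: eqP => // E; move: tn; rewrite -E ys.
Qed.

Lemma component_sum (x : ZPT) :
  x = \sum_(p <- undup [seq (y.1, size y.2) | y <- msupp x])
        ZX p.1 * TVW_to_ZPT h (component p.1 p.2 x).
Proof.
rewrite {1}(monalgE x).
have E y : y \in msupp x -> mterm y (mcoef y x) =
    \sum_(p <- undup [seq (y.1, size y.2) | y <- msupp x])
      (if (y.1 == p.1) && (size y.2 == p.2) then
        ZX p.1 * TVW_to_ZPT h (mterm y.2 (mcoef y x)) else 0).
  move=> yx; rewrite (bigD1_seq (y.1, size y.2)) ?undup_uniq //=; last first.
    by rewrite mem_undup; apply: map_f.
  rewrite !eqxx big1 ?addr0 => [|p]; last first.
    rewrite -pair_eqE /= => /negbTE; rewrite [y.1 == _]eq_sym [size _ == _]eq_sym.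
    by rewrite /pair_eq /= => ->.
  rewrite mterm_word rmorphM /= -ZfunE ZPT_termE mulrA.
  have -> : TVW_to_ZPT h (mconst (word (Deltap Phi)) (mcoef y x)) = mconst (smash_monoid Phi h) (mcoef y x).
    by rewrite mconstE [LHS]mextend_term mbasis1 mulr1.
  by rewrite (mconst_comm _ (ZX y.1)) mulrA.
rewrite big_seq (eq_bigr _ E) -big_seq exchange_big /=; apply: eq_bigr => p _.
by rewrite /component (raddf_sum (@TVW_to_ZPT _ _ Phi h)) mulr_sumr /= [RHS]big_mkcond.
Qed.

Theorem killed_nichols x : killed x ->
  ideal_gen (TVW_to_ZPT h @` nichols_rel psi)%classic x.
Proof.
move=> kx; rewrite (component_sum x).
have [I0 IB IM] := ideal_genP (TVW_to_ZPT h @` nichols_rel psi)%classic.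
elim: (undup _) => [|p s IH]; first by rewrite big_nil.
rewrite big_cons; apply: ideal_genD => //; rewrite -[_ * _]mulr1.
apply: IM => I [_ II]; apply: II; exists (component p.1 p.2 x) => //.
exists p.2; first by move=> t; exact: component_size.
exact: braided_sym_component.
Qed.

(** In positive length every element has degree 0 part 0, and in length 0 the symmetrizer is the
    identity. Hence degree 0 parts make sense in the quotient. *)
Lemma degree0_nichols x : ideal_gen (TVW_to_ZPT h @` nichols_rel psi)%classic x ->
  degree0 x = 0.
Proof.
move=> Ix; apply: (Ix [set y | degree0 y = 0]%classic); split.
  split => [|y z /= y0 z0|a y b /= y0]; first exact: raddf0.
    by rewrite raddfB /= y0 z0 subr0.
  by rewrite !rmorphM /= y0 mulr0 mul0r.
move=> _ [y [n yn By] <-] /=.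
case: n yn By => [|n] yn By.
  have y1 : y = mconst _ (mcoef (1 : word (Deltap Phi))%g y).
    have ysub : (msupp y `<=` [fset (1 : word (Deltap Phi))%g])%fset.
      by apply/fsubsetP => t /yn /size0nil ->; rewrite inE.
    by rewrite {1}(monalgEw ysub) big_seq_fset1 mconstE.
  move: By; rewrite y1 -[X in braided_sym _ _ X]mulr1 braided_sym_constM.
  have -> : 1 = fun_word Phi (fun i : 'I_0 => 0) by rewrite /fun_word big_ord0.
  by rewrite braided_sym_fun_word0 mulr1 => ->; rewrite !raddf0.
rewrite (monalgE y) (raddf_sum (@TVW_to_ZPT _ _ Phi h)) (raddf_sum degree0) big_seq big1 // => t /yn tn.
rewrite mterm_word /= TVW_to_ZPTM degree0M -ZfunE.
case: t tn => [//|a t] _; rewrite degree0_Zfun ?mulr0 //= => k.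
by apply: pos_sub; exact: valP.
Qed.

End Pairing.

(** * Alcove paths *)

Section AlcovePaths.
Variables (R : realType) (d : nat) (Phi : root_datum R d).
Local Notation V := 'rV[R]_d.
Implicit Types (x y : V) (b c : Delta Phi) (k : int).

Lemma val_root_neq0 b : val b != 0.
Proof. exact: root_neq0P (valP b). Qed.

Lemma copair_root_int b c : copair (val b) (val c) \is a Num.int.
Proof. by apply: root_int; exact: valP. Qed.

Definition drefl b c : Delta Phi := FSetSub (root_refl (valP b) (valP c)).
Definition dopp b : Delta Phi := FSetSub (root_opp (valP b)).

Lemma dreflK b : involutive (drefl b).
Proof. by move=> c; apply: val_inj; rewrite /= (reflK (valP b)). Qed.
Lemma doppK : involutive dopp.
Proof. by move=> c; apply: val_inj; rewrite /= opprK. Qed.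
Lemma drefl_opp b c : drefl b (dopp c) = dopp (drefl b c).
Proof. by apply: val_inj; rewrite /= refl_opp. Qed.
Lemma drefl_id b : drefl b b = dopp b.
Proof. by apply: val_inj; rewrite /= refl_neg // val_root_neq0. Qed.

Definition fl x b : int := Num.floor (copair x (val b)).
Definition regular x : Prop := forall b, copair x (val b) \isn't a Num.int.
(** The affine reflection in the hyperplane H_{b,k}. *)
Definition arefl b k x : V := refl (val b) x + k%:~R *: val b.

Lemma copair_drefl b c x : copair (refl (val b) x) (val c) = copair x (val (drefl b c)).
Proof.
by rewrite -[in RHS](@copair_refl2 _ _ (val b)) ?val_root_neq0 //= (reflK (valP b)).
Qed.

Lemma copair_arefl b k c x :
  copair (arefl b k x) (val c) = copair x (val (drefl b c)) + k%:~R * copair (val b) (val c).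
Proof. by rewrite /arefl copairD copairZ copair_drefl. Qed.

Lemma int_floorK (t : R) : t \is a Num.int -> t = (Num.floor t)%:~R.
Proof. by rewrite intrEfloor => /eqP. Qed.

Lemma copair_arefl_int b k c : k%:~R * copair (val b) (val c) \is a Num.int.
Proof. by apply: rpredM; [exact: intr_int|exact: copair_root_int]. Qed.

Lemma regular_arefl b k x : regular x -> regular (arefl b k x).
Proof.
by move=> xr c; rewrite copair_arefl rpredDr ?copair_arefl_int.
Qed.

Lemma fl_arefl b k c x : fl (arefl b k x) c =
  fl x (drefl b c) + Num.floor (k%:~R * copair (val b) (val c)).
Proof. by rewrite /fl copair_arefl floorDrz // copair_arefl_int. Qed.

Lemma fl_arefl_id b k x : fl (arefl b k x) b = fl x (dopp b) + k *+ 2.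
Proof.
rewrite fl_arefl drefl_id (copair_root (valP b)); congr (_ + _).
by rewrite mulr_natr -rmorphMn intrKfloor.
Qed.

Lemma regular_trans x (v : V) : (forall c, copair v (val c) \is a Num.int) -> regular x -> regular (x + v).
Proof. by move=> vP xr c; rewrite copairD rpredDr ?vP //; exact: vP. Qed.

Lemma fl_trans x (v : V) c : copair v (val c) \is a Num.int ->
  fl (x + v) c = fl x c + Num.floor (copair v (val c)).
Proof. by move=> vP; rewrite /fl copairD floorDrz. Qed.

(** The pairing is not an integer, so negating it turns the integer part k into -k-1. *)
Lemma fl_opp x b : regular x -> fl x (dopp b) = - fl x b - 1.
Proof.
move=> xr; rewrite /fl /= copairNr; apply: floor_def.
have := xr b; have := floor_itv (copair x (val b)); rewrite intrEfloor.
set t := copair _ _; move=> /andP[t1 t2] tn.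
rewrite subrK mulrNz.
have t1' : (Num.floor t)%:~R < t by rewrite lt_neqAle tn.
rewrite ltrN2 t1' andbT; move: t2; rewrite intrD => t2.
by rewrite intrD !mulrNz; lra.
Qed.

(* The alcove of a regular point x is given by the integer parts fl x b; as in
   the definition of a chain, a step with label b goes in the direction - b. *)
Definition same_alcove x y : Prop := [/\ regular x, regular y & forall c, fl x c = fl y c].

Lemma same_alcove_refl x : regular x -> same_alcove x x.
Proof. by []. Qed.

Definition cross x b y : Prop :=
  [/\ regular x, regular y, (forall c, c != b -> c != dopp b -> fl x c = fl y c) &
      fl y b = fl x b - 1].

Fixpoint apath x (p : seq (Delta Phi)) y : Prop :=
  if p is b :: p' then exists2 x', cross x b x' & apath x' p' y else same_alcove x y.

Lemma apath_simL x x' p y : same_alcove x x' -> apath x' p y -> apath x p y.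
Proof.
case=> xr x'r xx'; case: p => [|b p] /=.
  by case=> _ yr x'y; split => // c; rewrite xx'.
case=> z [_ zr x'z zb] zy; exists z => //; split => // [c cb cb'|]; last by rewrite xx'.
by rewrite xx'; apply: x'z.
Qed.

Lemma apath_regular x p y : apath x p y -> regular x /\ regular y.
Proof.
elim: p x => [|b p IH] x /=; first by case.
by case=> z [xr _ _ _] /IH[].
Qed.

Lemma apath_cat x p y q z : apath x p y -> apath y q z -> apath x (p ++ q) z.
Proof.
elim: p x => [|b p IH] x /=; first exact: apath_simL.
by case=> x' xx' x'y yz; exists x' => //; exact: IH.
Qed.

Lemma drefl_inj b : injective (drefl b).
Proof. exact: inv_inj (dreflK b). Qed.

Lemma apath_arefl b k x p y : apath x p y -> apath (arefl b k x) (map (drefl b) p) (arefl b k y).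
Proof.
elim: p x => [|c p IH] x /=.
  by case=> xr yr xy; split => [||c]; rewrite ?fl_arefl ?xy //; exact: regular_arefl.
case=> z [xr zr xz zc] zy; exists (arefl b k z); last exact: IH.
split; try exact: regular_arefl.
  move=> e ec ec'; rewrite !fl_arefl xz //.
    by apply: contra ec => /eqP <-; rewrite dreflK.
  by apply: contra ec' => /eqP E; rewrite -drefl_opp -E dreflK.
by rewrite !fl_arefl dreflK zc addrAC.
Qed.

Lemma apath_trans (v : V) x p y : (forall c, copair v (val c) \is a Num.int) ->
  apath x p y -> apath (x + v) p (y + v).
Proof.
move=> vP; elim: p x => [|c p IH] x /=.
  by case=> xr yr xy; split => [||c]; rewrite ?fl_trans ?xy //; exact: regular_trans.
case=> z [xr zr xz zc] zy; exists (z + v); last exact: IH.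
split; try exact: regular_trans.
  by move=> e ec ec'; rewrite !fl_trans // xz.
by rewrite !fl_trans // zc addrAC.
Qed.

(* The segment from x to y meets the wall in a point fixed by the reflection
   and lying on no other hyperplane. *)
Lemma cross_wall x y b k : regular x -> regular y ->
  (forall c, c != b -> c != dopp b -> fl x c = fl y c) ->
  fl x b = k -> fl y b = k - 1 -> same_alcove (arefl b k x) y.
Proof.
move=> xr yr xy xb yb; split => //; first exact: regular_arefl.
have itv z c : regular z -> (fl z c)%:~R < copair z (val c) < (fl z c + 1)%:~R.
  move=> zr; have := zr c; have := floor_itv (copair z (val c)); rewrite intrEfloor.
  by case/andP => z1 z2 zn; rewrite z2 lt_neqAle zn z1.
have /andP[xb1 xb2] := itv x b xr; have /andP[yb1 yb2] := itv y b yr.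
rewrite xb in xb1 xb2; rewrite yb subrK in yb1 yb2.
(* Solves (1 - s) <x, b^vee> + s <y, b^vee> = k. *)
pose s := (copair x (val b) - k%:~R) / (copair x (val b) - copair y (val b)).
have den : 0 < copair x (val b) - copair y (val b) by lra.
have s0 : 0 < s by apply: divr_gt0 => //; lra.
have s1 : s < 1 by rewrite ltr_pdivrMr // mul1r; lra.
pose z := (1 - s) *: x + s *: y.
have zE c : copair z (val c) = (1 - s) * copair x (val c) + s * copair y (val c).
  by rewrite /z copairD !copairZ.
have zb : copair z (val b) = k%:~R.
  by rewrite zE /s; field; rewrite gt_eqF.
have zitv c : c != b -> c != dopp b -> fl z c = fl y c.
  move=> cb cb'; apply: floor_def; rewrite zE.
  have /andP[x1 x2] := itv x c xr; have /andP[y1 y2] := itv y c yr.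
  rewrite xy // in x1 x2.
  by apply/andP; split; nra.
have zfix : arefl b k z = z.
  by rewrite /arefl /refl zb subrK.
move=> c; case: (eqVneq c b) => [->|cb].
  by rewrite fl_arefl_id fl_opp // xb yb mulr2n; lia.
case: (eqVneq c (dopp b)) => [->|cb'].
  rewrite (fl_opp b (regular_arefl b k xr)) fl_arefl_id !fl_opp // xb yb mulr2n.
  by clear; lia.
(* [z] has the integer part of [y] at c and that of [x] at [drefl b c]; the reflection exchanges
   these two roots up to an integral shift and fixes [z]. *)
rewrite -(zitv c) // -zfix !fl_arefl; congr (_ + _).
have b1 : drefl b c != b by apply: contra cb' => /eqP E; rewrite -[c](dreflK b) E drefl_id.
have b2 : drefl b c != dopp b.
  by apply: contra cb => /eqP E; rewrite -[c](dreflK b) E -drefl_id dreflK.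
by rewrite zitv // xy.
Qed.

Lemma cross_refl x b y : cross x b y -> same_alcove (arefl b (fl x b) x) y.
Proof. by case=> xr yr xy yb; apply: cross_wall. Qed.

Lemma arefl_opp b k x : arefl (dopp b) k x = arefl b (- k) x.
Proof. by rewrite /arefl /= refl_oppl scalerN mulrNz scaleNr. Qed.

(** Crossing upwards, the index of the wall is the integer part at the end point instead of the
    starting point. *)
Lemma cross_refl_opp x b y : cross x (dopp b) y -> same_alcove (arefl b (fl y b) x) y.
Proof.
move=> xy; have := cross_refl xy; rewrite arefl_opp.
case: xy => xr yr _; rewrite !fl_opp // => yb.
by have -> : - (- fl x b - 1) = fl y b by move: yb; lia.
Qed.

Lemma arefl_trans b k (m : int) x : arefl b k x + m%:~R *: val b = arefl b (k + m) x.
Proof. by rewrite /arefl -addrA -scalerDl -intrD. Qed.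

(** A crossing changes the integer part of one positive root only, by one, so each positive root is
    counted with its net number of crossings, and the sum depends on the end points alone. *)
Lemma sum_apath x p y : apath x p y ->
  \sum_(b <- p) val b = \sum_(b : Deltap Phi) (fl x (pos_root b) - fl y (pos_root b))%:~R *: val b.
Proof.
elim: p x => [|c p IH] x /=.
  by case=> _ _ xy; rewrite big_nil big1 // => b _; rewrite xy subrr scale0r.
case=> z [xr zr xz zc] zy; rewrite big_cons (IH _ zy).
have -> : val c = \sum_(b : Deltap Phi) (fl x (pos_root b) - fl z (pos_root b))%:~R *: val b.
  case: (boolP (val c \in Deltap Phi)) => [cp|].
    rewrite (bigD1 [` cp]%fset) //= big1 => [|b /negbTE bc]; last first.
      rewrite xz ?subrr ?scale0r //.
        by rewrite -val_eqE /= -[X in _ == X]/(val [` cp]%fset) val_eqE bc.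
      apply/eqP => /(congr1 val) /= E.
      have : - val c \in Deltap Phi by rewrite -[- val c]E; exact: (valP b).
      by rewrite (pos_oppF cp).
    have -> : pos_root [` cp]%fset = c by apply: val_inj.
    rewrite zc addr0; set m := fl x c.
    have -> : m - (m - 1) = 1 by lia.
    by rewrite scale1r.
  rewrite pos_xor ?(valP c) // negbK => cn.
  rewrite (bigD1 [` cn]%fset) //= big1 => [|b /negbTE bc]; last first.
    rewrite xz ?subrr ?scale0r //.
      apply/eqP => /(congr1 val) /= E.
      have cp : val c \in Deltap Phi by rewrite -[val c]E; exact: (valP b).
      by have := pos_oppF cp; rewrite cn.
    by rewrite -val_eqE /= -[X in _ == X]/(val [` cn]%fset) val_eqE bc.
  have -> : pos_root [` cn]%fset = dopp c by apply: val_inj.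
  rewrite !fl_opp // zc addr0; set m := fl x c.
  have -> : - m - 1 - (- (m - 1) - 1) = -1 by lia.
  by rewrite mulrN1z scaleN1r opprK.
rewrite -big_split /=; apply: eq_bigr => b _.
by rewrite -scalerDl -intrD addrA subrK.
Qed.

End AlcovePaths.

(** A discrete antiderivative: with it the contributions of crossings in both directions become
    differences that telescope along a path. *)
Lemma int_primitive (A : zmodType) (Psi : int -> A) :
  exists G : int -> A, forall k, G k - G (k - 1) = Psi k.
Proof.
pose G k := match k with
  | Posz n => \sum_(i < n) Psi i.+1%:Z
  | Negz n => - \sum_(i < n.+1) Psi (- i%:Z) end.
exists G => -[[|n]|n].
- by rewrite /= big_ord0 big_ord_recl big_ord0 sub0r opprK addr0.
- have -> : n.+1%:Z - 1 = n%:Z by lia.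
  by rewrite /= big_ord_recr /= addrAC subrr add0r.
have -> : Negz n - 1 = Negz n.+1 by lia.
rewrite /G opprK [X in _ + X]big_ord_recr /= addrA addNr add0r.
by congr Psi; lia.
Qed.

Lemma subr_cancel (A : zmodType) (a b g : A) : (a - g) - (b - g) = a - b.
Proof. by rewrite opprB addrA subrK. Qed.

(** * Products along alcove paths *)

Section ChainProducts.
Variables (R : realType) (d : nat) (Phi : root_datum R d) (h : nat).
Local Notation V := 'rV[R]_d.
Local Notation P := (lat Phi 1).
Local Notation P' := (lat Phi h).
Local Notation ZPT := (monalg rat (smash_monoid Phi h)).
Local Notation tder := (@tder R d Phi h).
Local Notation degree0 := (@degree0 R d Phi h).
Local Notation killed := (@killed R d Phi h).
Implicit Types (x y : V) (b c : Delta Phi) (k : int).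

Definition Hroot (b : Delta Phi) : ZPT := ZX (lat_div h (root_lat b)) + Zroot Phi h (val b).

(** As in Xi, the last crossing stands leftmost; a derivation then twists the factors of the
    crossings made before the one it removes. *)
Definition chain_prod (s : seq (Delta Phi)) : ZPT := \prod_(b <- rev s) Hroot b.

Lemma chain_prod_nil : chain_prod [::] = 1.
Proof. exact: big_nil. Qed.

Lemma chain_prod_cat s1 s2 : chain_prod (s1 ++ s2) = chain_prod s2 * chain_prod s1.
Proof. by rewrite /chain_prod rev_cat big_cat. Qed.

Lemma chain_prod1 b : chain_prod [:: b] = Hroot b.
Proof. exact: big_seq1. Qed.

Lemma chain_prod_cons b s : chain_prod (b :: s) = chain_prod s * Hroot b.
Proof. by rewrite -cat1s chain_prod_cat chain_prod1. Qed.

Lemma tder_Hroot (b : Deltap Phi) c : tder b (Hroot c) = root_sign h b (val c).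
Proof.
by rewrite /Hroot [LHS]raddfD /= tder_ZX add0r tder_Zroot // (valP c).
Qed.

Lemma trefl_Hroot (b : Deltap Phi) c : trefl b (Hroot c) = Hroot (drefl (pos_root b) c).
Proof.
have E : trefl b (Hroot c) = trefl b (ZX (lat_div h (root_lat c))) + trefl b (Zroot Phi h (val c)).
  exact: raddfD.
have H : lat_refl (pos_root b) (lat_div h (root_lat c)) = lat_div h (root_lat (drefl (pos_root b) c)).
  by apply: val_inj; rewrite /= reflZ.
have E1 := trefl_ZX b (lat_div h (root_lat c)); rewrite H in E1.
exact: etrans E (congr2 +%R E1 (trefl_Zroot h b (valP c))).
Qed.

Lemma root_sign_pos (b : Deltap Phi) : root_sign h b (val b) = 1.
Proof.
rewrite /root_sign eqxx; case: eqP => [E|_]; last by rewrite subr0.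
by have := pos_oppF (valP b); rewrite -E (valP b).
Qed.

Lemma root_sign_neg (b : Deltap Phi) : root_sign h b (- val b) = -1.
Proof.
rewrite /root_sign eqxx; case: eqP => [E|_]; last by rewrite sub0r.
by have := pos_oppF (valP b); rewrite E (valP b).
Qed.

Lemma root_sign0 (b : Deltap Phi) c : c != pos_root b -> c != dopp (pos_root b) ->
  root_sign h b (val c) = 0.
Proof.
move=> cb cb'; rewrite /root_sign.
have /negbTE-> : val c != val b by apply: contra cb => /eqP E; apply/eqP; exact: val_inj.
have /negbTE-> : val c != - val b by apply: contra cb' => /eqP E; apply/eqP; exact: val_inj.
by rewrite subr0.
Qed.

(* Each crossing of a hyperplane H_{b,k} contributes the path reflected in it
   up to that crossing; the values G telescope. *)
Lemma tder_chain_prod (b : Deltap Phi) x0 y N (Psi G : int -> ZPT) :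
  let b' := pos_root b in
  (forall k, G k - G (k - 1) = Psi k) ->
  (forall k p, apath (arefl b' k x0) p y -> (size p < N)%N -> killed (chain_prod p - Psi k)) ->
  forall p p1 x, apath x0 p1 x -> apath x p y -> (size p1 + size p)%N = N ->
  killed (tder b (chain_prod p) * chain_prod (map (drefl b') p1) - (G (fl x b') - G (fl y b'))).
Proof.
move=> b' GE HPsi; elim=> [|c p IH] p1 x x0x /=.
  case=> _ _ xy _; rewrite chain_prod_nil tder1 mul0r xy !subrr.
  exact: killed0.
case=> x' xx' x'y sN.
have x0x' : apath x0 (rcons p1 c) x'.
  rewrite -cats1; apply: apath_cat x0x _; exists x' => //.
  by case: xx' => _ x'r _ _; exact: same_alcove_refl.
have := IH _ _ x0x' x'y; rewrite size_rcons addSnnS => /(_ sN).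
rewrite map_rcons -cats1 chain_prod_cat chain_prod1.
rewrite chain_prod_cons tderM tder_Hroot trefl_Hroot => IH'.
(* The removed crossing is not replaced, so the reflected path is shorter than [N]. *)
have sp : (size p1 + size p < N)%N by rewrite -sN addnS.
have [xr x'r xx'c x'c] := xx'.
rewrite mulrDl -mulrA -(mulrA (tder b _)).
move: IH'; move: (tder b _ * _) => T IH'.
(* The first crossing of [p] is separated from the later ones, which the induction hypothesis
   covers. *)
rewrite -[X in killed X](_ : (T - (G (fl x' b') - G (fl y b'))) +
   (chain_prod p * (root_sign h b (val c) * chain_prod (map (drefl b') p1)) -
     (G (fl x b') - G (fl x' b'))) = _); last first.
  rewrite addrACA (addrC T) -opprD; congr (_ - _).
  by rewrite addrC addrA subrK.
apply: killedD => //.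
(* Going down through H_{b,k} contributes the product along the reflected path, going up its
   negative, and any other wall nothing. *)
case: (eqVneq c b') => [cb|cb].
  rewrite cb root_sign_pos mul1r -chain_prod_cat.
  have -> : G (fl x b') - G (fl x' b') = Psi (fl x b') by rewrite -GE -cb x'c.
  apply: HPsi; last by rewrite size_cat size_map.
  apply: apath_cat (apath_arefl _ _ x0x) _; apply: apath_simL x'y.
  by rewrite cb in xx'; exact: cross_refl.
case: (eqVneq c (dopp b')) => [cb'|cb'].
  rewrite cb' root_sign_neg mulN1r mulrN -chain_prod_cat.
  have -> : G (fl x b') - G (fl x' b') = - Psi (fl x' b').
    rewrite -GE opprB; congr (G _ - _).
    by move: x'c; rewrite cb' !fl_opp //; lia.
  rewrite -opprD; apply: killedN; apply: HPsi; last by rewrite size_cat size_map.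
  apply: apath_cat (apath_arefl _ _ x0x) _; apply: apath_simL x'y.
  by rewrite cb' in xx'; exact: cross_refl_opp.
have -> : root_sign h b (val c) = 0 by exact: root_sign0.
have -> : fl x b' = fl x' b'.
  by apply: xx'c; [rewrite eq_sym|apply: contra cb' => /eqP ->; rewrite doppK].
by rewrite mul0r mulr0 !subrr; exact: killed0.
Qed.

Lemma degree0_chain_prod s :
  degree0 (chain_prod s) = mbasis rat (\sum_(b <- s) lat_div h (root_lat b) : expo P').
Proof.
elim: s => [|b s IH]; first by rewrite chain_prod_nil big_nil [LHS]rmorph1.
rewrite chain_prod_cons degree0M IH big_cons.
have -> : degree0 (Hroot b) = mbasis rat (lat_div h (root_lat b) : expo P').
  by rewrite /Hroot [LHS]raddfD /= degree0_ZX degree0_Zroot ?(valP b) // addr0.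
rewrite -mbasisM; congr (mbasis _ _); exact: addrC.
Qed.

Lemma val_sum_lat (s : seq (Delta Phi)) :
  val (\sum_(b <- s) lat_div h (root_lat b)) = h%:R^-1 *: \sum_(b <- s) val b.
Proof.
elim: s => [|b s IH]; first by rewrite !big_nil scaler0.
by rewrite !big_cons scalerDr -IH.
Qed.

(** One product is chosen for each k. The value is 0 where no path exists, and there nothing is
    compared with it. *)
Lemma choose_Psi (C : int -> seq (Delta Phi) -> Prop) :
  exists Psi : int -> ZPT, forall k p, C k p -> exists2 q, C k q & Psi k = chain_prod q.
Proof.
have H k : exists u : ZPT, forall p, C k p -> exists2 q, C k q & u = chain_prod q.
  have [[q Cq]|nC] := pselect (exists q, C k q).
    by exists (chain_prod q) => p _; exists q.
  by exists 0 => p Cp; case: nC; exists p.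
by have [Psi HPsi] := choice H; exists Psi => k p; exact: HPsi.
Qed.

Theorem chain_prod_path_indep x y p q : apath x p y -> apath x q y ->
  killed (chain_prod p - chain_prod q).
Proof.
move: (leqnn (maxn (size p) (size q))); move: {2}(maxn _ _) => N.
elim: N x y p q => [|N IH] x y p q.
  rewrite leqn0 -leqn0 geq_max !leqn0 => /andP[/eqP/size0nil-> /eqP/size0nil->] _ _.
  by rewrite subrr; exact: killed0.
rewrite geq_max => /andP[pN qN] xp xq; apply: killedP => [|b].
  rewrite [LHS]raddfB /= !degree0_chain_prod; apply/eqP; rewrite subr_eq0; apply/eqP.
  congr (mbasis _ _); apply: val_inj.
  by rewrite !val_sum_lat (sum_apath xp) (sum_apath xq).
pose b' := pos_root b.
(* One [Psi], hence one [G], has to serve both paths, so the length of the chosen path is bounded by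
   [N] and not by that of [p] or [q]. *)
have [Psi HPsi] := choose_Psi (fun k p => apath (arefl b' k x) p y /\ (size p < N.+1)%N).
have [G HG] := int_primitive Psi.
have H r : apath x r y -> (size r <= N.+1)%N ->
    killed (tder b (chain_prod r) - (G (fl x b') - G (fl y b'))).
  move=> xr rN; have [xreg _] := apath_regular xr.
  have := @tder_chain_prod b x y (size r) Psi G HG _ r [::] x (same_alcove_refl xreg) xr erefl.
  rewrite /= chain_prod_nil mulr1; apply => k p' kp' p'r.
  have p'N := leq_trans p'r rN.
  have [q' [q'P q'N] ->] := HPsi k p' (conj kp' p'N).
  have szN : (maxn (size p') (size q') <= N)%N
    by rewrite geq_max; apply/andP; split; rewrite -ltnS.
  exact: (IH _ _ _ _ szN kp' q'P).
rewrite [tder b _]raddfB /=.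
have := killedB (H p xp pN) (H q xq qN).
by rewrite subr_cancel.
Qed.

Lemma tder_chain_prodE (b : Deltap Phi) x p y (Psi G : int -> ZPT) :
  let b' := pos_root b in
  (forall k, G k - G (k - 1) = Psi k) ->
  (forall k p, apath (arefl b' k x) p y -> killed (chain_prod p - Psi k)) ->
  apath x p y ->
  killed (tder b (chain_prod p) - (G (fl x b') - G (fl y b'))).
Proof.
move=> b' HG HPsi xp; have [xreg _] := apath_regular xp.
have := @tder_chain_prod b x y (size p) Psi G HG _ p [::] x (same_alcove_refl xreg) xp erefl.
by rewrite /= chain_prod_nil mulr1; apply => k p' kp' _; exact: HPsi.
Qed.

Lemma latP (l : P) c : copair (l : V) (val c) \is a Num.int.
Proof. by have /forallP/(_ c) := lat_valP l; rewrite scale1r. Qed.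

Lemma lat_reflE (b : Delta Phi) (l : P) :
  (lat_refl b l : V) = (l : V) - copair (l : V) (val b) *: val b.
Proof. by []. Qed.

Section Family.
Variables (x : V) (s : P -> seq (Delta Phi)).
Hypothesis sP : forall l, apath x (s l) (x - (l : V)).

Lemma chain_prod_add (l m : P) :
  killed (chain_prod (s l) * chain_prod (s m) - chain_prod (s (l + m))).
Proof.
rewrite -chain_prod_cat; apply: (@chain_prod_path_indep x (x - (l + m : P))); last exact: sP.
apply: apath_cat (sP m) _.
have -> : x - (l + m : P) = (x - (l : V)) + - (m : V) by rewrite /= opprD addrA.
apply: apath_trans; last exact: sP.
by move=> c; rewrite copairNl rpredN latP.
Qed.

(** With m = <l, b^vee>, translation by -m b turns a path from s_{b,k} x to x - s_b l into one from
    s_{b,k-m} x to x - l. So the second derivative is computed with the primitive k |-> G (k - m),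
    and the four values of [G] cancel in pairs. *)
Lemma tder_chain_prod_refl (b : Deltap Phi) (l : P) :
  killed (tder b (chain_prod (s l)) + tder b (chain_prod (s (lat_refl (pos_root b) l)))).
Proof.
pose b' := pos_root b; pose m := Num.floor (copair (l : V) (val b)).
have mE : m%:~R = copair (l : V) (val b) by rewrite /m -int_floorK // (latP l b').
have [Psi HPsi] := choose_Psi (fun k p => apath (arefl b' k x) p (x - (l : V))).
have [G HG] := int_primitive Psi.
have mbP (e : int) c : copair (e%:~R *: val b') (val c) \is a Num.int.
  by rewrite copairZ copair_arefl_int.
have H1 : killed (tder b (chain_prod (s l)) - (G (fl x b') - G (fl (x - (l : V)) b'))).
  apply: (tder_chain_prodE HG _ (sP l)) => k p kp.
  have [q kq ->] := HPsi k p kp; exact: chain_prod_path_indep kp kq.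
have lE : (lat_refl b' l : V) = (l : V) - m%:~R *: val b by rewrite lat_reflE mE.
have H2 : killed (tder b (chain_prod (s (lat_refl b' l))) -
    (G (fl x b' - m) - G (fl (x - (lat_refl b' l : V)) b' - m))).
  apply: (@tder_chain_prodE b _ _ _ (fun k => Psi (k - m)) (fun k => G (k - m)) _ _ (sP _)).
    by move=> k /=; rewrite -HG addrAC.
  move=> k p kp; have kp' : apath (arefl b' (k - m) x) p (x - (l : V)).
    have := apath_trans (mbP (- m)) kp; rewrite arefl_trans.
    by rewrite lE opprB -addrA mulrNz scaleNr addrAC subrr add0r.
  have [q kq ->] := HPsi _ _ kp'; exact: chain_prod_path_indep kp' kq.
have := killedD H1 H2.
have -> : fl (x - (l : V)) b' = fl x b' - m.
  rewrite fl_trans ?copairNl ?rpredN ?latP // floorN ?latP //.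
have -> : fl (x - (lat_refl b' l : V)) b' - m = fl x b'.
  rewrite lE opprB addrA -addrA [_ - (l : V)]addrC addrA.
  rewrite (fl_trans _ (mbP m b')) copairZ (copair_root (valP b')).
  rewrite fl_trans ?copairNl ?rpredN ?latP // floorN ?latP // -/m.
  have -> : m%:~R * 2 = (m *+ 2)%:~R :> R by rewrite mulr_natr -rmorphMn.
  by rewrite intrKfloor mulr2n; lia.
rewrite addrACA -opprD; set u := _ - _ + _.
by have -> : u = 0; [rewrite /u addrA subrK subrr|rewrite subr0].
Qed.

Definition chain_map (f : ZP Phi) : ZPT := mextend (intmul 1) (fun l : expo P => chain_prod (s l)) f.

Lemma killed_half u : killed (u + u) -> killed u.
Proof.
have -> : u + u = mconst (smash_monoid Phi h) 2 * u.
  by rewrite (_ : 2 = 1 + 1 :> rat) // rmorphD rmorph1 mulrDl mul1r.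
move=> /(killed_constM 2^-1).
by rewrite mulrA -rmorphM mulVf ?pnatr_eq0 // rmorph1 mul1r.
Qed.

Lemma mextend_weyl (A : pzRingType) (g : expo P -> A) (u : seq (Delta Phi)) (f : ZP Phi) :
  mextend (intmul 1) g (weyl_act u f) = mextend (intmul 1) (fun l : expo P => g (lat_act u l)) f.
Proof.
rewrite /weyl_act; elim/monalg_ind: f => [|f1 f2 H1 H2|l c].
- by rewrite !raddf0.
- by rewrite !raddfD /= H1 H2.
rewrite !mextend_term /=.
rewrite mterm_int.
by rewrite mextend_term.
Qed.

Lemma tder_chain_map (b : Deltap Phi) (f : ZP Phi) :
  tder b (chain_map f) = mextend (intmul 1) (fun l : expo P => tder b (chain_prod (s l))) f.
Proof.
rewrite /chain_map; elim/monalg_ind: f => [|f1 f2 H1 H2|l c].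
- by rewrite !raddf0.
- by rewrite !raddfD /= H1 H2.
by rewrite !mextend_term !mulrzl raddfMz.
Qed.

Lemma killed_mextend (g : expo P -> ZPT) f : (forall l, killed (g l)) -> killed (mextend (intmul 1) g f).
Proof.
move=> gk; elim/monalg_ind: f => [|f1 f2 H1 H2|l c].
- by rewrite raddf0; exact: killed0.
- by rewrite raddfD /=; exact: killedD.
rewrite mextend_term /=.
have -> : (c%:~R : ZPT) = mconst (smash_monoid Phi h) c%:~R by rewrite rmorph_int.
exact: killed_constM.
Qed.

Hypothesis rootsum : forall l : P, \sum_(b : Deltap Phi) copair (l : V) (val b) *: val b = h%:R *: (l : V).
Hypothesis h_gt0 : (0 < h)%N.

Lemma degree0_chain_prod_lat (l : P) :
  degree0 (chain_prod (s l)) = mbasis rat (lat_incl h l : expo P').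
Proof.
rewrite degree0_chain_prod; congr (mbasis _ _); apply: val_inj; rewrite val_sum_lat (sum_apath (sP l)).
rewrite (eq_bigr (fun b : Deltap Phi => copair (l : V) (val b) *: val b)); last first.
  move=> b _; congr (_ *: _); rewrite fl_trans ?copairNl ?rpredN ?latP //.
  rewrite floorN ?(latP _ (pos_root b)) //; set m := Num.floor _; set e := fl _ _.
  have -> : e - (e - m) = m by clear; lia.
  by rewrite /m -int_floorK // (latP _ (pos_root b)).
by rewrite rootsum scalerA mulVf ?scale1r // pnatr_eq0 -lt0n.
Qed.

Theorem chain_map_inv (f : ZP Phi) : weyl_inv f ->
  killed (chain_map f - mextend (intmul 1) (fun l : expo P => ZX (lat_incl h l)) f).
Proof.
move=> finv; apply: killedP => [|b].
  rewrite [LHS]raddfB /= /chain_map.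
  have H (g : expo P -> ZPT) : degree0 (mextend (intmul 1) g f) =
     mextend (intmul 1) (fun l => degree0 (g l)) f.
    elim/monalg_ind: {finv} f => [|f1 f2 H1 H2|l c].
    - by rewrite !raddf0.
    - by rewrite !raddfD /= H1 H2.
    by rewrite !mextend_term !mulrzl raddfMz.
  rewrite !H; apply/eqP; rewrite subr_eq0; apply/eqP; apply: mextend_eq => // l.
  by rewrite degree0_chain_prod_lat degree0_ZX.
rewrite [tder b _]raddfB /=.
have -> : tder b (mextend (intmul 1) (fun l : expo P => ZX (lat_incl h l)) f) = 0.
  elim/monalg_ind: {finv} f => [|f1 f2 H1 H2|l c].
  - by rewrite !raddf0.
  - by rewrite !raddfD /= H1 H2 addr0.
  by rewrite mextend_term mulrzl [LHS]raddfMz /= tder_ZX mul0rz.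
(* In one of the two copies f is replaced by s_b f; then each weight l contributes the sum of the
   derivatives for l and s_b l. *)
rewrite subr0; apply: killed_half; rewrite {2}tder_chain_map tder_chain_map.
rewrite -{2}(finv [:: pos_root b]) mextend_weyl mextendDg; apply: killed_mextend => l /=.
exact: tder_chain_prod_refl.
Qed.

End Family.
End ChainProducts.

(** * Alcove paths of a chain *)

Section AlcoveGeometry.
Import numFieldNormedType.Exports.
Local Open Scope classical_set_scope.

Section Geometry.
Variables (R : realType) (d : nat) (Phi : root_datum R d).
Local Notation V := 'rV[R]_d.
Implicit Types (x y z : V) (b c : Delta Phi) (A B : set V).

Lemma copair_sumE x c : copair x (val c) = 2 / dotv (val c) (val c) * \sum_i x 0 i * val c 0 i.
Proof.
rewrite /copair {1}/dotv mxE mulrAC; congr (_ * _).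
by apply: eq_bigr => i _; rewrite mxE.
Qed.

Lemma continuous_sum_seq (I : Type) (r : seq I) (F : I -> V -> R) :
  (forall i, continuous (F i)) -> continuous (fun x => \sum_(i <- r) F i x).
Proof.
move=> Fc; elim: r => [|i r IH] x.
  rewrite (_ : (fun x => _) = fun=> 0); first exact: cst_continuous.
  by apply/funext => y; rewrite big_nil.
rewrite (_ : (fun x => _) = fun y => F i y + \sum_(i <- r) F i y); last first.
  by apply/funext => y; rewrite big_cons.
exact: (cvgD (Fc i x) (IH x)).
Qed.

Lemma copair_continuous c : continuous (fun x => copair x (val c)).
Proof.
rewrite (_ : (fun x => copair x (val c)) =
   (fun x => \sum_i x 0 i * (2 / dotv (val c) (val c) * val c 0 i))).
  apply: continuous_sum_seq => i x.
  exact: (cvgM (@coord_continuous _ _ _ 0 i x) (cvg_cst _)).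
apply/funext => y; rewrite copair_sumE mulr_sumr; apply: eq_bigr => i _.
by rewrite mulrCA.
Qed.

Lemma off_regular x : off_hyperplanes Phi x -> regular Phi x.
Proof.
move=> xo c; apply/negP; rewrite intrEfloor => /eqP E.
by apply: (xo (val c) (Num.floor (copair x (val c))) (valP c)); rewrite /hyperplane /= E.
Qed.

Lemma floor_neq_between (s t : R) : s \isn't a Num.int -> t \isn't a Num.int ->
  Num.floor s < Num.floor t -> s < (Num.floor t)%:~R <= t.
Proof.
move=> sn tn st; have /andP[_ s2] := floor_itv s; have /andP[-> _] := floor_itv t.
rewrite andbT; apply: (lt_le_trans s2); rewrite ler_int.
by move: st; move: (Num.floor s) (Num.floor t) => m k; lia.
Qed.

Lemma alcove_regular A x : alcove Phi A -> A x -> regular Phi x.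
Proof. by case=> z _ -> /connected_component_sub/off_regular. Qed.

(** The pairing with a coroot maps the connected alcove to an interval, which would contain an
    integer if two integer parts differed; but no point of an alcove has an integral pairing. *)
Lemma alcove_fl A x y c : alcove Phi A -> A x -> A y -> fl x c = fl y c.
Proof.
move=> Aalc; wlog: x y / (fl x c < fl y c)%R.
  move=> H Ax Ay; case: (ltgtP (fl x c) (fl y c)) => // xy; first exact: H.
  by apply/esym; exact: H.
move=> xy Ax Ay; exfalso.
have Ac : connected A by case: Aalc => z _ ->; exact: component_connected.
have fc : {within A, continuous (fun x => copair x (val c))}.
  by apply: continuous_subspaceT; exact: copair_continuous.
have /connected_intervalP Ai := connected_continuous_connected Ac fc.
have := @floor_neq_between (copair x (val c)) (copair y (val c))
  (alcove_regular Aalc Ax c) (alcove_regular Aalc Ay c) xy.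
move=> /andP[x1 y1].
have [|z Az zE] := Ai _ _ (imageP _ Ax) (imageP _ Ay) (Num.floor (copair y (val c)))%:~R.
  by rewrite (ltW x1) y1.
by have := alcove_regular Aalc Az c; rewrite zE intr_int.
Qed.

Lemma closure_between A y c (a b' : R) : closure A y -> a < copair y (val c) < b' ->
  exists2 z, A z & a < copair z (val c) < b'.
Proof.
move=> Ay /andP[ay yb].
have : nbhs y [set z | copair z (val c) \in `]a, b'[%R].
  have yin : copair y (val c) \in `]a, b'[%R by rewrite in_itv /= ay yb.
  exact: (@copair_continuous c y _ (near_in_itvoo yin)).
by move=> /Ay[z [Az]] /=; rewrite in_itv /= => zab; exists z.
Qed.

Lemma closure_fl A y x c : alcove Phi A -> A x -> closure A y ->
  copair y (val c) \isn't a Num.int -> fl x c = Num.floor (copair y (val c)).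
Proof.
move=> Aalc Ax Ay yn; set k := Num.floor _.
have [|z Az /andP[z1 z2]] := @closure_between A y c k%:~R (k + 1)%:~R Ay.
  have := floor_itv (copair y (val c)); rewrite -/k => /andP[k1 ->].
  by rewrite andbT lt_neqAle k1 andbT; move: yn; rewrite intrEfloor.
by rewrite (alcove_fl c Aalc Ax Az); apply: floor_def; rewrite (ltW z1) z2.
Qed.

(** Take the part of c orthogonal to b; it is nonzero because a root proportional to b is plus or
    minus b. *)
Lemma root_direction b c : c != b -> c != dopp b ->
  exists2 v : V, copair v (val b) = 0 & copair v (val c) != 0.
Proof.
move=> cb cb'; pose v := (val c) - (copair (val c) (val b) / 2) *: val b.
have vb : dotv v (val b) = 0.
  rewrite /v dotvBl dotvZl copairE.
  have b0 : dotv (val b) (val b) != 0 by apply: dotv_neq0 (valP b).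
  by rewrite [_ / 2]mulrC !mulrA mulVf ?pnatr_eq0 // mul1r mulfVK // subrr.
exists v; first by rewrite copairE vb mulr0 mul0r.
have v0 : v != 0.
  apply/eqP => /eqP; rewrite subr_eq0 => /eqP cE.
  move: cE; set t := copair _ _ / 2 => cE.
  have cD : val c \in Delta Phi := valP c.
  rewrite cE in cD; have [t1|t1] := root_reduced (valP b) cD.
    by move/eqP: cb; apply; apply: val_inj; rewrite /= cE t1 scale1r.
  by move/eqP: cb'; apply; apply: val_inj; rewrite /= cE t1 scaleN1r.
have vc : dotv v (val c) = dotv v v.
  by rewrite {3}/v dotvBr dotvZr vb mulr0 subr0.
by rewrite copairE vc !mulf_neq0 ?invr_eq0 ?dotv_eq0 ?pnatr_eq0 ?val_root_neq0.
Qed.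

Lemma wall_point A B b k c : c != b -> c != dopp b -> common_wall A B (- val b) k ->
  exists y, [/\ closure A y, closure B y & copair y (val c) \isn't a Num.int].
Proof.
move=> cb cb' [U [Uo [y0 [Uy0 Hy0]] UH]].
case: (boolP (copair y0 (val c) \is a Num.int)) => [yint|ynint]; last first.
  by exists y0; have [] := UH _ (conj Uy0 Hy0).
have [v vb vc] := root_direction cb cb'.
have fcont : (fun t : R => y0 + t *: v) @ (0 : R) --> y0 + (0 : R) *: v.
  apply: cvgD; first exact: cvg_cst.
  by apply: cvgZr_tmp; exact: cvg_id.
have : nbhs (0 : R) [set t : R | U (y0 + t *: v)].
  apply: (fcont U); rewrite scale0r addr0; exact: open_nbhs_nbhs.
move=> /nbhs_ballP[e /= e0 eU].
(* The first bound keeps the shifted point in [U]; the second makes the pairing with c move by less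
   than 1, so that it leaves the integer where it started. *)
pose q := copair v (val c); pose t := Num.min (e / 2) (1 / (2 * (1 + `|q|))).
have q1 : 0 < 1 + `|q| by rewrite ltr_pwDl.
have t0 : 0 < t by rewrite lt_min divr_gt0 //= divr_gt0 // mulr_gt0.
have te : t < e by rewrite gt_min; apply/orP; left; lra.
have Ut : U (y0 + t *: v).
  by apply: eU; rewrite /ball /= sub0r normrN gtr0_norm.
have Ht : hyperplane (- val b) k (y0 + t *: v).
  by rewrite /hyperplane /= copairD copairZ copairNr [copair v _]copairNr vb oppr0 mulr0 addr0 -copairNr.
exists (y0 + t *: v); have [h1 h2] := UH _ (conj Ut Ht); split => //.
rewrite copairD copairZ rpredDl // -/q.
have tq0 : t * q != 0 by rewrite mulf_neq0 // gt_eqF.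
have tq1 : `|t * q| < 1.
  rewrite normrM (gtr0_norm t0).
  have tle : t <= 1 / (2 * (1 + `|q|)) by rewrite ge_min lexx orbT.
  apply: (@le_lt_trans _ _ (1 / (2 * (1 + `|q|)) * `|q|)).
    by apply: ler_wpM2r.
  rewrite mulrAC mul1r ltr_pdivrMr ?mulr_gt0 // mul1r.
  have := normr_ge0 q; lra.
apply/negP => /int_floorK tE; move: tq0 tq1; rewrite tE.
rewrite intr_eq0 -intr_norm -[1]/(1%:~R) ltr_int => z0 z1.
move: z0; rewrite -normr_eq0; move: (normr_ge0 (Num.floor (t * q))) z1.
by move: `|_| => m; lia.
Qed.

(** For a root other than plus or minus b, a point of the common wall with non-integral pairing lies
    in both closures and forces equal integer parts. For -b, points of the two alcoves close to the
    wall have integer parts k - 1 and k. *)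
Lemma alcove_step_cross A b B x y : alcove Phi A -> alcove Phi B ->
  alcove_step A (- val b) B -> A x -> B y -> cross x b y.
Proof.
move=> Aalc Balc [_ [k [W Ak Bk]]] Ax By.
have xr := alcove_regular Aalc Ax; have yr := alcove_regular Balc By.
split => // [c cb cb'|].
  have [w [wA wB wn]] := wall_point cb cb' W.
  by rewrite (closure_fl Aalc Ax wA wn) (closure_fl Balc By wB wn).
have [U [Uo [y0 [Uy0 Hy0]] UH]] := W; have [y0A y0B] := UH _ (conj Uy0 Hy0).
have y0k : copair y0 (val (dopp b)) = k%:~R by exact: Hy0.
have xk : fl x (dopp b) = k - 1.
  have [|z Az /andP[z1 z2]] := @closure_between A y0 (dopp b) (k - 1)%:~R (k + 1)%:~R y0A.
    by rewrite y0k !ltr_int; lia.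
  rewrite (alcove_fl (dopp b) Aalc Ax Az); apply: floor_def; rewrite (ltW z1) subrK.
  exact: (Ak _ Az).
have yk : fl y (dopp b) = k.
  have [|z Bz /andP[z1 z2]] := @closure_between B y0 (dopp b) (k - 1)%:~R (k + 1)%:~R y0B.
    by rewrite y0k !ltr_int; lia.
  rewrite (alcove_fl (dopp b) Balc By Bz); apply: floor_def; rewrite z2 andbT.
  exact: ltW (Bk _ Bz).
by move: xk yk; rewrite !fl_opp //; lia.
Qed.

Lemma chain_apath s (A : nat -> set V) x y :
  (forall i, (i <= size s)%N -> alcove Phi (A i)) ->
  (forall i, (i < size s)%N -> alcove_step (A i) (- nth 0 [seq val b | b <- s] i) (A i.+1)) ->
  A 0%N x -> A (size s) y -> apath x s y.
Proof.
elim: s A x => [|b s IH] A x Aalc Astep Ax Ay /=.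
  have A0 := Aalc 0%N isT; split; [exact: alcove_regular Ax|exact: alcove_regular Ay|].
  by move=> c; exact: alcove_fl Ax Ay.
have A1 := Aalc 1%N isT; have [z zoff A1E] := A1.
have A1z : A 1%N z by rewrite A1E; exact: connected_component_refl.
exists z; first exact: alcove_step_cross (Aalc 0%N isT) A1 (Astep 0%N isT) Ax A1z.
apply: (IH (fun i => A i.+1)) => // i is_; first exact: Aalc.
exact: Astep.
Qed.

Lemma lambda_chain_apath (l : lat Phi 1) s x : fund_alcove Phi x -> lambda_chain l s ->
  apath x s (x - (l : V)).
Proof.
move=> xf [A [Aalc A0 As Astep]]; apply: chain_apath Aalc Astep _ _.
  by rewrite A0.
by rewrite As; exists x.
Qed.

(** A chain starts in the fundamental alcove, and an alcove, being a connected component, contains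
    its base point. *)
Lemma lambda_chain_point (l : lat Phi 1) s : lambda_chain l s -> exists x, fund_alcove Phi x.
Proof.
case=> A [Aalc A0 _ _]; have [z zoff A0E] := Aalc 0%N isT.
by exists z; rewrite -A0 A0E; exact: connected_component_refl.
Qed.

End Geometry.

End AlcoveGeometry.

(** * Simple roots, dominant vectors and fundamental weights *)

Section WordAction.
Variables (R : realType) (d : nat).
Local Notation V := 'rV[R]_d.
Implicit Types (a b x y : V) (s t : seq V).

Definition wact s x : V := foldr (@refl R d) x s.

Lemma wact_cat s t x : wact (s ++ t) x = wact s (wact t x).
Proof. exact: foldr_cat. Qed.
Lemma wact_rcons s a x : wact (rcons s a) x = wact s (refl a x).
Proof. by rewrite -cats1 wact_cat. Qed.
Lemma wactD s x y : wact s (x + y) = wact s x + wact s y.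
Proof. by elim: s => //= a s ->; rewrite reflD. Qed.
Lemma wactZ s c x : wact s (c *: x) = c *: wact s x.
Proof. by elim: s => //= a s ->; rewrite reflZ. Qed.
Lemma wactN s x : wact s (- x) = - wact s x.
Proof. by rewrite -scaleN1r wactZ scaleN1r. Qed.
Lemma wactB s x y : wact s (x - y) = wact s x - wact s y.
Proof. by rewrite wactD wactN. Qed.
Lemma wact0 s : wact s 0 = 0.
Proof. by have := wactB s 0 0; rewrite !subrr. Qed.
Lemma wact_sum s (I : Type) (r : seq I) (P : pred I) (F : I -> V) :
  wact s (\sum_(i <- r | P i) F i) = \sum_(i <- r | P i) wact s (F i).
Proof. by apply: (big_morph (wact s)) => [x y|]; rewrite ?wactD ?wact0. Qed.

Definition no0 s := forall a, a \in s -> a != 0.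

Lemma no0_cons a s : no0 (a :: s) -> a != 0 /\ no0 s.
Proof. by move=> h; split=> [|b bs]; apply: h; rewrite inE ?eqxx // bs orbT. Qed.

Lemma refl_involutive a : a != 0 -> involutive (refl a).
Proof.
move=> a0 x; rewrite {1}/refl [copair (refl a x) a](_ : _ = - copair x a).
  by rewrite scaleNr opprK /refl subrK.
rewrite /refl copairB copairZ (_ : copair a a = 2) ?copairE ?mulfK ?dotv_eq0 //.
by rewrite mulr_natr mulr2n opprD addrA subrr sub0r.
Qed.

Lemma dotv_act s x y : no0 s -> dotv (wact s x) (wact s y) = dotv x y.
Proof. by elim: s => //= a s IH /no0_cons[a0 s0]; rewrite dotv_refl // IH. Qed.
Lemma copair_act s x y : no0 s -> copair (wact s x) (wact s y) = copair x y.
Proof. by move=> s0; rewrite !copairE !dotv_act. Qed.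
Lemma refl_act s a x : no0 s -> refl (wact s a) (wact s x) = wact s (refl a x).
Proof. by move=> s0; rewrite /refl copair_act // wactB wactZ. Qed.

Lemma wact_revK s x : no0 s -> wact s (wact (rev s) x) = x.
Proof.
elim: s x => //= a s IH x /no0_cons[a0 s0].
by rewrite rev_cons wact_rcons IH // refl_involutive.
Qed.
Lemma no0_rev s : no0 s -> no0 (rev s).
Proof. by move=> s0 a; rewrite mem_rev => /s0. Qed.
Lemma wact_revK' s x : no0 s -> wact (rev s) (wact s x) = x.
Proof. by move=> s0; rewrite -{2}(revK s) wact_revK //; exact: no0_rev. Qed.
Lemma wact_inj s : no0 s -> injective (wact s).
Proof. by move=> s0; apply: can_inj (wact (rev s)) _ => x; exact: wact_revK'. Qed.

Lemma iter_act s k x : iter k (wact s) x = wact (flatten (nseq k s)) x.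
Proof. by elim: k => //= k ->; rewrite wact_cat. Qed.

End WordAction.

(** * Positive and simple roots, dominance, and words in simple reflections *)

Section PositiveRoots.
Variables (R : realType) (d : nat) (Phi : root_datum R d).
Local Notation V := 'rV[R]_d.
Local Notation Delta := (Delta Phi).
Local Notation Deltap := (Deltap Phi).
Local Notation simple := (simple_root Phi).
Implicit Types (a x y : V) (s t : seq V).

Lemma simple_pos a : simple a -> a \in Deltap.
Proof. by case. Qed.
Lemma simple_root_in a : simple a -> a \in Delta.
Proof. by move/simple_pos/pos_sub. Qed.
Lemma pos_neq0 a : a \in Deltap -> a != 0.
Proof. by move/pos_sub/root_neq0P. Qed.
Lemma simple_neq0 a : simple a -> a != 0.
Proof. by move/simple_pos/pos_neq0. Qed.

Lemma wact_root s a : {subset s <= Delta} -> a \in Delta -> wact s a \in Delta.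
Proof.
elim: s => //= b s IH sD aD; apply: root_refl; first by apply: sD; exact: mem_head.
by apply: IH => // c cs; apply: sD; rewrite inE cs orbT.
Qed.

Lemma root_proportional a b (t : R) : a \in Delta -> b \in Delta -> b = t *: a -> b = a \/ b = - a.
Proof.
move=> aD bD E; rewrite E in bD; have [t1|t1] := root_reduced aD bD; rewrite E t1.
  by left; rewrite scale1r.
by right; rewrite scaleN1r.
Qed.

(** By strict Cauchy-Schwarz the positive integers <a, b^vee> and <b, a^vee> have product below 4,
    so one of them is 1 and a reflection yields a - b up to sign. *)
Lemma root_sub a b : a \in Delta -> b \in Delta -> 0 < dotv a b -> a != b -> a - b \in Delta.
Proof.
move=> aD bD ab neq; have aa : 0 < dotv a a by rewrite dotv_gt0 (root_neq0P aD).
have bb : 0 < dotv b b by rewrite dotv_gt0 (root_neq0P bD).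
have CS : dotv a b * dotv a b < dotv a a * dotv b b.
  pose v := a - (dotv a b / dotv b b) *: b.
  have v0 : v != 0.
    rewrite subr_eq0; apply/eqP => E; have [E'|E'] := root_proportional bD aD E.
      by rewrite E' eqxx in neq.
    by move: ab; rewrite E' dotvNl oppr_gt0 ltNge dotv_ge0.
  have : 0 < dotv v v by rewrite dotv_gt0.
  rewrite /v dotvBl !dotvBr !dotvZl !dotvZr (dotvC b a) divfK ?gt_eqF // subrr subr0.
  have -> : dotv a a - dotv a b / dotv b b * dotv a b =
    (dotv a a * dotv b b - dotv a b * dotv a b) / dotv b b.
    by field; rewrite gt_eqF.
  by rewrite pmulr_lgt0 ?invr_gt0 // subr_gt0.
have m1 := root_int bD aD; have m2 := root_int aD bD.
have p1 : 0 < copair a b by rewrite copairE divr_gt0 // mulr_gt0.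
have p2 : 0 < copair b a by rewrite copairE dotvC divr_gt0 // mulr_gt0.
have p3 : copair a b * copair b a < 4.
  rewrite !copairE (dotvC b a).
  have -> : 2 * dotv a b / dotv b b * (2 * dotv a b / dotv a a) =
     4 * (dotv a b * dotv a b) / (dotv a a * dotv b b).
    by field; rewrite !gt_eqF.
  by rewrite ltr_pdivrMr ?mulr_gt0 // ltr_pM2l.
move: p1 p2 p3; rewrite (int_floorK m1) (int_floorK m2).
rewrite -intrM -[4]/(4%:~R) !ltr0z ltr_int.
move=> p1 p2 p3; have [E|E] : Num.floor (copair a b) = 1 \/ Num.floor (copair b a) = 1.
- by move: (Num.floor _) (Num.floor _) p1 p2 p3 => u v; nia.
- by have := root_refl bD aD; rewrite /refl (int_floorK m1) E scale1r.
- by have := root_opp (root_refl aD bD); rewrite /refl (int_floorK m2) E scale1r opprB.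
Qed.

Lemma root_add a b : a \in Delta -> b \in Delta -> dotv a b < 0 -> a != - b -> a + b \in Delta.
Proof.
move=> aD bD ab neq; rewrite -[b]opprK; apply: root_sub => //; first exact: root_opp.
by rewrite dotvNr oppr_gt0.
Qed.

(** In a vanishing sum the first root has negative inner product with another one; their sum is
    again a positive root, and merging them gives a shorter vanishing sum. This makes [possum] the
    positive part of a strict order. *)
Lemma pos_sum_neq0 s : s != [::] -> {subset s <= Deltap} -> \sum_(b <- s) b != 0.
Proof.
move: {2}(size s) (leqnn (size s)) => N; elim: N s => [|N IH] [//|a t] //= tN _ sP.
have ap : a \in Deltap by apply: sP; exact: mem_head.
have tP b : b \in t -> b \in Deltap by move=> bt; apply: sP; rewrite inE bt orbT.
apply/eqP; rewrite big_cons => E.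
have [b bt ab] : exists2 b, b \in t & dotv a b < 0.
  apply: contrapT => nex.
  have ge0 : 0 <= dotv a (\sum_(b <- t) b).
    rewrite dotv_sumr big_seq sumr_ge0 // => b bt; rewrite leNgt; apply/negP => ab.
    by apply: nex; exists b.
  have aa : 0 < dotv a a by rewrite dotv_gt0 pos_neq0.
  have : dotv a (a + \sum_(b <- t) b) = 0 by rewrite E dotv0r.
  by rewrite dotvDr; lra.
have bp := tP _ bt.
have abD : a + b \in Delta.
  apply: root_add => //; try exact: pos_sub.
  by apply: contraTneq ap => ->; rewrite pos_oppF.
have abP := pos_add ap bp abD.
have := IH ((a + b) :: rem b t); rewrite /= size_rem // big_cons.
have -> : (a + b) + \sum_(j <- rem b t) j = 0.
  by rewrite -[RHS]E [X in _ = _ + X](perm_big _ (perm_to_rem bt)) /= big_cons addrA.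
rewrite eqxx => H; have : false = true; last by [].
apply: H => //; first by case: (t) bt tN => //= c t' _; rewrite ltnS.
move=> c; rewrite inE => /orP[/eqP->//|/mem_rem]; exact: tP.
Qed.

Definition possum (v : V) : Prop :=
  exists s, [/\ s != [::], {subset s <= Deltap} & v = \sum_(b <- s) b].

Lemma possumD u v : possum u -> possum v -> possum (u + v).
Proof.
case=> s [s0 sP ->] [t [t0 tP ->]]; exists (s ++ t); split; last by rewrite big_cat.
  by case: s s0 {sP}.
by move=> b; rewrite mem_cat => /orP[/sP|/tP].
Qed.

Lemma possum1 a : a \in Deltap -> possum a.
Proof. by move=> ap; exists [:: a]; split=> [//|b|]; rewrite ?inE ?big_seq1 // => /eqP->. Qed.

Lemma possum0 : ~ possum 0.
Proof. by case=> s [s0 sP /esym/eqP]; apply/negP; exact: pos_sum_neq0. Qed.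

(** Its cardinality is the measure for induction along the order given by [possum]. *)
Definition below a : {fset V} := [fset b in Deltap | `[< possum (a - b) >]]%fset.

Lemma below_lt a b : b \in Deltap -> possum (a - b) -> (#|` below b| < #|` below a|)%N.
Proof.
move=> bp ab; apply: fproper_ltn_card; rewrite fproperE; apply/andP; split.
  apply/fsubsetP => c; rewrite !inE /= => /andP[-> /asboolP bc]; apply/asboolP.
  by rewrite -(subrK b a) -addrA; exact: possumD.
apply/fsubsetPn; exists b; first by rewrite !inE bp; apply/asboolP.
by rewrite !inE bp subrr /=; apply/asboolP; exact: possum0.
Qed.

Lemma pos_ind (Q : V -> Prop) :
  (forall a, a \in Deltap -> (forall b, b \in Deltap -> possum (a - b) -> Q b) -> Q a) ->
  forall a, a \in Deltap -> Q a.
Proof.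
move=> H a; move: {2}(#|` below a|) (leqnn (#|` below a|)) => N.
elim: N a => [|N IH] a aN ap; apply: H => // b bp ab; have := leq_trans (below_lt bp ab) aN.
  by [].
by rewrite ltnS => bN; exact: IH.
Qed.

Lemma pos_simple_sum a : a \in Deltap ->
  exists s, [/\ s != [::], (forall b, b \in s -> simple b) & a = \sum_(b <- s) b].
Proof.
move: a; apply: pos_ind => a ap IH.
have [sa|nsa] := pselect (simple a).
  by exists [:: a]; split=> [//|b|]; rewrite ?big_seq1 // inE => /eqP->.
have [b [c [bp cp aE]]] : exists b c, [/\ b \in Deltap, c \in Deltap & a = b + c].
  apply: contrapT => nex; apply: nsa; split => // b c bp cp aE.
  by apply: nex; exists b, c.
have [s [s0 sS bE]] : exists s, [/\ s != [::], (forall b, b \in s -> simple b) & b = \sum_(b <- s) b].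
  by apply: IH => //; rewrite aE addrAC subrr add0r; exact: possum1.
have [t [t0 tS cE]] : exists s, [/\ s != [::], (forall b, b \in s -> simple b) & c = \sum_(b <- s) b].
  by apply: IH => //; rewrite aE addrK; exact: possum1.
exists (s ++ t); split; first by case: (s) s0.
  by move=> e; rewrite mem_cat => /orP[/sS|/tS].
by rewrite big_cat aE {1}bE {1}cE.
Qed.

Lemma simple_obtuse a b : simple a -> simple b -> a != b -> dotv a b <= 0.
Proof.
move=> sa sb ab; rewrite leNgt; apply/negP => ab0.
have abD := root_sub (simple_root_in sa) (simple_root_in sb) ab0 ab.
case: (boolP (a - b \in Deltap)) => [abp|].
  by case: sa => _ /(_ b (a - b) (simple_pos sb) abp); apply; rewrite addrC subrK.
rewrite pos_xor // negbK opprB => bap.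
by case: sb => _ /(_ a (b - a) (simple_pos sa) bap); apply; rewrite addrC subrK.
Qed.

(** If s_a b were negative, b and -s_a b would be sums of simple roots with total <b, a^vee> a. The
    terms other than a then add up to a multiple of a, a nonpositive one since simple roots are
    mutually obtuse, and adding copies of a would give a vanishing sum of positive roots. If there
    are no such terms, b is a multiple of a. *)
Lemma simple_refl_pos a b : simple a -> b \in Deltap -> b != a -> refl a b \in Deltap.
Proof.
move=> sa bp ba; have aD := simple_root_in sa; have ap := simple_pos sa.
rewrite pos_xor; last by apply: root_refl => //; exact: pos_sub.
apply/negP => rp.
have [s [s0 sS bE]] := pos_simple_sum bp; have [t [t0 tS rE]] := pos_simple_sum rp.
pose m := Num.floor (copair b a).
have mE : copair b a = m%:~R by exact: int_floorK (root_int aD (pos_sub bp)).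
have stE : \sum_(e <- s ++ t) e = m%:~R *: a.
  by rewrite big_cat /= -bE -rE /refl mE opprB addrC subrK.
have stS e : e \in s ++ t -> simple e by rewrite mem_cat => /orP[/sS|/tS].
pose T := [seq e <- s ++ t | e != a]; pose k := count_mem a (s ++ t).
have kE (r : seq V) : \sum_(e <- r) e = (count_mem a r)%:R *: a + \sum_(e <- [seq e <- r | e != a]) e.
  elim: r => [|e r IH]; first by rewrite !big_nil scale0r addr0.
  rewrite big_cons IH /=; case: eqP => [->|_] /=.
    by rewrite natrD scalerDl scale1r addrA.
  by rewrite big_cons add0n addrCA.
have TE : \sum_(e <- T) e = (m - k%:Z)%:~R *: a.
  rewrite rmorphB /= scalerBl -stE (kE (s ++ t)) -/k -/T addrC addrA.
  by rewrite addNr add0r.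
case: (eqVneq T [::]) => [T0|T0].
  have sa' : [seq e <- s | e != a] = [::].
    by move: T0; rewrite /T filter_cat; case: [seq e <- s | _].
  have := kE s; rewrite sa' big_nil addr0 -bE => /(root_proportional aD (pos_sub bp))[].
    by move/eqP: ba.
  by move=> E; move: bp; rewrite E pos_oppF.
have TP e : e \in T -> e \in Deltap.
  by rewrite mem_filter => /andP[_ /stS/simple_pos].
have mk : m - k%:Z <= 0.
  have : dotv (\sum_(e <- T) e) a <= 0.
    rewrite dotv_suml big_seq sumr_le0 // => e; rewrite mem_filter => /andP[ea /stS se].
    exact: simple_obtuse.
  rewrite TE dotvZl pmulr_lle0 ?dotv_gt0 ?pos_neq0 //.
  by rewrite -[0]/(0%:~R) ler_int.
have [j jE] : exists j : nat, m - k%:Z = - j%:Z by exists `|k%:Z - m|%N; lia.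
have := @pos_sum_neq0 (T ++ nseq j a).
have -> : \sum_(e <- T ++ nseq j a) e = 0.
  rewrite big_cat TE jE /= big_nseq -Monoid.iteropE /= .
  by rewrite mulrNz scaleNr -[iterop _ _ _ _]/(a *+ j) -scaler_nat addNr.
rewrite eqxx => H; have : false = true; last by [].
apply: H; first by case: (T) T0.
by move=> e; rewrite mem_cat => /orP[/TP//|]; rewrite mem_nseq => /andP[_ /eqP->].
Qed.

(** s_a permutes the positive roots other than a, so it changes their total 2 rho by -2 a. *)
Lemma dotv_rho_simple a : simple a -> 2 * dotv (rho Phi) a = dotv a a.
Proof.
move=> sa; have ap := simple_pos sa; have a0 := simple_neq0 sa.
pose r := \sum_(b : Deltap) val b.
pose sa' : Deltap := [` ap]%fset.
(* The default value makes [t] fix a, since -a is not positive. *)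
pose t (b : Deltap) : Deltap := insubd b (refl a (val b)).
have tE (b : Deltap) : b != sa' -> val (t b) = refl a (val b).
  move=> ba; rewrite /t insubdK //; apply: simple_refl_pos => //; exact: valP.
have ra : refl a r = r - a - a.
  rewrite /r refl_sum (bigD1 sa') //= refl_neg // [in RHS](bigD1 sa') //=.
  rewrite [a + _ - _]addrAC subrr add0r [RHS]addrC; congr (_ + _).
  rewrite (eq_bigr (fun b => val (t b))) => [|b ba]; last by rewrite tE.
  have tsa (b : Deltap) : b != sa' -> t b != sa'.
    move=> ba; apply/eqP => /(congr1 val); rewrite tE //= => E.
    have := valP b; rewrite -[val b](refl_involutive a0) E refl_neg //.
    by rewrite (pos_oppF ap).
  have tK (b : Deltap) : b != sa' -> t (t b) = b.
    by move=> ba; apply: val_inj; rewrite !tE ?tsa // refl_involutive.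
  rewrite [RHS](reindex_onto t t) => [|b ba]; last exact: tK.
  apply: eq_bigl => b; case: (boolP (b == sa')) => [/eqP->|ba]; last by rewrite tsa // tK // eqxx.
  apply/esym/negbTE; rewrite negb_and; case: eqP => //= tn.
  have ts : t sa' = sa'.
    rewrite /t /insubd insubF //= refl_neg //; exact: pos_oppF.
  by rewrite ts in tn.
have : copair r a = 2.
  have /eqP := ra; rewrite /refl -addrA (inj_eq (addrI _)) -opprD eqr_opp => /eqP E.
  have /eqP : (copair r a - 2) *: a = 0.
    by rewrite scalerBl E scaler_nat mulr2n subrr.
  by rewrite scaler_eq0 (negbTE a0) orbF subr_eq0 => /eqP.
rewrite copairE => /(congr1 (fun z => z * dotv a a)).
rewrite mulfVK ?dotv_eq0 // => E; rewrite /rho dotvZl mulrA mulfV ?pnatr_eq0 // mul1r -/r.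
by move: E; set u := dotv r a; set v := dotv a a; lra.
Qed.

Lemma dotv_rho_pos b : b \in Deltap -> 0 < dotv (rho Phi) b.
Proof.
case/pos_simple_sum => s [s0 sS ->]; rewrite dotv_sumr.
have p a : simple a -> 0 < dotv (rho Phi) a.
  move=> sa; have := dotv_rho_simple sa; have : 0 < dotv a a by rewrite dotv_gt0 simple_neq0.
  lra.
case: s s0 sS => [//|a s] _ sS; rewrite big_cons ltr_wpDr //; last first.
  by apply: p; apply: sS; exact: mem_head.
by rewrite big_seq sumr_ge0 // => c cs; rewrite ltW // p //; apply: sS; rewrite inE cs orbT.
Qed.

Definition simples s := forall a, a \in s -> simple a.

Lemma simples_cons a s : simples (a :: s) -> simple a /\ simples s.
Proof. by move=> h; split=> [|b bs]; apply: h; rewrite inE ?eqxx // bs orbT. Qed.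
Lemma simples_no0 s : simples s -> no0 s.
Proof. by move=> h a /h/simple_neq0. Qed.
Lemma simples_cat s t : simples s -> simples t -> simples (s ++ t).
Proof. by move=> hs ht a; rewrite mem_cat => /orP[/hs|/ht]. Qed.
Lemma simples_rev s : simples s -> simples (rev s).
Proof. by move=> h a; rewrite mem_rev => /h. Qed.
Lemma simples_sub s : simples s -> {subset s <= Delta}.
Proof. by move=> h a /h/simple_root_in. Qed.

(** At a letter where the root changes from positive to negative, the root equals that letter; s_a
    conjugated to this place cancels it. *)
Lemma wact_exchange s a : simples s -> simple a -> wact s a \notin Deltap ->
  exists s', [/\ simples s', (size s' < size s)%N & forall x, wact s (refl a x) = wact s' x].
Proof.
elim: s => [|b t IH] /=; first by move=> _ /simple_pos ->.
move=> /simples_cons[sb st] sa nb; case: (boolP (wact t a \in Deltap)) => tp.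
  have tb : wact t a = b.
    by apply/eqP; apply: contraR nb => tb; exact: simple_refl_pos.
  exists t; split=> // x; rewrite -{1}tb -refl_act; last exact: simples_no0.
  by rewrite tb refl_involutive // simple_neq0.
have [s' [ss' sz sE]] := IH st sa tp; exists (b :: s'); split=> [c||x /=]; last by rewrite sE.
  by rewrite inE => /orP[/eqP->|/ss'].
by [].
Qed.

Definition cone x : Prop := exists2 f : Deltap -> R, (forall b : Deltap, 0 <= f b) & x = \sum_(b : Deltap) f b *: val b.

Lemma cone0 : cone 0.
Proof. by exists (fun=> 0) => //; rewrite big1 // => b _; rewrite scale0r. Qed.
Lemma coneD x y : cone x -> cone y -> cone (x + y).
Proof.
case=> f f0 -> [g g0 ->]; exists (fun b => f b + g b) => [b|]; first by rewrite addr_ge0.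
by rewrite -big_split; apply: eq_bigr => b _; rewrite scalerDl.
Qed.
Lemma cone_scale c x : 0 <= c -> cone x -> cone (c *: x).
Proof.
move=> c0 [f f0 ->]; exists (fun b => c * f b) => [b|]; first by rewrite mulr_ge0.
by rewrite scaler_sumr; apply: eq_bigr => b _; rewrite scalerA.
Qed.
Lemma cone_pos b : b \in Deltap -> cone b.
Proof.
move=> bp; exists (fun c => (c == [` bp]%fset)%:R) => [c|]; first exact: ler0n.
rewrite (bigD1 [` bp]%fset) //= eqxx scale1r big1 ?addr0 // => c /negbTE ->.
by rewrite scale0r.
Qed.
Lemma cone_sum (I : eqType) (r : seq I) (F : I -> V) :
  (forall i, i \in r -> cone (F i)) -> cone (\sum_(i <- r) F i).
Proof.
elim: r => [|i r IH] h; first by rewrite big_nil; exact: cone0.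
rewrite big_cons; apply: coneD; first by apply: h; exact: mem_head.
by apply: IH => j jr; apply: h; rewrite inE jr orbT.
Qed.

Lemma cone_dotv_ge0 x y : (forall b, b \in Deltap -> 0 <= dotv y b) -> cone x -> 0 <= dotv y x.
Proof.
move=> yp [f f0 ->]; rewrite dotv_sumr sumr_ge0 // => b _.
by rewrite dotvZr mulr_ge0 // yp //; exact: valP.
Qed.

Lemma cone_rho_ge0 x : cone x -> 0 <= dotv (rho Phi) x.
Proof. by apply: cone_dotv_ge0 => b /dotv_rho_pos/ltW. Qed.

Lemma cone_rho0 x : cone x -> dotv (rho Phi) x = 0 -> x = 0.
Proof.
case=> f f0 -> E; rewrite big1 // => b _.
have : forall b : Deltap, 0 <= dotv (rho Phi) (f b *: val b).
  by move=> c; rewrite dotvZr mulr_ge0 // ltW // dotv_rho_pos //; exact: valP.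
move=> h; move: E; rewrite dotv_sumr => /psumr_eq0P => /(_ (fun c _ => h c)) /(_ b isT).
rewrite dotvZr => /eqP; rewrite mulf_eq0 => /orP[/eqP->|]; first by rewrite scale0r.
by rewrite gt_eqF // dotv_rho_pos //; exact: valP.
Qed.

(** rho is strictly positive on the nonzero elements of the cone. *)
Lemma cone_anti x : cone x -> cone (- x) -> x = 0.
Proof.
move=> cx cn; apply: cone_rho0 => //; apply/eqP; rewrite eq_le cone_rho_ge0 // andbT.
by rewrite -oppr_ge0 -dotvNr cone_rho_ge0.
Qed.

Definition dominant x := forall b, b \in Deltap -> 0 <= dotv x b.

Lemma dominant_simple x : (forall a, simple a -> 0 <= dotv x a) -> dominant x.
Proof.
move=> h b /pos_simple_sum[s [_ sS ->]]; rewrite dotv_sumr big_seq sumr_ge0 // => a /sS.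
exact: h.
Qed.

Lemma dominant_copair x a : dominant x -> a \in Deltap -> 0 <= copair x a.
Proof. by move=> dx ap; rewrite copairE divr_ge0 ?dotv_ge0 // mulr_ge0 // dx. Qed.

(** Peel off the last letter a, leaving w. If w a is positive, w s_a x is w x minus <x, a^vee> w a;
    otherwise the exchange property gives a shorter word. *)
Lemma dominant_cone s x : simples s -> dominant x -> cone (x - wact s x).
Proof.
move=> + dx; move: {2}(size s) (leqnn (size s)) => N.
elim: N s => [|N IH] s.
  by rewrite leqn0 => /eqP/size0nil -> _; rewrite subrr; exact: cone0.
case/lastP: s => [|s a]; first by rewrite subrr => _ _; exact: cone0.
rewrite size_rcons ltnS => sN sa.
have ss : simples s by move=> b bs; apply: sa; rewrite mem_rcons inE bs orbT.
have {}sa : simple a by apply: sa; rewrite mem_rcons mem_head.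
rewrite wact_rcons; case: (boolP (wact s a \in Deltap)) => sap.
  rewrite /refl wactB wactZ opprB addrCA addrC; apply: coneD; first exact: IH.
  by apply: cone_scale; [exact: dominant_copair (simple_pos sa)|exact: cone_pos].
have [s' [ss' s's sE]] := wact_exchange ss sa sap; rewrite sE; apply: IH => //.
exact: leq_trans (ltnW s's) sN.
Qed.

Lemma dominant_act_eq s x : simples s -> dominant x -> dominant (wact s x) -> wact s x = x.
Proof.
move=> ss dx dsx; apply/esym/eqP; rewrite -subr_eq0; apply/eqP; apply: cone_anti.
  exact: dominant_cone.
have := dominant_cone (simples_rev ss) dsx.
by rewrite wact_revK' ?opprB //; exact: simples_no0.
Qed.

(** A positive root has positive inner product with some simple root; unless it is simple itself,
    reflecting it there gives a smaller positive root. *)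
Lemma pos_act_simple b : b \in Deltap -> exists s a, [/\ simples s, simple a & b = wact s a].
Proof.
move: b; apply: pos_ind => b bp IH.
have [sb|nsb] := pselect (simple b); first by exists [::], b.
have [a sa ab] : exists2 a, simple a & 0 < dotv b a.
  have [s [_ sS bE]] := pos_simple_sum bp; apply: contrapT => nex.
  have : dotv b b <= 0.
    rewrite {2}bE dotv_sumr big_seq sumr_le0 // => a /sS sa; rewrite leNgt; apply/negP => h.
    by apply: nex; exists a.
  by rewrite leNgt dotv_gt0 pos_neq0.
have ba : b != a by apply: contra_notN nsb => /eqP->.
have rp := simple_refl_pos sa bp ba.
have [s [a' [ss sa' E]]] : exists s a', [/\ simples s, simple a' & refl a b = wact s a'].
  apply: IH => //; rewrite /refl opprB addrC subrK.
  have p : 0 < copair b a by rewrite copairE divr_gt0 ?mulr_gt0 // dotv_gt0 simple_neq0.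
  rewrite (int_floorK (root_int (simple_root_in sa) (pos_sub bp))) in p *.
  have [m mE] : exists m : nat, Num.floor (copair b a) = m.+1%:Z.
    by move: p; rewrite ltr0z; case: (Num.floor _) => [[|m]|m] //; exists m.
  rewrite mE; exists (nseq m.+1 a); split=> // [c|].
    by rewrite mem_nseq => /andP[_ /eqP->]; exact: simple_pos.
  by rewrite big_nseq -[iter _ _ _]/(iter m.+1 (+%R a) 0) iter_addr_0 pmulrn scaler_nat.
exists (a :: s), a'; split => // [c|]; first by rewrite inE => /orP[/eqP->|/ss].
by rewrite /= -E refl_involutive // simple_neq0.
Qed.

Lemma root_act_simple b : b \in Delta -> exists s a, [/\ simples s, simple a & b = wact s a].
Proof.
move=> bD; case: (boolP (b \in Deltap)) => [|]; first exact: pos_act_simple.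
rewrite pos_xor // negbK => /pos_act_simple[s [a [ss sa E]]].
exists (rcons s a), a; split=> // [c|]; last first.
  by rewrite wact_rcons refl_neg ?simple_neq0 // wactN -E opprK.
by rewrite mem_rcons inE => /orP[/eqP->|/ss].
Qed.

Lemma wact_simple_word u : {subset u <= Delta} -> exists2 s, simples s & forall x, wact u x = wact s x.
Proof.
elim: u => [|b u IH] uD; first by exists [::].
have [s ss sE] : exists2 s, simples s & forall x, wact u x = wact s x.
  by apply: IH => c cu; apply: uD; rewrite inE cu orbT.
have [t [a [st sa bE]]] := root_act_simple (uD b (mem_head _ _)).
exists (t ++ a :: rev t ++ s).
  apply: simples_cat => // c; rewrite inE mem_cat => /orP[/eqP->//|/orP[|/ss//]].
  exact: simples_rev.
move=> x; rewrite wact_cat /= wact_cat sE bE -refl_act; last exact: simples_no0.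
by rewrite wact_revK //; exact: simples_no0.
Qed.

End PositiveRoots.

(** * The basis of simple roots and the Coxeter element *)

Section SimpleBasis.
Variables (R : realType) (d : nat) (Phi : root_datum R d).
Local Notation V := 'rV[R]_d.
Local Notation Delta := (Delta Phi).
Local Notation Deltap := (Deltap Phi).
Local Notation simple := (simple_root Phi).
Implicit Types (a x y : V) (s t : seq V).

Variable S : seq V.
Hypothesis Suniq : uniq S.
Hypothesis SP : forall a, a \in S <-> simple a.

Lemma S_simple a : a \in S -> simple a.
Proof. by move/SP. Qed.
Lemma S_simples s : {subset s <= S} -> simples Phi s.
Proof. by move=> sS a /sS/S_simple. Qed.

(** Separate positive from negative coefficients. Both parts give the same vector, whose square is
    nonpositive because simple roots are mutually obtuse; so it is 0, and pairing with rho kills the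
    coefficients. *)
Lemma simple_independent (c : V -> R) : \sum_(a <- S) c a *: a = 0 -> forall a, a \in S -> c a = 0.
Proof.
move=> E; pose v := \sum_(a <- S | 0 < c a) c a *: a.
pose w := \sum_(a <- S | ~~ (0 < c a)) (- c a) *: a.
have vw : v = w.
  apply/eqP; rewrite -subr_eq0 -E (bigID (fun a => 0 < c a)) /= /v /w -sumrN.
  by apply/eqP; congr (_ + _); apply: eq_bigr => a _; rewrite scaleNr opprK.
have v0 : v = 0.
  apply/eqP; rewrite -dotv_eq0 eq_le dotv_ge0 andbT {2}vw /v dotv_suml.
  rewrite big_seq_cond sumr_le0 // => a /andP[aS ca]; rewrite /w dotv_sumr.
  rewrite big_seq_cond sumr_le0 // => b /andP[bS cb].
  rewrite dotvZl dotvZr pmulr_rle0 // mulr_ge0_le0 ?oppr_ge0 ?leNgt //.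
  by rewrite -leNgt; apply: simple_obtuse; [exact: S_simple|exact: S_simple|apply: contraNneq cb => <-].
have half (P : pred V) (f : V -> R) : (forall a, P a -> 0 <= f a) ->
    \sum_(a <- S | P a) f a *: a = 0 -> forall a, a \in S -> P a -> f a = 0.
  move=> f0 /(congr1 (dotv (rho Phi))); rewrite dotv0r dotv_sumr => F a aS Pa.
  have rp b : b \in S -> 0 < dotv (rho Phi) b by move=> /S_simple/simple_pos; exact: dotv_rho_pos.
  apply/eqP; apply: contraT => fa; have {}fa : 0 < f a by rewrite lt_neqAle eq_sym fa f0.
  have : 0 < \sum_(i <- S | P i) dotv (rho Phi) (f i *: i).
    rewrite (big_rem a) //= Pa dotvZr ltr_wpDr ?mulr_gt0 ?rp //.
    rewrite big_seq_cond sumr_ge0 // => b /andP[/mem_rem bS Pb].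
    by rewrite dotvZr mulr_ge0 ?f0 // ltW // rp.
  by rewrite F ltxx.
move=> a aS; case: (boolP (0 < c a)) => ca.
  by apply: (half (fun a => 0 < c a) c _ v0) => // b /ltW.
apply/eqP; rewrite -oppr_eq0; apply/eqP.
apply: (half (fun a => ~~ (0 < c a)) (fun a => - c a)) => //; last by rewrite -/w -vw.
by move=> b; rewrite -leNgt oppr_ge0.
Qed.

Lemma simple_free : free S.
Proof.
rewrite -[S]/(val (in_tuple S)); apply/freeP => k E i.
pose c a := if insub (index a S) is Some j then k j else 0.
have cE (j : 'I_(size S)) : c S`_j = k j.
  by rewrite /c index_uniq // (valK j).
rewrite -cE; apply: simple_independent; last by rewrite mem_nth.
rewrite (big_nth 0) big_mkord -[RHS]E; apply: eq_bigr => j _.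
by rewrite cE.
Qed.

Lemma simple_span x : x \in <<S>>%VS.
Proof.
suff : (fullv <= <<S>>)%VS by move/subvP; apply; rewrite memvf.
rewrite -(root_span Phi); apply/span_subvP => b bD.
have H c : c \in Deltap -> c \in <<S>>%VS.
  move=> /pos_simple_sum[s [_ sS ->]]; rewrite big_seq; apply: rpred_sum => a /sS/SP.
  exact: memv_span.
case: (boolP (b \in Deltap)) => [/H//|]; rewrite pos_xor // negbK => /H.
by rewrite rpredN.
Qed.

Lemma size_simple : size S = d.
Proof.
have : \dim <<S>> = size S by apply/eqP; exact: simple_free.
have -> : <<S>>%VS = fullv.
  by apply/eqP; rewrite eqEsubv subvf /=; apply/subvP => x _; exact: simple_span.
rewrite dimvf => <-; exact: mul1n.
Qed.

Lemma orth_simple0 x : (forall a, a \in S -> dotv x a = 0) -> x = 0.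
Proof.
move=> h; have : x \in <<S>>%VS by exact: simple_span.
rewrite -[S]/(val (in_tuple S)) => /coord_span xE; apply/eqP; rewrite -dotv_eq0 {2}xE.
rewrite dotv_sumr big1 // => i _; rewrite dotvZr h ?mulr0 //.
exact: mem_nth.
Qed.

Lemma fundamental_weights_exist : exists om : V -> V,
  forall a b, a \in S -> b \in S -> copair (om a) b = (a == b)%:R.
Proof.
pose B : 'M[R]_(size S, d) := \matrix_(i, j) S`_i 0 j.
have Bfree : row_free B.
  apply: inj_row_free => v vB; apply/rowP => i; rewrite mxE.
  have := simple_free; rewrite -{1}[S]/(val (in_tuple S)) => /freeP; apply.
  rewrite -[RHS]vB; apply/rowP => j; rewrite summxE mxE; apply: eq_bigr => k _.
  by rewrite !mxE.
have [C BC] := row_freeP Bfree.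
(* A right inverse of the matrix of simple roots gives the dual basis; the factor (a,a)/2 makes it
   dual to the coroots. *)
pose om a : V := match insub (index a S) with
  | Some i => (dotv a a / 2) *: (col i C)^T | None => 0 end.
exists om => a b aS bS.
have ia : (index a S < size S)%N by rewrite index_mem.
have ib : (index b S < size S)%N by rewrite index_mem.
rewrite /om insubT copairZ copairE.
have -> : dotv (col (Sub (index a S) ia) C)^T b = (a == b)%:R.
  have := congr1 (fun M : 'M_(size S) => M (Ordinal ib) (Ordinal ia)) BC.
  rewrite !mxE => E; rewrite /dotv mxE.
  rewrite (_ : (a == b) = (Ordinal ib == Ordinal ia)); last first.
    apply/idP/idP => /eqP ab; apply/eqP; first by apply: val_inj; rewrite /= ab.
    by have := congr1 (fun i : 'I_(size S) => S`_i) ab; rewrite /= !nth_index.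
  rewrite -E; apply: eq_bigr => k _; rewrite !mxE mulrC nth_index //.
have a0 : dotv a a != 0 by rewrite dotv_eq0 (simple_neq0 (S_simple aS)).
have b0 : dotv b b != 0 by rewrite dotv_eq0 (simple_neq0 (S_simple bS)).
by case: eqP => [->|_]; [field|rewrite mulr0 mul0r mulr0].
Qed.

Section Weights.
Variable om : V -> V.
Hypothesis omP : forall a b, a \in S -> b \in S -> copair (om a) b = (a == b)%:R.

Lemma copair_simple_eq x y : (forall a, a \in S -> copair x a = copair y a) -> x = y.
Proof.
move=> h; apply/eqP; rewrite -subr_eq0; apply/eqP; apply: orth_simple0 => a aS.
have a0 : dotv a a != 0 by rewrite dotv_eq0 (simple_neq0 (S_simple aS)).
have : copair (x - y) a = 0 by rewrite copairB h // subrr.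
rewrite copairE => /eqP; rewrite mulf_eq0 invr_eq0 (negbTE a0) orbF mulf_eq0 pnatr_eq0 /=.
by move/eqP.
Qed.

Lemma weight_expansion x : x = \sum_(a <- S) copair x a *: om a.
Proof.
apply: copair_simple_eq => b bS.
have cs (r : seq V) : copair (\sum_(a <- r) copair x a *: om a) b = \sum_(a <- r) copair x a * copair (om a) b.
  by elim: r => [|a r IH]; rewrite ?big_nil ?copair0 // !big_cons copairD copairZ IH.
rewrite cs (big_rem b) //= omP // eqxx mulr1 big_seq big1 ?addr0 // => a ar.
rewrite omP ?(mem_rem ar) //; move: ar; rewrite mem_rem_uniq // !inE => /andP[/negbTE-> _].
by rewrite mulr0.
Qed.

Lemma om_dominant a : a \in S -> dominant Phi (om a).
Proof.
move=> aS; apply: dominant_simple => b /SP bS.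
have b0 : 0 < dotv b b by rewrite dotv_gt0 (simple_neq0 (S_simple bS)).
have : 0 <= copair (om a) b by rewrite omP // ler0n.
by rewrite copairE pmulr_lge0 ?invr_gt0 // pmulr_rge0.
Qed.

Lemma integral_simple x : (forall a, a \in S -> copair x a \is a Num.int) ->
  forall b, b \in Delta -> copair x b \is a Num.int.
Proof.
move=> h b /root_act_simple[s [a [ss sa ->]]]; elim: s x h ss => [|c s IH] x h /=.
  by move=> _; apply: h; apply/SP.
move=> /simples_cons[sc ss]; have c0 := simple_neq0 sc.
rewrite -[x](refl_involutive c0) copair_refl2 //; apply: IH => // e eS.
rewrite /refl copairB copairZ rpredB ?h // rpredM ?h //; first exact/SP.
exact: (root_int (simple_root_in (S_simple eS)) (simple_root_in sc)).
Qed.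

Lemma refl_om a b : a \in S -> b \in S -> refl a (om b) = om b - (b == a)%:R *: a.
Proof. by move=> aS bS; rewrite /refl omP. Qed.

Lemma wact_om_notin s b : {subset s <= S} -> b \in S -> b \notin s -> wact s (om b) = om b.
Proof.
elim: s => //= a s IH sS bS; rewrite inE negb_or => /andP[ba bs].
rewrite IH // => [|c cs]; last by apply: sS; rewrite inE cs orbT.
by rewrite refl_om ?(negbTE ba) ?scale0r ?subr0 //; apply: sS; exact: mem_head.
Qed.

(** The letters other than a fix om_a. So 1 - c, with c the Coxeter element, maps om_a to
    [wact s1 a]; these roots will represent the orbits of c. *)
Lemma wact_om_split s1 a s2 : S = s1 ++ a :: s2 -> wact S (om a) = om a - wact s1 a.
Proof.
move=> SE; have : uniq S by []; rewrite SE cat_uniq /= negb_or.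
case/and3P => _ /andP[as1 _] /andP[as2 _].
have sub1 : {subset s1 <= S} by move=> c cs; rewrite SE mem_cat cs.
have sub2 : {subset s2 <= S} by move=> c cs; rewrite SE mem_cat inE cs !orbT.
have aS : a \in S by rewrite SE mem_cat mem_head orbT.
rewrite wact_cat /= (wact_om_notin sub2) // refl_om // eqxx scale1r wactB.
by rewrite (wact_om_notin sub1).
Qed.

Local Notation cox := (wact S).

Lemma wact_sub_span s x : x - wact s x \in <<s>>%VS.
Proof.
elim: s x => [|a s IH] x /=; first by rewrite subrr mem0v.
rewrite /refl opprB addrC -addrA [- _ + _]addrC; apply: rpredD.
  by apply: rpredZ; apply: memv_span; exact: mem_head.
apply: (subvP (sub_span _)) (IH x) => b bs; by rewrite inE bs orbT.
Qed.

(** Moving the first reflection to the other side shows that <x, a^vee> a lies in the span of the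
    remaining vectors, so it is 0 by independence. *)
Lemma wact_fixed s x : free s -> no0 s -> wact s x = x -> forall a, a \in s -> copair x a = 0.
Proof.
elim: s => // a s IH; rewrite free_cons => /andP[as1 sf] /no0_cons[a0 s0] /= E.
have E' : wact s x = refl a x by rewrite -{2}E refl_involutive.
have := wact_sub_span s x; rewrite E' /refl opprB addrC subrK => H.
have xa : copair x a = 0.
  apply/eqP; apply: contraR as1 => xa.
  by rewrite -[a](scalerK xa) rpredZ.
move=> b; rewrite inE => /orP[/eqP->//|]; apply: IH => //.
by rewrite E' /refl xa scale0r subr0.
Qed.

Lemma cox_fixed x : cox x = x -> x = 0.
Proof.
move=> E; apply: copair_simple_eq => a aS; rewrite copair0.
apply: (wact_fixed simple_free) E a aS; exact: simples_no0 (S_simples (fun a => id)).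
Qed.

Lemma S_no0 : no0 S.
Proof. exact: simples_no0 (S_simples (fun a => id)). Qed.

Lemma cox_inj : injective cox.
Proof. exact: wact_inj S_no0. Qed.

Lemma iter_cox_word k : exists2 s, simples Phi s & forall x, iter k cox x = wact s x.
Proof.
exists (flatten (nseq k S)) => [a|x]; last exact: iter_act.
by case/flattenP => s; rewrite mem_nseq => /andP[_ /eqP->] /S_simple.
Qed.

Lemma om_inj a b : a \in S -> b \in S -> om a = om b -> a = b.
Proof.
move=> aS bS E; apply/eqP; have := omP bS aS; rewrite -E omP // eqxx.
by case: eqP => [->//|_] /eqP; rewrite oner_eq0.
Qed.

Lemma iter_coxB k x y : iter k cox (x - y) = iter k cox x - iter k cox y.
Proof. by rewrite !iter_act wactB. Qed.

(** 1 - c is injective and maps om_a, om_b to the two given roots, so c^k om_a = om_b. Dominant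
    vectors of one Weyl orbit are equal, whence a = b. *)
Lemma iter_cox_beta k s1 a s2 t1 b t2 : S = s1 ++ a :: s2 -> S = t1 ++ b :: t2 ->
  iter k cox (wact s1 a) = wact t1 b -> iter k cox (om a) = om b /\ a = b.
Proof.
move=> SE TE E; have aS : a \in S by rewrite SE mem_cat mem_head orbT.
have bS : b \in S by rewrite TE mem_cat mem_head orbT.
have omE : iter k cox (om a) = om b.
  apply/eqP; rewrite -subr_eq0; apply/eqP; apply: cox_fixed.
  rewrite wactB -iterS iterSr (wact_om_split SE) (wact_om_split TE) iter_coxB E.
  by rewrite opprB addrA subrK.
split=> //; apply: om_inj => //; rewrite -omE.
have [s ss sE] := iter_cox_word k; rewrite sE in omE *.
apply/esym; apply: (dominant_act_eq ss); first exact: om_dominant.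
by rewrite omE; exact: om_dominant.
Qed.

Lemma conj_cox s1 s2 m x : S = s1 ++ s2 ->
  iter m cox (wact s1 x) = wact s1 (iter m (wact (s2 ++ s1)) x).
Proof. by move=> SE; elim: m => //= m ->; rewrite {1}SE !wact_cat. Qed.

(* Conjugate the Coxeter element so that the letter a comes first; then om_a and
   a are fixed by its m-th power, hence so is the dominant vector 2 om_a - a,
   whose om_b-components are the -<a, b^vee>. *)
Lemma cox_period_neighbour m a b : a \in S -> b \in S -> a != b -> copair a b != 0 ->
  iter m cox (om a) = om a -> iter m cox (om b) = om b.
Proof.
move=> aS bS ab abn Ea.
have [s1 [s2 SE]] : exists s1 s2, S = s1 ++ a :: s2.
  by move/splitPr: aS => [s1 s2]; exists s1, s2.
have : uniq S by []; rewrite {1}SE cat_uniq /= negb_or.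
case/and3P => _ /andP[as1 _] /andP[as2 _].
have sub1 : {subset s1 <= S} by move=> c cs; rewrite SE mem_cat cs.
have sub2 : {subset s2 <= S} by move=> c cs; rewrite SE mem_cat inE cs !orbT.
pose c' := wact ((a :: s2) ++ s1).
have s1n0 : no0 s1 by move=> c /sub1/S_no0.
have c'E : forall x, iter m cox (wact s1 x) = wact s1 (iter m c' x) by move=> x; exact: conj_cox.
have om1 : wact s1 (om a) = om a by exact: wact_om_notin.
have Ea' : iter m c' (om a) = om a.
  by apply: (wact_inj s1n0); rewrite -c'E om1.
have c'om : c' (om a) = om a - a.
  by rewrite /c' wact_cat om1 /= (wact_om_notin sub2) // refl_om // eqxx scale1r.
(* om_a - a is the image of om_a under c', so it has the same period. *)
have Eb : iter m c' (om a - a) = om a - a by rewrite -c'om -iterSr iterS Ea'.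
have [w ww wE] : exists2 w, simples Phi w & forall x, iter m c' x = wact w x.
  exists (flatten (nseq m ((a :: s2) ++ s1))) => [e|x]; last exact: iter_act.
  case/flattenP => s; rewrite mem_nseq => /andP[_ /eqP->]; rewrite mem_cat inE => es.
  by apply: S_simple; rewrite SE mem_cat inE orbC.
pose y := om a + (om a - a).
have yE : wact w y = y by rewrite wactD -!wE Ea' Eb.
have ya e : e \in S -> 0 <= copair y e.
  move=> eS; rewrite /y copairD copairB omP //; case: eqP => [<-|/eqP ae].
    rewrite (_ : copair a a = 2); first by rewrite (_ : true%:R = 1 :> R) //; lra.
    by rewrite copairE mulfK // dotv_eq0 S_no0.
  rewrite add0r sub0r oppr_ge0 copairE mulr_le0_ge0 ?invr_ge0 ?dotv_ge0 //.
  rewrite mulr_ge0_le0 //; exact: simple_obtuse (S_simple aS) (S_simple eS) ae.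
have yb : copair y b != 0.
  by rewrite /y copairD copairB omP // (negbTE ab) add0r sub0r oppr_eq0.
have coneb e : e \in S -> cone Phi (om e - wact w (om e)).
  by move=> eS; apply: dominant_cone => //; exact: om_dominant.
(* As w fixes y, a combination with coefficients >= 0 of vectors in the pointed cone vanishes, hence
   each of its terms; the coefficient at b is nonzero. *)
have zero : \sum_(e <- S) copair y e *: (om e - wact w (om e)) = 0.
  have E1 := weight_expansion y.
  have E2 : y = \sum_(e <- S) copair y e *: wact w (om e).
    by rewrite -{1}yE {1}E1 wact_sum; apply: eq_bigr => e _; rewrite wactZ.
  transitivity (\sum_(e <- S) copair y e *: om e - \sum_(e <- S) copair y e *: wact w (om e)).
    by rewrite -sumrB; apply: eq_bigr => e _; rewrite scalerBr.
  by rewrite -E1 -E2 subrr.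
have wb : om b - wact w (om b) = 0.
  have := zero; rewrite (big_rem b) //= => zb.
  have z0 : copair y b *: (om b - wact w (om b)) = 0.
    apply: cone_anti.
      by apply: cone_scale; [exact: ya|exact: coneb].
    have -> : - (copair y b *: (om b - wact w (om b))) = \sum_(e <- rem b S) copair y e *: (om e - wact w (om e)).
      by apply/eqP; rewrite eq_sym -addr_eq0 addrC zb.
    apply: cone_sum => e /mem_rem eS; apply: cone_scale; [exact: ya|exact: coneb].
  by move/eqP: z0; rewrite scaler_eq0 (negbTE yb) => /eqP.
have c'b : iter m c' (om b) = om b.
  by rewrite wE; apply/esym/eqP; rewrite -subr_eq0; apply/eqP.
(* Back from c' to the Coxeter element: if b is not in [s1], this word fixes om_b; otherwise it acts
   on om_b like the whole Coxeter element, which is injective. *)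
have := c'E (om b); rewrite c'b; case: (boolP (b \in s1)) => bs1; last first.
  by rewrite wact_om_notin.
have -> : wact s1 (om b) = cox (om b).
  rewrite SE wact_cat [wact (a :: s2) (om b)]wact_om_notin //.
    by move=> e; rewrite inE => /orP[/eqP->|/sub2].
  rewrite inE negb_or eq_sym ab /=; apply/negP => bs2.
  have : uniq S by []; rewrite SE cat_uniq => /and3P[_ /hasPn/(_ b) + _].
  by rewrite inE bs2 orbT bs1 => /(_ isT).
by rewrite -iterSr iterS => /cox_inj.
Qed.

End Weights.
End SimpleBasis.

(** * The number of roots *)

Section CoxeterCount.
Variables (R : realType) (d : nat) (Phi : root_datum R d).
Local Notation V := 'rV[R]_d.
Local Notation Delta := (Delta Phi).
Local Notation Deltap := (Deltap Phi).
Local Notation simple := (simple_root Phi).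
Implicit Types (a x y : V) (s t : seq V).

Variable S : seq V.
Hypothesis Suniq : uniq S.
Hypothesis SP : forall a, a \in S <-> simple a.
Variable om : V -> V.
Hypothesis omP : forall a b, a \in S -> b \in S -> copair (om a) b = (a == b)%:R.
Local Notation cox := (wact S).
Let SS a : a \in S -> simple a. Proof. by move/SP. Qed.

(* The fixed weights span an orthogonal summand of the root system. *)
Lemma cox_period_all m a : a \in S -> iter m cox (om a) = om a -> forall x, iter m cox x = x.
Proof.
move=> aS Ea.
pose S1 := [seq b <- S | iter m cox (om b) == om b].
pose S2 := [seq b <- S | iter m cox (om b) != om b].
have orth b c : b \in S1 -> c \in S2 -> dotv b c = 0.
  rewrite !mem_filter => /andP[/eqP b1 bS] /andP[c2 cS].
  apply/eqP; apply: contraR c2 => bc; apply/eqP.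
  have bc' : copair b c != 0.
    by rewrite copairE !mulf_neq0 ?pnatr_eq0 ?invr_eq0 ?dotv_eq0 ?(simple_neq0 (SS cS)).
  case: (eqVneq b c) => [<-//|bnc].
  exact: (cox_period_neighbour Suniq SP omP bS cS bnc bc' b1).
have orthV b c : b \in <<S1>>%VS -> c \in <<S2>>%VS -> dotv b c = 0.
  rewrite -[S1]/(val (in_tuple S1)) -[S2]/(val (in_tuple S2)).
  move=> /coord_span -> /coord_span ->; rewrite dotv_suml big1 // => i _.
  rewrite dotv_sumr big1 // => j _; rewrite dotvZl dotvZr orth ?mulr0 //.
    exact: mem_nth.
  exact: mem_nth.
pose A := [fset b in Delta | b \in <<S1>>%VS]%fset.
pose B := [fset b in Delta | b \in <<S2>>%VS]%fset.
(* Every root is a simple root moved by simple reflections, and each of these preserves both spans,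
   as the two are orthogonal. *)
have AB : Delta = (A `|` B)%fset.
  apply/fsetP => b; rewrite !inE /=; case: (boolP (b \in Delta)) => //= bD.
  have [s [c [ss sc ->]]] := root_act_simple bD; elim: s ss => [|e s IH] /=.
    move=> _; have : c \in S by apply/SP.
    by case: (boolP (iter m cox (om c) == om c)) => hc cS; apply/esym/orP; [left|right];
      apply: memv_span; rewrite mem_filter hc.
  move=> /simples_cons[se ss]; have /esym/orP H := IH ss.
  have eS : e \in S by apply/SP.
  have eD : (e \in <<S1>>%VS) || (e \in <<S2>>%VS).
    by case: (boolP (iter m cox (om e) == om e)) => he; apply/orP; [left|right];
      apply: memv_span; rewrite mem_filter he.
  apply/esym/orP; case: H => H; case/orP: eD => eD.
  - by left; apply: rpredB => //; exact: rpredZ.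
  - left; rewrite /refl copairE (orthV _ _ H eD) mulr0 mul0r scale0r subr0 //.
  - right; rewrite /refl copairE dotvC (orthV _ _ eD H) mulr0 mul0r scale0r subr0 //.
  - by right; apply: rpredB => //; exact: rpredZ.
have [A0|B0] : A = fset0 \/ B = fset0.
- apply: root_irreducible AB _ => b c; rewrite !inE /= => /andP[_ b1] /andP[_ c2].
  exact: orthV.
- have : a \in A.
    rewrite !inE /= (simple_root_in (SS aS)) /=; apply: memv_span.
    by rewrite mem_filter Ea eqxx.
  by rewrite A0 inE.
have all1 b : b \in S -> iter m cox (om b) = om b.
  move=> bS; apply/eqP; apply: contraT => hb; have : b \in B; last by rewrite B0 inE.
  rewrite !inE /= (simple_root_in (SS bS)) /=; apply: memv_span.
  by rewrite mem_filter hb.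
move=> x; rewrite (weight_expansion Suniq SP omP x) iter_act wact_sum.
by rewrite big_seq [RHS]big_seq; apply: eq_bigr => b bS; rewrite wactZ -iter_act all1.
Qed.

Variable h : nat.
Hypothesis h_gt0 : (0 < h)%N.
Hypothesis cox_h : forall v, iter h cox v = v.
Hypothesis cox_min : forall k, (0 < k < h)%N -> exists v, iter k cox v <> v.

Let Sn0 : no0 S. Proof. exact: (S_no0 SP). Qed.

(** At a letter where the sign changes from negative to positive, the root is minus that letter and
    becomes the letter itself. *)
Lemma cox_positive_split s x : simples Phi s -> x \in Delta -> x \notin Deltap -> wact s x \in Deltap ->
  exists s1 a s2, s = s1 ++ a :: s2 /\ wact s x = wact s1 a.
Proof.
elim: s => [|a s IH] /=; first by move=> _ _ /negP.
move=> /simples_cons[sa ss] xD xn ap.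
case: (boolP (wact s x \in Deltap)) => sp.
  have [s1 [b [s2 [-> ->]]]] := IH ss xD xn sp.
  by exists (a :: s1), b, s2.
have sxD : wact s x \in Delta by apply: wact_root => //; exact: simples_sub.
move: sp; rewrite pos_xor // negbK => sp.
have sa' : - wact s x = a.
  apply/eqP; apply: contraT => ne; have := simple_refl_pos sa sp ne.
  by rewrite refl_opp (pos_oppF ap).
exists [::], a, s; split=> //=; rewrite -[wact s x]opprK sa' refl_opp refl_neg ?opprK //.
exact: simple_neq0 sa.
Qed.

Lemma iter_cox_root k x : x \in Delta -> iter k cox x \in Delta.
Proof.
move=> xD; elim: k => //= k IH; apply: wact_root => // b bS; exact: simple_root_in (SS bS).
Qed.

Lemma iter_cox_mod k x : iter k cox x = iter (k %% h) cox x.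
Proof.
rewrite {1}(divn_eq k h) addnC iterD; congr (iter _ _ _).
by elim: (k %/ h)%N => [|q IH]; rewrite ?mul0n // mulSn iterD IH.
Qed.

Lemma cox_orbit_sum x : \sum_(k < h) iter k cox x = 0.
Proof.
apply: (cox_fixed Suniq SP); rewrite wact_sum.
have [h' hE] : exists h', h = h'.+1 by exists h.-1; rewrite prednK.
rewrite hE big_ord_recr [RHS]big_ord_recl /= addrC; congr (_ + _).
by have := cox_h x; rewrite {1}hE.
Qed.

(** If no root of the orbit had this form, no negative root of it would ever become positive, so by
    periodicity all of them would have the same sign; but they add up to 0. *)
Lemma cox_orbit_beta x : x \in Delta ->
  exists k s1 a s2, S = s1 ++ a :: s2 /\ iter k cox x = wact s1 a.
Proof.
move=> xD; apply: contrapT => nex.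
have step k : iter k cox x \notin Deltap -> iter k.+1 cox x \notin Deltap.
  move=> kn; apply/negP => kp; apply: nex.
  have [s1 [a [s2 [SE E]]]] := cox_positive_split (fun a aS => SS aS) (iter_cox_root k xD) kn kp.
  by exists k.+1, s1, a, s2.
have steps k j : iter k cox x \notin Deltap -> iter (j + k) cox x \notin Deltap.
  by move=> kn; elim: j => // j /step.
have size_h (f : nat -> V) : [seq f k | k <- iota 0 h] != [::] by case: h h_gt0.
have sumE (f : nat -> V) : \sum_(b <- [seq f k | k <- iota 0 h]) b = \sum_(k < h) f k.
  by rewrite big_map -{1}(subn0 h) -/(index_iota 0 h) big_mkord.
have [[k kn]|allp] := pselect (exists k, iter k cox x \notin Deltap).
  have alln j : - iter j cox x \in Deltap.
    have jn : iter j cox x \notin Deltap.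
      (* The exponent is chosen so that adding k gives j modulo [h]; the subtraction does not
         truncate, as [h] is positive. *)
      rewrite iter_cox_mod; have := steps k (h * k + j %% h - k)%N kn.
      rewrite subnK; last first.
        by apply: leq_trans (leq_addr _ _); case: h h_gt0 => // h' _; rewrite mulSn leq_addr.
      by rewrite iter_cox_mod mulnC modnMDl modn_mod.
    by move: jn; rewrite pos_xor ?negbK //; exact: iter_cox_root.
  have := @pos_sum_neq0 _ _ Phi [seq - iter j cox x | j <- iota 0 h] (size_h _).
  rewrite sumE sumrN cox_orbit_sum oppr0 eqxx => H; have : false = true; last by [].
  by apply: H => b /mapP[j _ ->].
have := @pos_sum_neq0 _ _ Phi [seq iter j cox x | j <- iota 0 h] (size_h _).
rewrite sumE cox_orbit_sum eqxx => H; have : false = true; last by [].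
apply: H => b /mapP[j _ ->]; apply: contrapT => /negP jn; apply: allp; by exists j.
Qed.

Definition beta_root (i : 'I_(size S)) : V := wact (take i S) S`_i.

Lemma beta_split (i : 'I_(size S)) : S = take i S ++ S`_i :: drop i.+1 S.
Proof. by rewrite -drop_nth // cat_take_drop. Qed.

Lemma beta_root_in i : beta_root i \in Delta.
Proof.
apply: wact_root; last by apply: simple_root_in; apply: SS; exact: mem_nth.
by move=> b /mem_take/SS; exact: simple_root_in.
Qed.

Lemma iter_cox_inj k : injective (iter k cox).
Proof. by move=> x y; elim: k => //= k IH /(cox_inj SP)/IH. Qed.

(** Such an equality forces i = j and makes a fundamental weight periodic of period l - k; if this
    were nonzero, the Coxeter element would have an order below [h]. *)
Lemma cox_beta_inj (i j : 'I_(size S)) (k l : 'I_h) :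
  iter k cox (beta_root i) = iter l cox (beta_root j) -> (i, k) = (j, l).
Proof.
wlog: i j k l / (k <= l)%N => [H|kl E].
  by case: (leqP k l) => [|/ltnW] kl E; [exact: H|apply/esym; apply: H].
have E' : iter (l - k) cox (beta_root j) = beta_root i.
  by apply: (@iter_cox_inj k); rewrite -iterD subnKC.
have [omE ji] := iter_cox_beta Suniq SP omP (beta_split j) (beta_split i) E'.
have ij : i = j.
  by apply: val_inj; apply/eqP; rewrite -(nth_uniq 0 (ltn_ord i) (ltn_ord j) Suniq) -ji.
rewrite ij; congr (_, _); apply: val_inj; apply/eqP; rewrite eqn_leq kl /=.
rewrite -subn_eq0; apply: contraT => lk; rewrite -ji in omE.
have lkh : (0 < l - k < h)%N by rewrite lt0n lk (leq_ltn_trans (leq_subr _ _)).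
have [v []] := cox_min lkh.
by apply: (cox_period_all _ omE); exact: mem_nth.
Qed.

(* Each orbit of the Coxeter element s_1 ... s_d on the roots has h elements, and
   exactly one of the form s_1 ... s_(i-1) a_i. *)
Theorem card_roots : #|` Delta| = (size S * h)%N.
Proof.
pose f (p : 'I_(size S) * 'I_h) : Delta := FSetSub (iter_cox_root p.2 (beta_root_in p.1)).
have finj : injective f.
  move=> [i k] [j l] /(congr1 val) /=; exact: cox_beta_inj.
have fsurj : forall b : Delta, exists p, f p = b.
  move=> b; have [k [s1 [a [s2 [SE E]]]]] := cox_orbit_beta (valP b).
  have is_ : (size s1 < size S)%N by rewrite SE size_cat /= -addSnnS leq_addr.
  pose i : 'I_(size S) := Ordinal is_.
  have bi : beta_root i = wact s1 a.
    have tk : take (size s1) S = s1 by rewrite {1}SE take_size_cat.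
    have nt : S`_(size s1) = a by rewrite {1}SE nth_cat ltnn subnn.
    by rewrite /beta_root /= tk nt.
  (* c^l undoes c^k, because l + k is a multiple of [h]. *)
  pose l := (k * h - k)%N; have lh : (l %% h < h)%N by rewrite ltn_pmod.
  exists (i, Ordinal lh); apply: val_inj => /=; rewrite -iter_cox_mod bi -E -iterD subnK.
    by rewrite iter_cox_mod modnMl.
  by rewrite leq_pmulr.
have codomf : codom f =i {: Delta}.
  by move=> b; have [p <-] := fsurj b; rewrite codom_f inE.
by rewrite cardfE -(eq_card codomf) card_codom // card_prod !card_ord.
Qed.

Definition root_sum x : V := \sum_(b : Delta) copair x (val b) *: val b.

Lemma root_sum_dot x y : dotv (root_sum x) y = dotv x (root_sum y).
Proof.
rewrite /root_sum dotv_suml dotv_sumr; apply: eq_bigr => b _.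
by rewrite dotvZl dotvZr !copairE (dotvC y); ring.
Qed.

Lemma root_sumB x y : root_sum (x - y) = root_sum x - root_sum y.
Proof. by rewrite /root_sum -sumrB; apply: eq_bigr => b _; rewrite copairB scalerBl. Qed.
Lemma root_sumZ c x : root_sum (c *: x) = c *: root_sum x.
Proof. by rewrite /root_sum scaler_sumr; apply: eq_bigr => b _; rewrite copairZ scalerA. Qed.

Lemma root_sumD x y : root_sum (x + y) = root_sum x + root_sum y.
Proof. by rewrite /root_sum -big_split; apply: eq_bigr => b _; rewrite copairD scalerDl. Qed.
Lemma root_sum_sum (I : Type) (r : seq I) (F : I -> V) :
  root_sum (\sum_(i <- r) F i) = \sum_(i <- r) root_sum (F i).
Proof.
by apply: (big_morph root_sum root_sumD); have := root_sumB 0 0; rewrite !subrr.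
Qed.

Lemma root_sum_refl (c : Delta) x : root_sum (refl (val c) x) = refl (val c) (root_sum x).
Proof.
rewrite /root_sum refl_sum (reindex_inj (@drefl_inj _ _ Phi c)) /=.
by apply: eq_bigr => b _; rewrite reflZ copair_refl2 // val_root_neq0.
Qed.

(** The map commutes with s_c, so the image of c is negated by s_c, as c is, and must be a multiple
    of c. *)
Lemma root_sum_root (c : Delta) : root_sum (val c) = (copair (root_sum (val c)) (val c) / 2) *: val c.
Proof.
have := root_sum_refl c (val c); rewrite refl_neg ?val_root_neq0 //.
rewrite -scaleN1r root_sumZ scaleN1r /refl; set u := root_sum _.
move=> /eqP; rewrite eq_sym subr_eq addrC -subr_eq opprK => /eqP E.
by rewrite mulrC -scalerA -E -mulr2n -(scaler_nat 2 u) scalerA mulVf ?pnatr_eq0 // scale1r.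
Qed.

(* By irreducibility the map is scalar; its trace is 2 |Delta| = 2 h d. *)
Theorem root_sum_scalar x : root_sum x = (2 * h%:R) *: x.
Proof.
pose t (c : Delta) := copair (root_sum (val c)) (val c) / 2.
have tE c : root_sum (val c) = t c *: val c by exact: root_sum_root.
(* The map is symmetric, so roots that are not orthogonal have the same eigenvalue. *)
have teq b c : dotv (val b) (val c) != 0 -> t b = t c.
  move=> bc; have := root_sum_dot (val b) (val c); rewrite !tE dotvZl dotvZr.
  exact: (mulIf bc).
have [c0 _] : exists c : Delta, true.
  by have /fset0Pn[b bD] := root_nonempty Phi; exists [` bD]%fset.
pose A := [fset val b | b in {: Delta} & t b == t c0]%fset.
pose B := [fset val b | b in {: Delta} & t b != t c0]%fset.
have AB : Delta = (A `|` B)%fset.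
  apply/fsetP => b; rewrite inE; apply/idP/orP => [bD|].
    by case: (boolP (t [` bD]%fset == t c0)) => h0; [left|right];
      apply/imfsetP; exists [` bD]%fset; rewrite //= inE.
  by case=> /imfsetP[b' _ ->]; exact: valP.
have [A0|B0] : A = fset0 \/ B = fset0.
- apply: root_irreducible AB _ => b c /imfsetP[b' /=]; rewrite inE => /eqP tb ->.
  move=> /imfsetP[c' /=]; rewrite inE => tc ->.
  by apply/eqP; apply: contraR tc => /teq <-; rewrite tb.
- have : val c0 \in A by apply/imfsetP; exists c0; rewrite //= inE.
  by rewrite A0 inE.
have tall b : t b = t c0.
  apply/eqP; apply: contraT => tb; have : val b \in B by apply/imfsetP; exists b; rewrite //= inE.
  by rewrite B0 inE.
have scal y : root_sum y = t c0 *: y.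
  have : y \in <<Delta>>%VS by rewrite (root_span Phi) memvf.
  rewrite -[X in <<X>>%VS]/(val (in_tuple Delta)) => /coord_span ->.
  set r := \sum_i _.
  rewrite /r root_sum_sum scaler_sumr; apply: eq_bigr => i _.
  have iD : (in_tuple Delta)`_i \in Delta by apply: mem_nth.
  rewrite root_sumZ -[_`_i]/(val [` iD]%fset) tE tall !scalerA mulrC //.
suff -> : 2 * h%:R = t c0 by exact: scal.
have d0 : (0 < d)%N.
  have := val_root_neq0 c0; rewrite lt0n; apply: contraNneq => d0.
  by apply/eqP/rowP => -[i ii]; exfalso; move: ii; rewrite {1}d0.
have tr : d%:R * t c0 = \sum_(i < d) root_sum (delta_mx 0 i) 0 i.
  under eq_bigr do rewrite scal !mxE !eqxx mulr1.
  by rewrite sumr_const card_ord mulr_natl.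
(* Each rank one map x |-> <x, b^vee> b has trace 2. *)
have tr2 : \sum_(i < d) root_sum (delta_mx 0 i) 0 i = 2 * (#|{: Delta}|)%:R.
  under eq_bigr do rewrite summxE.
  rewrite exchange_big /= mulr_natr -sumr_const; apply: eq_bigr => b _.
  have b0 := val_root_neq0 b.
  under eq_bigr do rewrite mxE copairE.
  have dE i : dotv (delta_mx 0 i) (val b) = (val b) 0 i.
    by rewrite /dotv -rowE !mxE.
  under eq_bigr do rewrite dE.
  transitivity ((2 * \sum_i (val b) 0 i * (val b) 0 i) / dotv (val b) (val b)).
    by rewrite mulr_sumr mulr_suml; apply: eq_bigr => i _ /=; ring.
  rewrite (_ : \sum_i _ = dotv (val b) (val b)); first by rewrite mulfK // dotv_eq0.
  by rewrite /dotv mxE; apply: eq_bigr => i _; rewrite mxE.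
have d0' : d%:R != 0 :> R by rewrite pnatr_eq0 -lt0n.
apply: (mulfI d0'); rewrite tr tr2 -cardfE card_roots (size_simple Suniq SP) natrM.
by rewrite mulrCA.
Qed.

Lemma root_sum_pos x : root_sum x = 2 *: \sum_(b : Deltap) copair x (val b) *: val b.
Proof.
have fsE (A : {fset V}) : \sum_(b : A) copair x (val b) *: val b = \sum_(b <- A) copair x b *: b.
  by rewrite big_seq_fsetE.
rewrite /root_sum !fsE.
have -> : \sum_(b <- Delta) copair x b *: b =
    \sum_(b <- (Deltap : seq V) ++ [seq - b | b <- (Deltap : seq V)]) copair x b *: b.
  apply: perm_big; apply: uniq_perm; first exact: fset_uniq.
    rewrite cat_uniq fset_uniq map_inj_uniq ?fset_uniq ?andbT //; last exact: oppr_inj.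
    apply/hasPn => _ /mapP[b bp ->]; rewrite /= pos_oppF //.
  move=> b; rewrite mem_cat; apply/idP/orP => [bD|[/pos_sub//|/mapP[c cp ->]]].
    case: (boolP (b \in Deltap)) => [|]; first by left.
    rewrite pos_xor // negbK => bp; right; apply/mapP; exists (- b) => //.
    by rewrite opprK.
  by apply: root_opp; exact: pos_sub.
rewrite big_cat big_map /= scaler_nat mulr2n; congr (_ + _).
by apply: eq_bigr => b _; rewrite copairNr scaleNr scalerN opprK.
Qed.

Corollary pos_root_sum x : \sum_(b : Deltap) copair x (val b) *: val b = h%:R *: x.
Proof.
have := root_sum_pos x; rewrite root_sum_scalar -scalerA.
by move/(scalerI _) => -> //; rewrite pnatr_eq0.
Qed.

End CoxeterCount.

(** * Steinberg's spanning set *)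

Section WeylGroup.
Variables (R : realType) (d : nat) (Phi : root_datum R d).
Local Notation V := 'rV[R]_d.
Local Notation Delta := (Delta Phi).
Local Notation Deltap := (Deltap Phi).
Local Notation P := (lat Phi 1).
Implicit Types (x y : V) (u v : seq Delta) (l m : P).

(** If t s_a fixes rho, then (rho, t a) = -(rho, a) < 0, so t a is negative and the exchange
    property shortens the word. *)
Lemma rho_fixed s : simples Phi s -> wact s (rho Phi) = rho Phi -> forall x, wact s x = x.
Proof.
move: {2}(size s) (leqnn (size s)) => N.
elim: N s => [|N IH] s; first by rewrite leqn0 => /eqP/size0nil ->.
case/lastP: s => [//|t a]; rewrite size_rcons ltnS => tN ss E x.
have st : simples Phi t by move=> b bt; apply: ss; rewrite mem_rcons inE bt orbT.
have sa : simple_root Phi a by apply: ss; rewrite mem_rcons mem_head.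
have tan : wact t a \notin Deltap.
  apply/negP => tap; have := dotv_act (rho Phi) a (simples_no0 ss).
  rewrite E wact_rcons refl_neg ?(simple_neq0 sa) // wactN dotvNr.
  by have := dotv_rho_pos tap; have := dotv_rho_pos (simple_pos sa); lra.
have [s' [ss' s't sE]] := wact_exchange st sa tan.
rewrite wact_rcons sE; apply: (IH _ _ ss').
  by rewrite -ltnS (leq_trans s't) // (leq_trans tN).
by rewrite -sE -wact_rcons.
Qed.

Definition dact u x : V := wact [seq val b | b <- u] x.

Lemma map_val_sub u : {subset [seq val b | b <- u] <= Delta}.
Proof. by move=> b /mapP[c _ ->]; exact: valP. Qed.
Lemma map_val_no0 u : no0 [seq val b | b <- u].
Proof. by move=> b /map_val_sub/root_neq0P. Qed.

Lemma dact_cat u v x : dact (u ++ v) x = dact u (dact v x).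
Proof. by rewrite /dact map_cat wact_cat. Qed.
Lemma dact_revK u x : dact u (dact (rev u) x) = x.
Proof. by rewrite /dact map_rev wact_revK //; exact: map_val_no0. Qed.
Lemma dact_revK' u x : dact (rev u) (dact u x) = x.
Proof. by rewrite /dact map_rev wact_revK' //; exact: map_val_no0. Qed.
Lemma dactD u x y : dact u (x + y) = dact u x + dact u y.
Proof. exact: wactD. Qed.
Lemma dactZ u c x : dact u (c *: x) = c *: dact u x.
Proof. exact: wactZ. Qed.
Lemma dact_root u b : b \in Delta -> dact u b \in Delta.
Proof. by move=> bD; apply: wact_root => //; exact: map_val_sub. Qed.
Lemma copair_dact u x y : copair (dact u x) (dact u y) = copair x y.
Proof. by apply: copair_act; exact: map_val_no0. Qed.

Lemma dact_rho_inj u v : dact u (rho Phi) = dact v (rho Phi) -> dact u =1 dact v.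
Proof.
move=> E x; have [s ss sE] := wact_simple_word (@map_val_sub (rev v ++ u)).
have H y : dact (rev v) (dact u y) = wact s y by rewrite -dact_cat -sE.
rewrite -[LHS](dact_revK v) H rho_fixed //.
by rewrite -H E dact_revK'.
Qed.

Lemma val_lat_act h u (l : lat Phi h) : (lat_act u l : V) = dact u l.
Proof. by elim: u => //= a u IH; rewrite -[RHS]/(refl (val a) (dact u l)) -IH. Qed.

Lemma lat_actD h u (l m : lat Phi h) : lat_act u (l + m) = lat_act u l + lat_act u m.
Proof. by apply: val_inj; rewrite /= !val_lat_act dactD. Qed.
Lemma lat_act0 h u : lat_act u (0 : lat Phi h) = 0.
Proof. by apply: val_inj; rewrite /= val_lat_act /dact wact0. Qed.
Lemma lat_act_cat h u v (l : lat Phi h) : lat_act (u ++ v) l = lat_act u (lat_act v l).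
Proof. by apply: val_inj; rewrite /= !val_lat_act dact_cat. Qed.
Lemma lat_act_revK h u (l : lat Phi h) : lat_act u (lat_act (rev u) l) = l.
Proof. by apply: val_inj; rewrite /= !val_lat_act dact_revK. Qed.
Lemma lat_act_revK' h u (l : lat Phi h) : lat_act (rev u) (lat_act u l) = l.
Proof. by apply: val_inj; rewrite /= !val_lat_act dact_revK'. Qed.
Lemma lat_act_inj h u : injective (@lat_act R d Phi h u).
Proof. exact: can_inj (@lat_act_revK' h u). Qed.

Lemma dact_eq_on_roots u v : (forall b, b \in Delta -> dact u b = dact v b) -> dact u =1 dact v.
Proof.
move=> uv x; have : x \in <<Delta>>%VS by rewrite (root_span Phi) memvf.
rewrite -[X in <<X>>%VS]/(val (in_tuple (enum_fset Delta))) => /coord_span ->.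
rewrite /dact !wact_sum; apply: eq_bigr => i _; rewrite !wactZ; congr (_ *: _).
by apply: uv; apply: mem_nth.
Qed.

(** An element of W is recorded by the permutation it induces on the roots, which span; there are
    finitely many such permutations, and [wd] picks a word for each. *)
Theorem weyl_finite : exists (I : finType) (wd : I -> seq Delta),
  (forall i j, dact (wd i) =1 dact (wd j) -> i = j) /\ (forall u, exists i, dact (wd i) =1 dact u).
Proof.
pose rt u : {ffun Delta -> Delta} := [ffun b => FSetSub (dact_root u (valP b))].
have rtE u v : rt u = rt v <-> dact u =1 dact v.
  split=> [E|E]; last by apply/ffunP => b; rewrite !ffunE; apply: val_inj; rewrite /= E.
  apply: dact_eq_on_roots => b bD; have := congr1 (fun f : {ffun Delta -> Delta} => val (f [` bD]%fset)) E.
  by rewrite !ffunE.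
pose I : finType := {f : {ffun Delta -> Delta} | `[< exists u, rt u = f >]}.
have wdP (i : I) : exists u, rt u = val i by apply/asboolP; exact: (valP i).
have [wd wdE] := choice wdP; exists I, wd; split=> [i j /rtE|u].
  by rewrite !wdE => /val_inj.
have uP : `[< exists v, rt v = rt u >] by apply/asboolP; exists u.
by exists (exist _ (rt u) uP : I); apply/rtE; rewrite wdE.
Qed.

(* A W-invariant scalar product taking integral values on the weight lattice. *)
Definition wform x y : R := \sum_(b : Delta) copair x (val b) * copair y (val b).

Lemma wformC x y : wform x y = wform y x.
Proof. by apply: eq_bigr => b _; rewrite mulrC. Qed.
Lemma wformDl x x' y : wform (x + x') y = wform x y + wform x' y.
Proof. by rewrite -big_split; apply: eq_bigr => b _; rewrite copairD mulrDl. Qed.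
Lemma wformZl c x y : wform (c *: x) y = c * wform x y.
Proof. by rewrite mulr_sumr; apply: eq_bigr => b _; rewrite copairZ mulrA. Qed.
Lemma wformBl x x' y : wform (x - x') y = wform x y - wform x' y.
Proof. by rewrite wformDl -scaleN1r wformZl mulN1r. Qed.
Lemma wform_suml (I : Type) (r : seq I) (F : I -> V) y :
  wform (\sum_(i <- r) F i) y = \sum_(i <- r) wform (F i) y.
Proof.
apply: (big_morph (wform^~ y)) => [x x'|]; first exact: wformDl.
by rewrite -(scale0r 0) wformZl mul0r.
Qed.
Lemma wformDr x y y' : wform x (y + y') = wform x y + wform x y'.
Proof. by rewrite wformC wformDl !(wformC x). Qed.
Lemma wformBr x y y' : wform x (y - y') = wform x y - wform x y'.
Proof. by rewrite wformC wformBl !(wformC x). Qed.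
Lemma wformZr c x y : wform x (c *: y) = c * wform x y.
Proof. by rewrite wformC wformZl wformC. Qed.

Lemma wform_sqr c x y : wform (c *: x + y) (c *: x + y) =
  c * c * wform x x + 2 * (c * wform x y) + wform y y.
Proof. by rewrite wformDl !wformDr !wformZl !wformZr (wformC y x); ring. Qed.

Lemma wform_refl (c : Delta) x y : wform (refl (val c) x) (refl (val c) y) = wform x y.
Proof.
rewrite /wform (reindex_inj (@drefl_inj _ _ Phi c)) /=.
by apply: eq_bigr => b _; rewrite !copair_refl2 // val_root_neq0.
Qed.

Lemma wform_dact u x y : wform (dact u x) (dact u y) = wform x y.
Proof. by elim: u => // a u IH; rewrite -IH; exact: wform_refl. Qed.

Lemma wform_root b y : b \in Delta -> 2 * wform b y = copair y b * wform b b.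
Proof.
move=> bD; have := wform_refl [` bD]%fset b y; rewrite /= refl_neg ?(root_neq0P bD) //.
rewrite -scaleN1r wformZl /refl wformBr wformZr; lra.
Qed.

Lemma wform_root_gt0 b : b \in Delta -> 0 < wform b b.
Proof.
move=> bD; rewrite /wform (bigD1 [` bD]%fset) //= (copair_root bD) ltr_wpDr //; last by rewrite mulr_gt0.
by rewrite sumr_ge0 // => c _; rewrite -expr2 sqr_ge0.
Qed.

(** Each positive root b pairs positively with y also in this form, as 2 (b,y) = <y, b^vee>
    (b,b). *)
Lemma wform_cone_gt0 y z : (forall b, b \in Deltap -> 0 < dotv y b) ->
  cone Phi z -> z != 0 -> 0 < wform z y.
Proof.
move=> yp [f f0 ->] z0.
have term (b : Deltap) : 0 <= wform (f b *: val b) y ?= iff (f b == 0).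
  have bp := valP b; have bD := pos_sub bp.
  have p : 0 < wform (val b) y.
    have := wform_root y bD; have := wform_root_gt0 bD.
    have : 0 < copair y (val b) by rewrite copairE divr_gt0 ?mulr_gt0 ?yp // dotv_gt0 (pos_neq0 bp).
    by move=> c0 w0; have := mulr_gt0 c0 w0; lra.
  rewrite wformZl; apply/leifP; case: eqP => [->|/eqP fb]; first by rewrite mul0r.
  by rewrite mulr_gt0 // lt_def fb f0.
rewrite wform_suml lt_def; apply/andP; split; last by rewrite sumr_ge0 // => b _; case: (term b).
apply: contraNneq z0 => E; rewrite big1 // => b _.
have /(_ b isT) := psumr_eq0P (fun b _ => (term b).1) E.
by move=> E'; have := (term b).2; rewrite E' eqxx => /esym/eqP ->; rewrite scale0r.
Qed.

Lemma wform_int l m : wform l m \is a Num.int.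
Proof. by apply: rpred_sum => b _; rewrite rpredM // latP. Qed.

Lemma wform_ge0 x : 0 <= wform x x.
Proof. by rewrite sumr_ge0 // => b _; rewrite -expr2 sqr_ge0. Qed.

Lemma weyl_act_is_zmod u : zmod_morphism (@weyl_act R d Phi u).
Proof. by move=> f g; rewrite /weyl_act raddfB. Qed.
HB.instance Definition _ u := GRing.isZmodMorphism.Build (ZP Phi) (ZP Phi) (@weyl_act R d Phi u) (weyl_act_is_zmod u).

Lemma weyl_act_basis u l : weyl_act u (mbasis int (l : expo P)) = mbasis int (lat_act u l : expo P).
Proof. by rewrite /weyl_act mextend_basis. Qed.

Lemma weyl_inv0 : weyl_inv (0 : ZP Phi).
Proof. by move=> u; exact: raddf0. Qed.
Lemma weyl_invB (f g : ZP Phi) : weyl_inv f -> weyl_inv g -> weyl_inv (f - g).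
Proof. by move=> fi gi u; rewrite raddfB /= fi gi. Qed.

Section Steinberg.
Variable S : seq V.
Hypothesis Suniq : uniq S.
Hypothesis SP : forall a, a \in S <-> simple_root Phi a.
Variable om : V -> V.
Hypothesis omP : forall a b, a \in S -> b \in S -> copair (om a) b = (a == b)%:R.
Variables (I : finType) (wd : I -> seq Delta).
Hypothesis wdP : forall u, exists i, dact (wd i) =1 dact u.

Lemma om_lat a : a \in S -> om a \in lat_pred Phi 1.
Proof.
move=> aS; apply/forallP => b; rewrite scale1r; apply: (integral_simple SP) => // [c cS|].
  by rewrite omP // rpred_nat.
exact: valP.
Qed.

Definition om_weight a : P := insubd 0 (om a).
(** For a weight nu with N nu + w^-1 rho dominant and N large, subtracting this sum over the
    descents of w leaves a dominant weight. *)
Definition steinberg_weight i : P := \sum_(a <- S | dact (wd i) a \notin Deltap) om_weight a.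

Lemma copair_steinberg_weight i a : a \in S ->
  copair (steinberg_weight i : V) a = (dact (wd i) a \notin Deltap)%:R.
Proof.
move=> aS; rewrite /steinberg_weight -big_filter.
have : uniq [seq b <- S | dact (wd i) b \notin Deltap] by exact: filter_uniq.
have : {subset [seq b <- S | dact (wd i) b \notin Deltap] <= S} by exact: mem_subseq (filter_subseq _ _).
have -> : (dact (wd i) a \notin Deltap) = (a \in [seq b <- S | dact (wd i) b \notin Deltap]).
  by rewrite mem_filter aS andbT.
elim: [seq b <- S | _] => [|b t IH] sub /=; first by rewrite big_nil copair0.
case/andP => bt tu; rewrite big_cons /= copairD IH //; last by move=> c ct; apply: sub; rewrite inE ct orbT.
have bS : b \in S by apply: sub; exact: mem_head.
rewrite insubdK ?om_lat // omP // inE eq_sym; case: eqP => [->|_] /=; last by rewrite add0r.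
by rewrite (negbTE bt) addr0.
Qed.

Definition steinberg_basis i : P := lat_act (wd i) (steinberg_weight i).

Definition in_span (f : ZP Phi) : Prop := exists2 a : I -> ZP Phi, (forall i, weyl_inv (a i)) &
  f = \sum_i a i * mbasis int (steinberg_basis i : expo P).

Lemma in_spanB f g : in_span f -> in_span g -> in_span (f - g).
Proof.
case=> a ai -> [b bi ->]; exists (fun i => a i - b i) => [i|]; first exact: weyl_invB.
by rewrite -sumrB; apply: eq_bigr => i _; rewrite mulrBl.
Qed.
Lemma in_span0 : in_span 0.
Proof.
exists (fun=> 0) => [i|]; first exact: weyl_inv0.
by rewrite big1 // => i _; rewrite mul0r.
Qed.
Lemma in_span_sum (J : eqType) (r : seq J) (F : J -> ZP Phi) :
  (forall j, j \in r -> in_span (F j)) -> in_span (\sum_(j <- r) F j).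
Proof.
elim: r => [|j r IH] h; first by rewrite big_nil; exact: in_span0.
rewrite big_cons -[\sum_(i <- r) _]opprK; apply: in_spanB; first by apply: h; exact: mem_head.
rewrite -sub0r; apply: in_spanB; first exact: in_span0.
by apply: IH => k kr; apply: h; rewrite inE kr orbT.
Qed.
Lemma in_span_inv (c : ZP Phi) i : weyl_inv c -> in_span (c * mbasis int (steinberg_basis i : expo P)).
Proof.
move=> ci; exists (fun j => if j == i then c else 0) => [j|].
  by case: eqP => _ //; exact: weyl_inv0.
rewrite (bigD1 i) //= eqxx big1 ?addr0 // => j /negbTE ->; exact: mul0r.
Qed.

Definition orbit l : {fset P} := [fset m in [seq lat_act (wd j) l | j <- enum I]]%fset.

Lemma orbitP l m : reflect (exists u, m = lat_act u l) (m \in orbit l).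
Proof.
rewrite in_fset; apply: (iffP mapP) => [[j _ ->]|[u ->]]; first by exists (wd j).
have [j jE] := wdP u; exists j; first by rewrite mem_enum.
by apply: val_inj; rewrite /= !val_lat_act jE.
Qed.

Lemma orbit_sum_inv l : weyl_inv (\sum_(m <- orbit l) mbasis int (m : expo P)).
Proof.
move=> u; rewrite raddf_sum /=.
transitivity (\sum_(m <- map (lat_act u) (orbit l)) mbasis int (m : expo P)).
  by rewrite big_map; apply: eq_bigr => m _; exact: weyl_act_basis.
apply: perm_big; apply: uniq_perm; first by rewrite map_inj_uniq ?fset_uniq //; exact: lat_act_inj.
  exact: fset_uniq.
move=> m; apply/mapP/idP => [[m' /orbitP[v ->] ->]|/orbitP[v ->]].
  by apply/orbitP; exists (u ++ v); rewrite lat_act_cat.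
exists (lat_act (rev u) (lat_act v l)); last by rewrite lat_act_revK.
by apply/orbitP; exists (rev u ++ v); rewrite lat_act_cat.
Qed.

(** In the orbit of y take the element with the largest product with rho; reflecting it in a simple
    root cannot increase this product, which makes it dominant. *)
Lemma dominant_representative y : exists i, dominant Phi (dact (rev (wd i)) y).
Proof.
have [i0 _] := wdP [::]; pose F i := dotv (dact (rev (wd i)) y) (rho Phi).
have [i iP imax] := @Order.TotalTheory.arg_maxP _ _ I i0 predT F isT; exists i.
set z := dact (rev (wd i)) y.
apply: dominant_simple => a sa; have aD := simple_root_in sa.
have [j jE] := wdP (rcons (wd i) [` aD]%fset).
have : F j <= F i by exact: imax.
have -> : F j = dotv (refl a z) (rho Phi).
  congr dotv; apply: (can_inj (dact_revK' (wd j))); rewrite dact_revK jE.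
  by rewrite /dact map_rcons wact_rcons /= refl_involutive ?(simple_neq0 sa) // -/(dact _ _) dact_revK.
rewrite /F -/z /refl dotvBl dotvZl lerBlDr lerDl.
have a0 : 0 < dotv a (rho Phi) by rewrite dotvC; exact: dotv_rho_pos (simple_pos sa).
rewrite pmulr_lge0 // copairE pmulr_lge0 ?pmulr_rge0 //.
by rewrite invr_gt0 dotv_gt0 (simple_neq0 sa).
Qed.

(** Such an N makes N <m, b^vee> outweigh <rho, b^vee> whenever <m, b^vee> is a nonzero integer. *)
Lemma rho_bound : exists N : nat, forall b, b \in Delta -> `|copair (rho Phi) b| < N%:R.
Proof.
exists (Num.bound (\sum_(b : Delta) `|copair (rho Phi) (val b)|)) => b bD.
apply: le_lt_trans (archi_boundP _); last by rewrite sumr_ge0.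
by rewrite (bigD1 [` bD]%fset) //= lerDl sumr_ge0.
Qed.

(* Take w with w^-1 (N m + rho) dominant, N large, and lam = w^-1 m - wt_w.
   Subtracting (sum of the orbit of e^lam) e^(w wt_w) from e^m leaves weights m'
   for which |N m' + rho| is smaller. *)
Theorem steinberg_span m : in_span (mbasis int (m : expo P)).
Proof.
have [N rhoN] := rho_bound; pose y (m : P) : V := N%:R *: (m : V) + rho Phi.
have rhoP b : b \in Deltap -> 0 < copair (rho Phi) b.
  by move=> bp; rewrite copairE divr_gt0 ?mulr_gt0 ?dotv_rho_pos // dotv_gt0 (pos_neq0 bp).
have rhon b : b \in Delta -> b \notin Deltap -> copair (rho Phi) b < 0.
  by move=> bD; rewrite pos_xor // negbK => /rhoP; rewrite copairNr oppr_gt0.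
(* [y m'] is itself a weight, so its square is an integer and the induction can run over a natural
   upper bound. *)
have y_int m' : wform (y m') (y m') \is a Num.int.
  have -> : y m' = (m' *+ N + rho_lat Phi : P).
    have vn k : ((m' *+ k : P) : V) = k%:R *: (m' : V).
      elim: k => [|k IHk]; first by rewrite mulr0n scale0r.
      by rewrite !mulrS scalerDl scale1r -IHk.
    by rewrite /y -vn.
  exact: wform_int.
have [k] : exists k : nat, wform (y m) (y m) < k%:R.
  by exists (Num.bound (wform (y m) (y m))); apply: archi_boundP; exact: wform_ge0.
elim: k m => [|k IH] m; first by rewrite ltNge wform_ge0.
move=> mk; have [i idom] := dominant_representative (y m).
pose w := wd i; pose wt := steinberg_weight i.
pose nu := lat_act (rev w) m; pose lam : P := nu - wt.
(* w^-1 takes [y m] to N lam + p, and the other weights of the product to N (v lam) + p with v in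
   W. *)
pose p : V := N%:R *: (wt : V) + dact (rev w) (rho Phi).
have nuE : (nu : V) = dact (rev w) m by exact: val_lat_act.
have sig a : copair (dact (rev w) (rho Phi)) a = copair (rho Phi) (dact w a).
  by rewrite -(copair_dact w) dact_revK.
(* At a descent of w the contribution of rho is negative, so dominance forces <nu, a^vee> >= 1,
   which the subtracted weight uses up; elsewhere it forces <nu, a^vee> >= 0. *)
have lamdom : dominant Phi lam.
  apply: dominant_simple => a sa; have aS : a \in S by apply/SP.
  have aD := simple_root_in sa; have waD := dact_root w aD.
  have a0 : 0 < dotv a a by rewrite dotv_gt0 (simple_neq0 sa).
  suff : 0 <= copair lam a by rewrite copairE pmulr_lge0 ?invr_gt0 // pmulr_rge0.
  rewrite copairB copair_steinberg_weight // -/w.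
  have := dominant_copair idom (simple_pos sa).
  rewrite /y dactD dactZ copairD copairZ -nuE sig.
  have nuint : copair nu a \is a Num.int by exact: (latP nu [` aD]%fset).
  have N0 : (0 : R) <= N%:R by [].
  rewrite (int_floorK nuint); set c := Num.floor _.
  have := rhoN _ waD; rewrite ltr_norml => /andP[l1 l2].
  case: (boolP (dact w a \in Deltap)) => wap /= H.
    rewrite subr0 ler0z; rewrite leNgt; apply/negP => c0.
    have : c%:~R <= -1 :> R by rewrite -[-1]/((-1)%:~R) ler_int -ltzD1 addNr.
    by move=> c1; nra.
  have := rhon _ waD wap => r0.
  have c0 : 0 < c.
    rewrite ltNge; apply/negP => c0; have : c%:~R <= 0 :> R by rewrite -[0]/(0%:~R) ler_int.
    by move=> c1; nra.
  by rewrite subr_ge0 -[true%:R]/(1%:~R) ler_int -gtz0_ge1.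
(* At a descent the summand N outweighs rho; elsewhere the contribution of rho is positive. *)
have ppos b : b \in Deltap -> 0 < dotv p b.
  have ps a : simple_root Phi a -> 0 < dotv p a.
    move=> sa; have aS : a \in S by apply/SP.
    have aD := simple_root_in sa; have waD := dact_root w aD.
    have a0 : 0 < dotv a a by rewrite dotv_gt0 (simple_neq0 sa).
    suff : 0 < copair p a by rewrite copairE pmulr_lgt0 ?invr_gt0 // pmulr_rgt0.
    rewrite copairD copairZ copair_steinberg_weight // -/w sig.
    have := rhoN _ waD; rewrite ltr_norml => /andP[l1 l2].
    case: (boolP (dact w a \in Deltap)) => wap /=; first by rewrite mulr0 add0r rhoP.
    by rewrite mulr1; lra.
  case/pos_simple_sum => s [s0 sS ->]; rewrite dotv_sumr.
  case: s s0 sS => [//|a s] _ sS; rewrite big_cons ltr_wpDr //; last by apply: ps; apply: sS; exact: mem_head.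
  by rewrite big_seq sumr_ge0 // => c cs; rewrite ltW // ps //; apply: sS; rewrite inE cs orbT.
have mE : m = lat_act w lam + steinberg_basis i.
  by rewrite /steinberg_basis -/w -lat_actD subrK /nu lat_act_revK.
have wo : lat_act w lam \in orbit lam by apply/orbitP; exists w.
have sumE : (\sum_(x <- orbit lam) mbasis int (x : expo P)) * mbasis int (steinberg_basis i : expo P) =
    mbasis int (m : expo P) + \sum_(x <- (orbit lam `\ lat_act w lam)%fset) mbasis int (x + steinberg_basis i : expo P).
  rewrite (big_fsetD1 _ wo) /= mulrDl -mbasisM mulr_suml {1}mE; congr (_ + _).
  by apply: eq_bigr => x _; rewrite -mbasisM.
have -> : mbasis int (m : expo P) = (\sum_(x <- orbit lam) mbasis int (x : expo P)) * mbasis int (steinberg_basis i : expo P) -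
    \sum_(x <- (orbit lam `\ lat_act w lam)%fset) mbasis int (x + steinberg_basis i : expo P).
  by rewrite sumE addrK.
apply: in_spanB; first by apply: in_span_inv; exact: orbit_sum_inv.
apply: in_span_sum => x; rewrite in_fsetD1 => /andP[xw /orbitP[u xE]].
apply: IH; pose v := rev w ++ u; pose del : V := (lam : V) - dact v lam.
have del_cone : cone Phi del.
  have [s ss sE] := wact_simple_word (@map_val_sub v).
  by rewrite /del /dact sE; exact: dominant_cone.
have del0 : del != 0.
  apply: contraNneq xw => /eqP; rewrite subr_eq0 => /eqP E; apply/eqP; apply: val_inj.
  by rewrite xE /= !val_lat_act {2}E /v dact_cat dact_revK.
(* lam and v lam have the same square, so the two sides differ by 2 N (lam - v lam, p), which is
   positive. *)
have lt : wform (y (x + steinberg_basis i)) (y (x + steinberg_basis i)) < wform (y m) (y m).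
  have E1 : dact (rev w) (y (x + steinberg_basis i)) = N%:R *: dact v lam + p.
    have xl : (x : V) = dact u lam by rewrite xE val_lat_act.
    have bl : (steinberg_basis i : V) = dact w wt by exact: val_lat_act.
    have xbl : ((x + steinberg_basis i : P) : V) = dact u lam + dact w wt by rewrite -xl -bl.
    rewrite /y xbl dactD dactZ dactD dact_revK' scalerDr -addrA.
    by rewrite /v dact_cat.
  have E2 : dact (rev w) (y m) = N%:R *: (lam : V) + p.
    by rewrite /y dactD dactZ -nuE /p addrA -scalerDr /= subrK.
  rewrite -(wform_dact (rev w)) -[ltRHS](wform_dact (rev w)) E1 E2.
  have := wform_cone_gt0 ppos del_cone del0; rewrite /del wformBl => g0.
  have g1 : wform (dact v lam) (dact v lam) = wform lam lam by exact: wform_dact.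
  rewrite !wform_sqr g1.
  have N0 : (0 : R) < N%:R.
    have /fset0Pn[b bD] := root_nonempty Phi.
    by apply: le_lt_trans (rhoN b bD).
  by have := mulr_gt0 N0 g0; rewrite mulrBr -/lam; lra.
move: lt mk; rewrite (int_floorK (y_int m)) (int_floorK (y_int _)).
by rewrite !pmulrn !ltr_int; lia.
Qed.

End Steinberg.

End WeylGroup.

(** * The isomorphism *)

Section QuotientLift.
#[local] Transparent to_quot.
Variables (A : pzRingType) (S : set A).

Lemma to_quotP x y : to_quot S x = to_quot S y <-> ideal_gen S (x - y).
Proof.
rewrite /to_quot; split=> [/eqP|xy]; first by rewrite piE => /asboolP.
by apply/eqP; rewrite piE; apply/asboolP.
Qed.

Lemma to_quot_eq0 x : ideal_gen S x -> to_quot S x = 0.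
Proof. by move=> Sx; rewrite -[RHS](raddf0 (to_quot S)); apply/to_quotP; rewrite subr0. Qed.

Lemma to_quot_surj (z : ring_quot S) : exists x, z = to_quot S x.
Proof. by exists (repr z); rewrite /to_quot reprK. Qed.

Variables (B : pzRingType) (f : {rmorphism A -> B}).
Hypothesis fS : forall x, S x -> f x = 0.

Lemma ideal_gen_ker x : ideal_gen S x -> f x = 0.
Proof.
move=> Ix; apply: (Ix [set y | f y = 0]%classic); split; last exact: fS.
split=> [|y z /= fy fz|a y b /= fy]; first exact: rmorph0.
  by rewrite rmorphB fy fz subrr.
by rewrite !rmorphM fy mulr0 mul0r.
Qed.

Lemma quot_lift : exists g : {rmorphism ring_quot S -> B}, forall x, g (to_quot S x) = f x.
Proof.
pose g (z : ring_quot S) : B := f (repr z).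
have gE x : g (to_quot S x) = f x.
  apply/eqP; rewrite -subr_eq0 -rmorphB; apply/eqP; apply: ideal_gen_ker.
  by apply/to_quotP; rewrite {1}/to_quot reprK.
have gB : zmod_morphism g.
  move=> z w; have [x ->] := to_quot_surj z; have [y ->] := to_quot_surj w.
  by rewrite -raddfB !gE rmorphB.
have gM : monoid_morphism g.
  split=> [|z w]; first by rewrite -(rmorph1 (to_quot S)) gE rmorph1.
  have [x ->] := to_quot_surj z; have [y ->] := to_quot_surj w.
  by rewrite -rmorphM !gE rmorphM.
pose g1 := GRing.isZmodMorphism.Build _ _ g gB.
pose g2 := GRing.isMonoidMorphism.Build _ _ g gM.
pose gg : {rmorphism ring_quot S -> B} := HB.pack g g1 g2.
by exists gg.
Qed.

End QuotientLift.

Section TensorLift.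
Variables (S B A : pzRingType) (D : set S) (f : S -> B) (g : S -> A).
Local Notation tens := (@tens S B A D f g).
Local Notation pure b a := (mbasis int ((b, a) : mulpair B A)).

Lemma tens_rel x : tensor_rel D f g x -> to_quot (tensor_rel D f g) x = 0.
Proof. by move=> xr; apply: to_quot_eq0 => I [_]; apply. Qed.

Lemma tensE b a : tens b a = to_quot _ (pure b a).
Proof. by []. Qed.

Lemma tensDl b b' a : tens (b + b') a = tens b a + tens b' a.
Proof.
apply/eqP; rewrite -subr_eq0 opprD addrA !tensE -!raddfB /=; apply/eqP.
by apply: tens_rel; exact: tensor_rel_addl.
Qed.
Lemma tensDr b a a' : tens b (a + a') = tens b a + tens b a'.
Proof.
apply/eqP; rewrite -subr_eq0 opprD addrA !tensE -!raddfB /=; apply/eqP.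
by apply: tens_rel; exact: tensor_rel_addr.
Qed.
Lemma tens_balanced s b a : D s -> tens (b * f s) a = tens b (g s * a).
Proof.
move=> Ds; apply/eqP; rewrite -subr_eq0 !tensE -!raddfB /=; apply/eqP.
by apply: tens_rel; exact: tensor_rel_balanced.
Qed.
Lemma tensM b a b' a' : tens b a * tens b' a' = tens (b * b') (a * a').
Proof. by rewrite !tensE -rmorphM -mbasisM. Qed.
Lemma tens11 : tens 1 1 = 1.
Proof. by rewrite tensE -(rmorph1 (to_quot (tensor_rel D f g))). Qed.

Lemma tensl_is_zmod : zmod_morphism (fun b => tens b 1).
Proof.
move=> b b'; have h : tens 0 1 = 0 by apply: (addrI (tens 0 1)); rewrite -tensDl !addr0.
have hN : tens (- b') 1 = - tens b' 1.
  by apply/eqP; rewrite -addr_eq0 -tensDl addNr h.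
by rewrite tensDl hN.
Qed.
Lemma tensl_is_monoid : monoid_morphism (fun b => tens b 1).
Proof. by split=> [|b b']; rewrite ?tens11 // tensM mulr1. Qed.
Lemma tensr_is_zmod : zmod_morphism (fun a => tens 1 a).
Proof.
move=> a a'; have h : tens 1 0 = 0 by apply: (addrI (tens 1 0)); rewrite -tensDr !addr0.
have hN : tens 1 (- a') = - tens 1 a'.
  by apply/eqP; rewrite -addr_eq0 -tensDr addNr h.
by rewrite tensDr hN.
Qed.
Lemma tensr_is_monoid : monoid_morphism (fun a => tens 1 a).
Proof. by split=> [|a a']; rewrite ?tens11 // tensM mulr1. Qed.

Variables (T : comNzRingType) (u : {rmorphism B -> T}) (v : {rmorphism A -> T}).
Hypothesis uv : forall s, D s -> u (f s) = v (g s).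

Lemma tensor_lift : exists w : {rmorphism tensor D f g -> T}, forall b a, w (tens b a) = u b * v a.
Proof.
pose F (p : mulpair B A) : T := u p.1 * v p.2.
pose G := mextend (intmul 1) F.
have GE b a : G (pure b a) = u b * v a by rewrite /G mextend_basis.
have GM : monoid_morphism G.
  split; first by rewrite /G mextend1 // /F !rmorph1 mulr1.
  apply: mextendM => [p q|c p]; last by rewrite mulrC.
  by rewrite /F /= !rmorphM mulrACA.
pose G1 := GRing.isMonoidMorphism.Build _ _ G GM.
pose GG : {rmorphism monalg int (mulpair B A) -> T} := HB.pack G G1.
have Grel x : tensor_rel D f g x -> GG x = 0.
  case=> {x} [b b' a|b a a'|s b a Ds]; rewrite !(raddfB GG) /= !GE.
  - by rewrite (rmorphD u) mulrDl -addrA -opprD subrr.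
  - by rewrite (rmorphD v) mulrDr -addrA -opprD subrr.
  by rewrite !rmorphM uv // mulrA subrr.
have [w wE] := quot_lift Grel; exists w => b a.
by rewrite -GE -[RHS](wE (pure b a)).
Qed.

End TensorLift.

(** * Regular elements in group algebras of torsion-free groups *)

Section GroupAlgebraRegular.
Variables (k : comNzRingType) (L : zmodType).
Local Notation A := (monalg k (expo L)).

Lemma monalg_expo_mulC : commutative (@GRing.mul A).
Proof.
move=> f g; elim/monalg_ind: f => [|f1 f2 H1 H2|x c]; first by rewrite mul0r mulr0.
  by rewrite mulrDl mulrDr H1 H2.
elim/monalg_ind: g => [|f1 f2 H1 H2|y d]; first by rewrite mul0r mulr0.
  by rewrite mulrDl mulrDr H1 H2.
by rewrite !mtermM mulrC; congr mterm; exact: addrC.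
Qed.
HB.instance Definition _ := GRing.PzRing_hasCommutativeMul.Build A monalg_expo_mulC.

Lemma mcoef_basisM (a x : expo L) (f : A) : mcoef x (mbasis k a * f) = mcoef ((x : L) - (a : L) : expo L) f.
Proof.
elim/monalg_ind: f => [|f1 f2 H1 H2|y c]; first by rewrite mulr0 !raddf0.
  by rewrite mulrDr !raddfD /= H1 H2.
rewrite mtermM mul1r !mcoef_term; congr (_ *+ nat_of_bool _).
by rewrite [RHS]eq_sym subr_eq [RHS]eq_sym addrC.
Qed.

Hypothesis L_torsion_free : forall (l : L) n, l *+ n.+1 = 0 -> l = 0.

(** If X^a - X^b kills f, the coefficients of f are constant along progressions with difference a -
    b, which are infinite as there is no torsion; but f has finite support. *)
Lemma basis_sub_regular (a b : expo L) : a != b -> GRing.lreg (mbasis k a - mbasis k b : A).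
Proof.
move=> ab; apply: mulrI0_lreg => f E; apply: monalgP => x; rewrite raddf0; apply/eqP; apply: contraT => fx.
pose c : L := (a : L) - (b : L).
have step y : mcoef (y : expo L) f = mcoef ((y : L) + c : expo L) f.
  have := congr1 (mcoef ((y : L) + a : expo L)) E.
  rewrite mulrBl raddfB raddf0 /= !mcoef_basisM => /eqP; rewrite subr_eq0 => /eqP.
  by rewrite addrK /c addrA.
pose t (n : nat) : expo L := (x : L) + c *+ n.
have tf n : t n \in msupp f.
  rewrite -mcoef_neq0; elim: n => [|n IH]; first by rewrite /t mulr0n addr0.
  by rewrite /t mulrSr addrA -step.
have t_inj : injective t.
  have H m n : t (m + n)%N = t m -> n = 0%N.
    move=> /addrI; rewrite mulrnDr -[RHS]addr0 => /addrI; case: n => // n /L_torsion_free/eqP.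
    by rewrite subr_eq0 (negbTE ab).
  move=> m n; case: (leqP m n) => [|/ltnW] mn tmn.
    by move: tmn (H m (n - m)%N); rewrite subnKC // => -> /(_ erefl); lia.
  by move: tmn (H n (m - n)%N); rewrite subnKC // => -> /(_ erefl); lia.
have : (size (map t (iota 0 #|` msupp f|.+1)) <= size (msupp f))%N.
  apply: uniq_leq_size; first by rewrite map_inj_uniq ?iota_uniq.
  by move=> y /mapP[n _ ->].
by rewrite size_map size_iota ltnn.
Qed.

End GroupAlgebraRegular.

Lemma lreg_prod (Q : pzRingType) (I : Type) (s : seq I) (P : pred I) (F : I -> Q) :
  (forall i, P i -> GRing.lreg (F i)) -> GRing.lreg (\prod_(i <- s | P i) F i).
Proof. by move=> h; elim/big_ind: _ => //; [exact: lreg1|exact: lregM]. Qed.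

(* Q need not be a domain: apply the adjugate of A, then multiply by det C. *)
Lemma vandermonde_kernel (Q : comNzRingType) (n : nat) (a : 'rV[Q]_n) (A C : 'M[Q]_n) (r : 'cV[Q]_n) :
  (forall i j : 'I_n, i != j -> GRing.lreg (a 0 i - a 0 j)) ->
  (A *m C)^T = Vandermonde n a -> A *m r = 0 -> r = 0.
Proof.
move=> areg AC Ar; have : \det A *: r = 0.
  by rewrite -mul_scalar_mx -mul_adj_mx -mulmxA Ar mulmx0.
move=> /(congr1 (GRing.scale (\det C))); rewrite scaler0 scalerA mulrC -det_mulmx -det_tr AC det_Vandermonde.
move=> E; apply/matrixP => i j; have := congr1 (fun M : 'cV_n => M i j) E; rewrite !mxE.
have lregp : GRing.lreg (\prod_(i < n) \prod_(j < n | (i < j)%N) (a 0 j - a 0 i)).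
  apply: lreg_prod => i' _; apply: lreg_prod => j' ij; apply: areg.
  by rewrite -(inj_eq val_inj) /= gtn_eqF.
by rewrite -[X in _ = X](mulr0 (\prod_(i < n) \prod_(j < n | (i < j)%N) (a 0 j - a 0 i))) => /lregp.
Qed.

Section RingMorphisms.
Lemma raddf_mextend_int (M : monoidType) (B C : pzRingType) (F : {additive B -> C}) (g : M -> B) (f : monalg int M) :
  F (mextend (intmul 1) g f) = mextend (intmul 1) (fun l => F (g l)) f.
Proof.
elim/monalg_ind: f => [|f1 f2 H1 H2|l c].
- by rewrite !raddf0.
- by rewrite !raddfD /= H1 H2.
by rewrite !mextend_term !mulrzl raddfMz.
Qed.

Section Conjugation.
Variables (A B : pzRingType) (f : {rmorphism A -> B}) (a b : A).
Hypotheses (ab : a * b = 1) (ba : b * a = 1).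
Lemma conj_is_zmod : zmod_morphism (fun z => f (a * z * b)).
Proof. by move=> x y; rewrite mulrBr mulrBl rmorphB. Qed.
Lemma conj_is_monoid : monoid_morphism (fun z => f (a * z * b)).
Proof.
split=> [|x y]; first by rewrite mulr1 ab rmorph1.
by rewrite -rmorphM -!mulrA (mulrA b a) ba mul1r.
Qed.
Lemma conj_sum u v : f (a * (u + v) * b) = f a * (f u + f v) * f b.
Proof. by rewrite !rmorphM rmorphD. Qed.
Lemma conj_eq0 z : f z = 0 -> f (a * z * b) = 0.
Proof. by move=> z0; rewrite !rmorphM z0 mulr0 mul0r. Qed.
Lemma conj_comm z : a * z = z * a -> f (a * z * b) = f z.
Proof. by move=> ->; rewrite -mulrA ab mulr1. Qed.
End Conjugation.
End RingMorphisms.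

(** * Conjugation by X^(rho/h) and the specializations *)

Section Characters.
Variables (R : realType) (d : nat) (Phi : root_datum R d) (h : nat).
Variables (RT : comNzRingType) (iota : {rmorphism ZP Phi -> RT}).
Local Notation P := (lat Phi 1).
Local Notation P' := (lat Phi h).
Local Notation ZPT := (monalg rat (smash_monoid Phi h)).
Local Notation BT := (BT h iota).
Local Notation BP := (BP Phi h).
Local Notation relBP := (TVW_to_ZPT h @` nichols_rel (@VW_braiding R d Phi))%classic.
Local Notation QP := (monalg rat (expo P')).

Lemma RT_to_BT_is_zmod : zmod_morphism (RT_to_BT h iota).
Proof. exact: tensl_is_zmod. Qed.
HB.instance Definition _ := GRing.isZmodMorphism.Build RT BT (RT_to_BT h iota) RT_to_BT_is_zmod.
Lemma RT_to_BT_is_monoid : monoid_morphism (RT_to_BT h iota).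
Proof. exact: tensl_is_monoid. Qed.
HB.instance Definition _ := GRing.isMonoidMorphism.Build RT BT (RT_to_BT h iota) RT_to_BT_is_monoid.
Lemma BP_to_BT_is_zmod : zmod_morphism (BP_to_BT iota : BP -> BT).
Proof. exact: tensr_is_zmod. Qed.
HB.instance Definition _ := GRing.isZmodMorphism.Build BP BT (BP_to_BT iota) BP_to_BT_is_zmod.
Lemma BP_to_BT_is_monoid : monoid_morphism (BP_to_BT iota : BP -> BT).
Proof. exact: tensr_is_monoid. Qed.
HB.instance Definition _ := GRing.isMonoidMorphism.Build BP BT (BP_to_BT iota) BP_to_BT_is_monoid.

Lemma RT_BP_comm r (x : BP) : RT_to_BT h iota r * BP_to_BT iota x = BP_to_BT iota x * RT_to_BT h iota r.
Proof. by rewrite [LHS]tensM [RHS]tensM !mul1r !mulr1. Qed.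

Definition ZPT_to_BT : {rmorphism ZPT -> BT} := BP_to_BT iota \o to_quot relBP.

Let r := lat_div h (rho_lat Phi).

Lemma ZX_inv (l : P') : ZX l * ZX (- l) = 1 :> ZPT.
Proof. by rewrite -ZXD subrr ZX0. Qed.
Lemma ZX_inv' (l : P') : ZX (- l) * ZX l = 1 :> ZPT.
Proof. by rewrite -ZXD addNr ZX0. Qed.

(** The inner factors X^(rho/h) cancel in a product of [H_elt], so the product along a path is
    conjugated once, as a whole. *)
Definition conj_rho (z : ZPT) : BT := ZPT_to_BT (ZX r * z * ZX (- r)).
Lemma conj_rho_is_zmod : zmod_morphism conj_rho.
Proof. exact: conj_is_zmod. Qed.
HB.instance Definition _ := GRing.isZmodMorphism.Build ZPT BT conj_rho conj_rho_is_zmod.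
Lemma conj_rho_is_monoid : monoid_morphism conj_rho.
Proof. by apply: conj_is_monoid; [exact: ZX_inv|exact: ZX_inv']. Qed.
HB.instance Definition _ := GRing.isMonoidMorphism.Build ZPT BT conj_rho conj_rho_is_monoid.

Lemma conj_rho_ZX l : conj_rho (ZX l) = BP_to_BT iota (BP_X l).
Proof.
apply: (@conj_comm _ _ ZPT_to_BT (ZX r) (ZX (- r)) (ZX_inv r) (ZX l)).
by rewrite -!ZXD addrC.
Qed.

Lemma H_eltE b : H_elt h iota b = conj_rho (Hroot h b).
Proof.
rewrite /conj_rho /ZPT_to_BT /= (@conj_sum _ _ (to_quot relBP)).
by rewrite /H_elt.
Qed.

Lemma conj_rho_killed z : killed z -> conj_rho z = 0.
Proof.
move=> kz; have z0 : to_quot relBP z = 0 by apply: to_quot_eq0; exact: killed_nichols.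
apply: (@conj_eq0 _ _ ZPT_to_BT); rewrite /ZPT_to_BT /= z0.
exact: (raddf0 (BP_to_BT iota)).
Qed.

Lemma conj_rho_killedB z w : killed (z - w) -> conj_rho z = conj_rho w.
Proof. by move=> /conj_rho_killed; rewrite raddfB => /eqP; rewrite subr_eq0 => /eqP. Qed.

Lemma prod_H_elt s : \prod_(b <- rev s) H_elt h iota b = conj_rho (chain_prod h s).
Proof. by rewrite /chain_prod rmorph_prod; apply: eq_bigr => b _; exact: H_eltE. Qed.

Lemma conj_rho_comm t z : RT_to_BT h iota t * conj_rho z = conj_rho z * RT_to_BT h iota t.
Proof. exact: RT_BP_comm. Qed.

Definition QP_act u : QP -> QP := mextend (@mconst rat (expo P')) (fun l : expo P' => mbasis rat (lat_act u l : expo P')).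
Definition ZP_to_QP : ZP Phi -> QP := mextend (intmul 1) (fun l : expo P => mbasis rat (lat_incl h l : expo P')).

Lemma QP_act_is_zmod u : zmod_morphism (QP_act u).
Proof. by move=> f g; rewrite /QP_act raddfB. Qed.
HB.instance Definition _ u := GRing.isZmodMorphism.Build QP QP (QP_act u) (QP_act_is_zmod u).
Lemma QP_act_is_monoid u : monoid_morphism (QP_act u).
Proof.
split; first by rewrite /QP_act mextend1 // -mbasis1 lat_act0.
apply: mextendM => [l m|c l]; last exact: mconst_comm.
by rewrite -mbasisM; congr (mbasis _ _); exact: lat_actD.
Qed.
HB.instance Definition _ u := GRing.isMonoidMorphism.Build QP QP (QP_act u) (QP_act_is_monoid u).
Lemma QP_act_basis u l : QP_act u (mbasis rat (l : expo P')) = mbasis rat (lat_act u l : expo P').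
Proof. by rewrite /QP_act mextend_basis. Qed.

Lemma lat_inclD (l m : P) : lat_incl h (l + m) = lat_incl h l + lat_incl h m.
Proof. exact: val_inj. Qed.
Lemma lat_incl0 : lat_incl h (0 : P) = 0.
Proof. exact: val_inj. Qed.
Lemma lat_incl_act u (l : P) : lat_incl h (lat_act u l) = lat_act u (lat_incl h l).
Proof. by apply: val_inj; rewrite /= !val_lat_act. Qed.
Lemma lat_incl_inj : injective (@lat_incl R d Phi h).
Proof. by move=> l m /(congr1 val) lm; exact: val_inj. Qed.

Lemma ZP_to_QP_is_zmod : zmod_morphism ZP_to_QP.
Proof. by move=> f g; rewrite /ZP_to_QP raddfB. Qed.
HB.instance Definition _ := GRing.isZmodMorphism.Build (ZP Phi) QP ZP_to_QP ZP_to_QP_is_zmod.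
Lemma ZP_to_QP_is_monoid : monoid_morphism ZP_to_QP.
Proof.
split; first by apply: mextend1; exact: (etrans (congr1 (fun l : expo P' => mbasis rat l) lat_incl0) (mbasis1 _ _)).
apply: mextendM => [l m|c l]; first by rewrite -mbasisM lat_inclD.
by rewrite mulrzl mulrzr.
Qed.
HB.instance Definition _ := GRing.isMonoidMorphism.Build (ZP Phi) QP ZP_to_QP ZP_to_QP_is_monoid.
Lemma ZP_to_QP_basis l : ZP_to_QP (mbasis int (l : expo P)) = mbasis rat (lat_incl h l : expo P').
Proof. by rewrite /ZP_to_QP mextend_basis. Qed.

Lemma mcoef_ZP_to_QP l f : mcoef (lat_incl h l : expo P') (ZP_to_QP f) = (mcoef (l : expo P) f)%:~R.
Proof.
elim/monalg_ind: f => [|f1 f2 H1 H2|m c]; first by rewrite !raddf0.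
  by rewrite (raddfD ZP_to_QP) /= (raddfD (mcoef _)) /= H1 H2 (raddfD (mcoef (l : expo P))) /= intrD.
rewrite /ZP_to_QP mextend_term mulrzl raddfMz /= mbasisE !mcoef_term.
rewrite (inj_eq lat_incl_inj).
by case: eqP => _; rewrite ?mulr1n ?mulr0n ?mul0rz.
Qed.

Lemma ZP_to_QP_inj : injective ZP_to_QP.
Proof.
move=> f g fg; apply: monalgP => l; apply/eqP; rewrite -(eqr_int rat).
by rewrite -!mcoef_ZP_to_QP fg.
Qed.

Lemma QP_act_inv u f : weyl_inv f -> QP_act u (ZP_to_QP f) = ZP_to_QP f.
Proof.
move=> fi; rewrite -{2}(fi u) /ZP_to_QP mextend_weyl (raddf_mextend_int (QP_act u)).
by apply: mextend_eq => // l; rewrite [LHS]QP_act_basis -lat_incl_act.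
Qed.

Section Specialization.
Variable iotaV : RT -> ZP Phi.
Hypothesis iotaK : cancel iota iotaV.
Hypothesis iotaVK : cancel iotaV iota.

(** R(T) is sent through the inverse of iota without twist, B(V_W)<P'> through the degree 0 part
    twisted by u. The two agree over Z[P]^W because u fixes invariants, so they combine on the
    balanced tensor product. *)
Lemma specialization u : exists w : {rmorphism BT -> QP},
  (forall t, w (RT_to_BT h iota t) = ZP_to_QP (iotaV t)) /\
  (forall z, w (ZPT_to_BT z) = QP_act u (degree0 z)).
Proof.
have iV1 : zmod_morphism iotaV.
  by move=> x y; apply: (can_inj iotaK); rewrite rmorphB !iotaVK.
have iV2 : monoid_morphism iotaV.
  by split=> [|x y]; apply: (can_inj iotaK); rewrite ?rmorph1 ?rmorphM !iotaVK.
pose m1 := GRing.isZmodMorphism.Build _ _ iotaV iV1.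
pose m2 := GRing.isMonoidMorphism.Build _ _ iotaV iV2.
pose iV : {rmorphism RT -> ZP Phi} := HB.pack iotaV m1 m2.
have [d0 d0E] : exists g : {rmorphism BP -> QP}, forall x, g (to_quot relBP x) = degree0 x.
  apply: (quot_lift (f := @degree0 R d Phi h)) => x Sx.
  by apply: degree0_nichols => I [_]; apply.
pose a1 : {rmorphism RT -> QP} := ZP_to_QP \o iV.
pose a2 : {rmorphism BP -> QP} := QP_act u \o d0.
have [w wE] : exists w : {rmorphism BT -> QP}, forall b a, w (tens _ _ _ b a) = a1 b * a2 a.
  apply: tensor_lift => f fi; rewrite /= iotaK.
  have -> : d0 (ZP_to_BP h f) = ZP_to_QP f.
    rewrite /ZP_to_BP (raddf_mextend_int d0); apply: mextend_eq => // l.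
    by rewrite -degree0_ZX -d0E.
  by rewrite QP_act_inv.
exists w; split=> [t|z]; first by rewrite [LHS]wE (rmorph1 a2) mulr1.
by rewrite [LHS]wE (rmorph1 a1) mul1r /a2 /= d0E.
Qed.

End Specialization.

End Characters.

Lemma vandermonde_kernel_fin (Q : comNzRingType) (I : finType) (a : I -> Q) (A : I -> I -> Q)
    (C : nat -> I -> Q) (r : I -> Q) :
  (forall i j, i != j -> GRing.lreg (a i - a j)) ->
  (forall j k, \sum_i A j i * C k i = a j ^+ k) ->
  (forall j, \sum_i A j i * r i = 0) -> forall i, r i = 0.
Proof.
move=> areg AC Ar i.
have E (F : I -> Q) : \sum_(i < #|I|) F (enum_val i) = \sum_i F i.
  rewrite (reindex (@enum_rank I)) /=; last by apply: onW_bij; exact: enum_rank_bij.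
  by apply: eq_bigr => j _; rewrite enum_rankK.
have := @vandermonde_kernel Q #|I| (\row_j a (enum_val j))
  (\matrix_(j, i) A (enum_val j) (enum_val i)) (\matrix_(i, k) C k (enum_val i))
  (\col_i r (enum_val i)).
move=> H; have : \col_i r (enum_val i) = 0 :> 'cV_#|I|.
  apply: H => [i1 i2 i12||].
  - by rewrite !mxE; apply: areg; rewrite (inj_eq enum_val_inj).
  - apply/matrixP => k j; rewrite !mxE -AC -E; apply: eq_bigr => i' _; by rewrite !mxE.
  apply/matrixP => j k; rewrite mxE [RHS]mxE; transitivity (\sum_i A (enum_val j) i * r i); last exact: Ar.
  by rewrite -E; apply: eq_bigr => i' _; rewrite !mxE.
by move=> /matrixP/(_ (enum_rank i) 0); rewrite !mxE enum_rankK.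
Qed.

Lemma subring_setT_sum (A : pzRingType) (B : set A) (I : Type) (s : seq I) (F : I -> A) :
  subring_set B -> (forall i, B (F i)) -> B (\sum_(i <- s) F i).
Proof.
case=> B1 BB BM h; have B0 : B 0 by rewrite -(subrr 1); exact: BB.
elim: s => [|i s IH]; first by rewrite big_nil.
by rewrite big_cons -[\sum_(j <- s) _]opprK; apply: (BB) => //; rewrite -sub0r; exact: BB.
Qed.

(** * The homomorphism from the K-ring and its injectivity *)

Section Assembly.
Variables (R : realType) (d : nat) (Phi : root_datum R d) (h : nat).
Variables (RT : comNzRingType) (iota : {rmorphism ZP Phi -> RT}).
Local Notation V := 'rV[R]_d.
Local Notation P := (lat Phi 1).
Local Notation P' := (lat Phi h).
Local Notation BT := (BT h iota).
Local Notation KT := (KT iota).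
Local Notation QP := (monalg rat (expo P')).
Local Notation RTP := (monalg RT (expo P)).

Lemma lat_torsion_free (l : P') n : l *+ n.+1 = 0 -> l = 0.
Proof.
have vn k : ((l *+ k : P') : V) = k%:R *: (l : V).
  elim: k => [|k IHk]; first by rewrite mulr0n scale0r.
  by rewrite !mulrS scalerDl scale1r -IHk.
move=> /(congr1 val) /=; rewrite vn => /eqP; rewrite scaler_eq0 pnatr_eq0 /= => /eqP l0.
exact: val_inj.
Qed.

Lemma mbasis_muln (k : nzRingType) (L : zmodType) (l : L) n :
  mbasis k (l *+ n : expo L) = mbasis k (l : expo L) ^+ n.
Proof. by elim: n => [|n IH]; rewrite ?expr0 ?mbasis1 // exprS mulrS -IH -mbasisM. Qed.

Section Basis.
Variables (I : finType) (wd : I -> seq (Delta Phi)) (e : I -> P).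
Hypothesis span : forall m : P, exists2 a : I -> ZP Phi, (forall i, weyl_inv (a i)) &
  mbasis int (m : expo P) = \sum_i a i * mbasis int (e i : expo P).
Hypothesis wd_inj : forall i j, dact (wd i) =1 dact (wd j) -> i = j.

(** The powers of X^rho expand with invariant coefficients, which u does not change, so one
    coefficient matrix serves all rows of the factorization. The nodes X^(u rho) are distinct
    because only the identity of W fixes rho. *)
Lemma steinberg_kernel (r : I -> QP) :
  (forall j, \sum_i mbasis rat (lat_act (wd j) (lat_incl h (e i)) : expo P') * r i = 0) -> forall i, r i = 0.
Proof.
have /choice[c cP] : forall k : nat, exists a : I -> ZP Phi, (forall i, weyl_inv (a i)) /\
    mbasis int (rho_lat Phi *+ k : expo P) = \sum_i a i * mbasis int (e i : expo P).
  by move=> k; have [a ai aE] := span (rho_lat Phi *+ k); exists a.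
apply: (@vandermonde_kernel_fin _ I (fun j => mbasis rat (lat_act (wd j) (lat_incl h (rho_lat Phi)) : expo P'))
  _ (fun k i => @ZP_to_QP R d Phi h (c k i))) => [i j ij|j k].
  apply: basis_sub_regular; first by move=> l n; exact: lat_torsion_free.
  apply: contra ij => /eqP /(congr1 val); rewrite /= !val_lat_act => E; apply/eqP; apply: wd_inj.
  exact: dact_rho_inj.
have [ci cE] := cP k; rewrite -mbasis_muln.
have := congr1 (fun f => QP_act (wd j) (@ZP_to_QP R d Phi h f)) cE.
rewrite ZP_to_QP_basis QP_act_basis => E.
transitivity (QP_act (wd j) (@ZP_to_QP R d Phi h (\sum_i c k i * mbasis int (e i : expo P)))).
  rewrite (raddf_sum (@ZP_to_QP R d Phi h)) (raddf_sum (QP_act (wd j))) /=; apply: eq_bigr => i _.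
  rewrite mulrC (rmorphM (@ZP_to_QP R d Phi h)) (rmorphM (QP_act (wd j))) /= QP_act_inv //.
  by rewrite ZP_to_QP_basis QP_act_basis.
rewrite -E; congr (mbasis rat _); apply: val_inj.
elim: (k) => [|k' IH]; first by rewrite !mulr0n lat_incl0 lat_act0.
by rewrite !mulrS lat_inclD lat_actD /= IH.
Qed.

(** In R(T)[P]/J the invariant coefficients of an expansion become scalars of R(T). *)
Lemma KT_span (z : KT) : exists r : I -> RT,
  z = \sum_i RT_to_KT iota (r i) * to_quot _ (mbasis RT (e i : expo P)).
Proof.
have [f ->] := to_quot_surj z; elim/monalg_ind: f => [|f1 f2 [r1 E1] [r2 E2]|m c].
- exists (fun=> 0); rewrite (raddf0 (to_quot _)) big1 // => i _.
  by rewrite /RT_to_KT (raddf0 (@mconst RT (expo P))) (raddf0 (to_quot _)) mul0r.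
- exists (fun i => r1 i + r2 i); rewrite (raddfD (to_quot _)) /= E1 E2 -big_split.
  apply: eq_bigr => i _ /=.
  by rewrite /RT_to_KT (raddfD (@mconst RT (expo P))) (raddfD (to_quot _)) /= mulrDl.
have [a ai aE] := span m; exists (fun i => c * iota (a i)).
pose J : ZP Phi -> RTP := mextend (intmul 1) (fun l : expo P => mbasis RT l).
have JM : {morph J : f g / f * g}.
  by apply: mextendM => [l l'|n l]; [exact: mbasisM|rewrite mulrzl mulrzr].
have JE l : J (mbasis int (l : expo P)) = mbasis RT (l : expo P) by exact: mextend_basis.
have JS : J (\sum_i a i * mbasis int (e i : expo P)) = \sum_i J (a i * mbasis int (e i : expo P)).
  exact: raddf_sum.
rewrite mterm_const -JE aE JS mulr_sumr (raddf_sum (to_quot _)) /=.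
apply: eq_bigr => i _; rewrite -/J JM JE mulrA !(rmorphM (to_quot _)) /=; congr (_ * _).
rewrite /RT_to_KT (rmorphM (@mconst RT (expo P))) (rmorphM (to_quot _)) /=; congr (_ * _).
apply/to_quotP => B [_]; apply; by exists (a i).
Qed.

End Basis.

Section Characters.
Variables (x : V) (s : P -> seq (Delta Phi)).
Hypothesis sP : forall l, apath x (s l) (x - (l : V)).
Hypothesis rootsum : forall l : P, \sum_(b : Deltap Phi) copair (l : V) (val b) *: val b = h%:R *: (l : V).
Hypothesis h_gt0 : (0 < h)%N.
Variable Xi : P -> BT.
Hypothesis XiE : forall l, Xi l = conj_rho iota (chain_prod h (s l)).

Lemma Xi_add l m : Xi (l + m) = Xi l * Xi m.
Proof.
rewrite !XiE -(rmorphM (conj_rho iota)); apply/esym/conj_rho_killedB.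
exact: chain_prod_add.
Qed.

Lemma Xi0 : Xi 0 = 1.
Proof.
rewrite XiE -(rmorph1 (conj_rho iota)); apply: conj_rho_killedB.
rewrite -chain_prod_nil; apply: (@chain_prod_path_indep _ _ _ _ x (x - (0 : P))); first exact: sP.
have [xr _] := apath_regular (sP 0); rewrite /= subr0.
exact: same_alcove_refl.
Qed.

Lemma BP_to_BT_ZP f : mextend (intmul 1) (fun l : expo P => conj_rho iota (ZX (lat_incl h l))) f =
  BP_to_BT iota (ZP_to_BP h f).
Proof.
have E : (fun l : expo P => conj_rho iota (ZX (lat_incl h l))) = (fun l : expo P => BP_to_BT iota (BP_X (lat_incl h l))).
  by apply/funext => l; exact: conj_rho_ZX.
rewrite E; exact: esym (raddf_mextend_int (BP_to_BT iota) _ f).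
Qed.

Lemma KT_map : exists phi : {rmorphism KT -> BT},
  forall f, phi (to_quot _ f) = mextend (RT_to_BT h iota) (fun l : expo P => Xi l) f.
Proof.
pose F : RTP -> BT := mextend (RT_to_BT h iota) (fun l : expo P => Xi l).
have FB : zmod_morphism F by move=> f g; exact: raddfB.
have FM : monoid_morphism F.
  split; first by apply: mextend1; exact: Xi0.
  apply: mextendM => [l m|c l]; first exact: Xi_add.
  by rewrite XiE; exact: conj_rho_comm.
pose F1 := GRing.isZmodMorphism.Build _ _ F FB.
pose F2 := GRing.isMonoidMorphism.Build _ _ F FM.
pose FF : {rmorphism RTP -> BT} := HB.pack F F1 F2.
apply: (quot_lift (f := FF)) => _ [f fi <-].
have E1 : F (mextend (intmul 1) (fun l : expo P => mbasis RT l) f) =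
    mextend (intmul 1) (fun l : expo P => F (mbasis RT l)) f by exact: (raddf_mextend_int FF).
transitivity (F (mextend (intmul 1) (fun l : expo P => mbasis RT l) f) - F (mconst (expo P) (iota f))).
  exact: raddfB.
rewrite E1.
have -> : F (mconst (expo P) (iota f)) = RT_to_BT h iota (iota f).
  by rewrite mconstE /F mextend_term -[Xi _]/(Xi 0) Xi0 mulr1.
(* For invariant f the combination of products equals f itself in B(V_W)<P'>, and balancing over
   Z[P]^W moves it to the factor R(T). *)
have -> : mextend (intmul 1) (fun l : expo P => F (mbasis RT l)) f = RT_to_BT h iota (iota f).
  transitivity (conj_rho iota (chain_map h s f)).
    rewrite /chain_map (raddf_mextend_int (conj_rho iota)); apply: mextend_eq => // l.
    by rewrite /F mextend_basis XiE.
  rewrite (conj_rho_killedB iota (chain_map_inv sP rootsum h_gt0 fi)).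
  rewrite (raddf_mextend_int (conj_rho iota)).
  transitivity (BP_to_BT iota (ZP_to_BP h f)).
    exact: BP_to_BT_ZP.
  rewrite /BP_to_BT /RT_to_BT -[ZP_to_BP h f]mulr1 -tens_balanced //.
  by rewrite mul1r.
by rewrite subrr.
Qed.

(** The target is commutative, so the conjugating factors X^(rho/h) cancel there. *)
Lemma specialization_Xi (iotaV : RT -> ZP Phi) u :
  cancel iota iotaV -> cancel iotaV iota -> exists w : {rmorphism BT -> QP},
  (forall t, w (RT_to_BT h iota t) = @ZP_to_QP R d Phi h (iotaV t)) /\
  (forall l, w (Xi l) = mbasis rat (lat_act u (lat_incl h l) : expo P')).
Proof.
move=> iK iVK; have [w [w1 w2]] := specialization h iK iVK u; exists w; split=> // l.
rewrite XiE w2 -(QP_act_basis u) -(degree0_chain_prod_lat sP rootsum h_gt0 l).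
congr (QP_act u _); rewrite degree0M degree0M mulrAC -degree0M -ZXD subrr ZX0.
by rewrite (rmorph1 (@degree0 R d Phi h)) mul1r.
Qed.

End Characters.

End Assembly.

Local Open Scope classical_set_scope.

Theorem theorem3 (R : realType) (n : nat) (Phi : root_datum R n)
  (h : nat) (h_coxeter : coxeter_number Phi h)
  (RT : comNzRingType) (iota : {rmorphism ZP Phi -> RT})
  (iota_bij : bijective iota)
  (Xi : lat Phi 1 -> BT h iota) (Xi_eq : Xi_eq_family Xi) :
  exists phi : {rmorphism KT iota -> BT h iota},
    [/\ forall r : RT, phi (RT_to_KT iota r) = RT_to_BT h iota r,
        injective phi &
        range phi = subalg_gen (RT_to_BT h iota) (range Xi)].
Proof.
have [S [Suniq SP [h_gt0 cox_h cox_min]]] := h_coxeter.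
have [om omP] := fundamental_weights_exist Suniq SP.
have rootsum (l : lat Phi 1) := pos_root_sum Suniq SP omP h_gt0 cox_h cox_min (l : 'rV_n).
have [I [wd [wd_inj wd_cover]]] := weyl_finite Phi.
pose e := steinberg_basis S om wd.
have span (m : lat Phi 1) : exists2 a : I -> ZP Phi, (forall i, weyl_inv (a i)) &
    mbasis int (m : expo _) = \sum_i a i * mbasis int (e i : expo _).
  exact: (steinberg_span Suniq SP omP wd_cover m).
have /choice[s sP] l : exists t, lambda_chain l t /\ Xi l = \prod_(b <- rev t) H_elt h iota b.
  by have [t tc tE] := Xi_eq l; exists t.
(* All the chains start in the fundamental alcove, so one base point serves for every weight. *)
have [x xf] := lambda_chain_point (sP 0).1.
have pathP l := lambda_chain_apath xf (sP l).1.
have XiE l : Xi l = conj_rho iota (chain_prod h (s l)) by rewrite (sP l).2 prod_H_elt.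
have [phi phiE] := KT_map pathP rootsum h_gt0 XiE.
have phiRT t : phi (RT_to_KT iota t) = RT_to_BT h iota t.
  by rewrite /RT_to_KT phiE mconstE mextend_term -[Xi _]/(Xi 0) (Xi0 pathP XiE) mulr1.
have phiX l : phi (to_quot _ (mbasis RT (l : expo (lat Phi 1)))) = Xi l.
  by rewrite phiE mextend_basis.
exists phi; split=> //.
- have [iV iK iVK] := iota_bij.
  apply: raddf_inj => z z0.
  have [r zE] := KT_span span z.
  have rz i : @ZP_to_QP R n Phi h (iV (r i)) = 0.
    (* The specializations for all of W, applied to phi z = 0, give a linear system with the matrix
       (X^(u e_w)). *)
    move: i; apply: (steinberg_kernel span wd_inj) => j.
    have [w [w1 w2]] := specialization_Xi pathP rootsum h_gt0 XiE (wd j) iK iVK.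
    transitivity (w (phi z)); last by rewrite z0 raddf0.
    rewrite zE (raddf_sum phi) (raddf_sum w) /=; apply: eq_bigr => i _.
    by rewrite (rmorphM phi) (rmorphM w) /= phiRT w1 phiX w2 mulrC.
  have r0 i : r i = 0.
    rewrite -(iVK (r i)) (_ : iV (r i) = 0) ?raddf0 //.
    by apply: (@ZP_to_QP_inj _ _ _ h); rewrite rz raddf0.
  rewrite zE big1 // => i _.
  by rewrite r0 /RT_to_KT (raddf0 (@mconst RT _)) (raddf0 (to_quot _)) mul0r.
apply/seteqP; split=> [_ [z _ <-]|y].
  have [f ->] := to_quot_surj z; move=> B [Bring Bsub]; rewrite phiE.
  apply: subring_setT_sum => // l; have [_ _ BM] := Bring; apply: BM.
    by apply: Bsub; left; exists (mcoef l f).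
  by apply: Bsub; right; exists l.
apply; split.
  split=> [|_ _ [z1 _ <-] [z2 _ <-]|_ _ [z1 _ <-] [z2 _ <-]].
  - by exists 1; rewrite ?rmorph1.
  - by exists (z1 - z2); rewrite ?rmorphB.
  - by exists (z1 * z2); rewrite ?rmorphM.
move=> _ [[t _ <-]|[l _ <-]]; first by exists (RT_to_KT iota t).
by exists (to_quot _ (mbasis RT (l : expo (lat Phi 1)))).
Qed.
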